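(* Let $q\geq 2$ be an integer, let $H\in(0,1)$, let $B$ be a fractional Brownian motion with Hurst parameter $H$, and let $V_n=\sum_{k=0}^{n-1}H_q\big(n^H(B_{(k+1)/n}-B_{k/n})\big)$, where $H_q$ is the Hermite polynomial of degree $q$. Let $c_{1,q,H}$ (if $H<1-\frac1{2q}$) and $c_{2,q,H}$ (if $H>1-\frac1{2q}$) be the normalizing constants described in the context. For $\varepsilon>0$ set $$f_1(\varepsilon)=\sum_{n\geq1}\frac1n P\big(|V_n|>\varepsilon n\big),\qquad f_2(\varepsilon)=\sum_{n\geq1}\frac1n P\big(|V_n|>\varepsilon n^{2-2q(1-H)}\big).$$ (i) If $0<H<1-\frac1{2q}$, then $$\lim_{\varepsilon\to0}\frac{1}{-\log(c_{1,q,H}^{-1}\varepsilon)}\,f_1(\varepsilon)=2.$$ (ii) If $1-\frac1{2q}<H<1$, then $$\lim_{\varepsilon\to0}\frac{1}{-\log(c_{2,q,H}^{-1}\varepsilon)}\,f_2(\varepsilon)=\frac{1}{1-q(1-H)}.$$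
   Context: Fractional Brownian motion $(B_t)_{t\in[0,1]}$ with Hurst parameter $H\in(0,1)$ is the centered Gaussian process with covariance $\mathbf E(B_tB_s)=\frac12(t^{2H}+s^{2H}-|t-s|^{2H})$. The Hermite polynomial of degree $q$ is $H_q(x)=(-1)^qe^{x^2/2}\frac{d^q}{dx^q}(e^{-x^2/2})$. Hermite random variable of order $q$ (for $1-\frac1{2q}<H<1$): let $(W_t)_{t\in[0,1]}$ be a Wiener process and $I_q$ the multiple Wiener-It\^o integral of order $q$ with respect to $W$ (normalized so that $\mathbf E[I_q(f)^2]=q!\|f\|^2_{L^2([0,1]^q)}$ for symmetric $f$). Put $Z=d(q,H)I_q(L)$ with $$L(y_1,\ldots,y_q)=\int_{y_1\vee\cdots\vee y_q}^1\partial_1K^H(u,y_1)\cdots\partial_1K^H(u,y_q)\,du,$$ where $d(q,H)>0$ is the constant such that $\mathbf E Z^2=1$ and $K^H$ is the standard kernel of fractional Brownian motion, i.e. for $H>\frac12$, $K^H(t,s)=c_Hs^{\frac12-H}\int_s^t(u-s)^{H-\frac32}u^{H-\frac12}du$ for $0<s<t$, with $c_H>0$ a constant such that $\int_0^tK^H(t,s)dW_s$ is a fractional Brownian motion with Hurst parameter $H$. Normalizing constants: $c_{1,q,H}$ and $c_{2,q,H}$ are the (explicit, known) positive constants depending only on $q$ and $H$ such that: if $0<H<1-\frac1{2q}$, then $\frac{V_n}{c_{1,q,H}\sqrt n}$ converges in law to $N(0,1)$ as $n\to\infty$; if $1-\frac1{2q}<H<1$, then $\frac{V_n}{c_{2,q,H}n^{1-q(1-H)}}$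 converges in $L^2(\Omega)$ to the Hermite random variable $Z$ of order $q$ (where $B_t=\int_0^tK^H(t,s)dW_s$). *)

(* Defs.v *)
From HB Require Import structures.
From mathcomp Require Import all_boot all_order all_algebra.
From mathcomp Require Import all_classical all_reals all_analysis.

Set Implicit Arguments.
Unset Strict Implicit.
Unset Printing Implicit Defensive.
Import Order.TTheory GRing.Theory Num.Theory.
Import numFieldNormedType.Exports.

Local Open Scope classical_set_scope.
Local Open Scope ring_scope.

(* [H_q(x) = (-1)^q e^(x^2/2) (d^q/dx^q) e^(-x^2/2)]. *)
Definition hermite (R : realType) (q : nat) (x : R) : R :=
  (-1) ^+ q * expR (x ^+ 2 / 2) *
  derive1n q (fun y : R => expR (- (y ^+ 2 / 2))) x.

(* Degenerate (constant) variables are Gaussian; [normal_prob m 0] is a junk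
   value in the library, hence the case distinction. *)
Definition gaussian_rv d (T : measurableType d) (R : realType)
    (P : probability T R) (X : T -> R) : Prop :=
  measurable_fun [set: T] X /\
  exists m s : R, 0 <= s /\
    forall A : set R, measurable A ->
      P (X @^-1` A) = if s == 0 then \d_m A else normal_prob m s A.

(* Processes are indexed by all of [R] for convenience; only the times in
   [[0, 1]] are constrained. *)
Definition centered_gaussian_process d (T : measurableType d) (R : realType)
    (P : probability T R) (X : R -> T -> R) (C : R -> R -> R) : Prop :=
  [/\ forall (n : nat) (t a : 'I_n -> R), (forall i, t i \in `[0, 1]) ->
        gaussian_rv P (fun w => \sum_(i < n) a i * X (t i) w),
      forall t, t \in `[0, 1] -> ('E_P[X t] = 0)%E &
      forall t s, t \in `[0, 1] -> s \in `[0, 1] ->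
        ('E_P[(fun w => X t w * X s w)%R] = (C t s)%:E)%E].

Definition fbm d (T : measurableType d) (R : realType) (P : probability T R)
    (H : R) (B : R -> T -> R) : Prop :=
  centered_gaussian_process P B
    (fun t s => (t `^ (2 * H) + s `^ (2 * H) - `|t - s| `^ (2 * H)) / 2).

Definition wiener d (T : measurableType d) (R : realType) (P : probability T R)
    (W : R -> T -> R) : Prop :=
  centered_gaussian_process P W Num.min /\
  {ae P, forall w, {within `[0, 1], continuous (fun t => W t w)}}.

Definition hermite_variation (R : realType) (T : Type) (q : nat) (H : R)
    (B : R -> T -> R) (n : nat) (w : T) : R :=
  \sum_(k < n)
    hermite q (n%:R `^ H * (B (k.+1%:R / n%:R) w - B (k%:R / n%:R) w)).

Definition cvg_in_law d (T : measurableType d) (R : realType)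
    (P : probability T R) (X : nat -> T -> R)
    (mu : probability (measurableTypeR R) R) : Prop :=
  forall g : R -> R, continuous g -> (exists M, forall x, `|g x| <= M) ->
    ('E_P[g \o X n] @[n --> \oo] --> \int[mu]_x (g x)%:E)%E.

Definition cvg_in_L2 d (T : measurableType d) (R : realType)
    (P : probability T R) (X : nat -> T -> R) (Y : T -> R) : Prop :=
  ('E_P[(fun w => (X n w - Y w) ^+ 2)%R] @[n --> \oo] --> 0)%E.

Definition unit_cube (R : realType) (q : nat) : set (q.-tuple R) :=
  [set y | forall i, tnth y i \in `[0, 1]].
Arguments unit_cube : clear implicits.

(* Integral over [[0, 1]^q] as an iterated Lebesgue integral; it is only used
   for measurable nonnegative integrands, for which it is the integral against
   the product measure by Tonelli. *)
Fixpoint cube_integral (R : realType) (q : nat) :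
    (q.-tuple R -> \bar R) -> \bar R :=
  match q return (q.-tuple R -> \bar R) -> \bar R with
  | 0%N => fun f => f [tuple]
  | p.+1 => fun f =>
      (\int[@lebesgue_measure R]_(x in `[0%R, 1%R])
         @cube_integral R p (fun y => f [tuple of (x : R) :: y]))%E
  end.

(* Off-diagonal step function on a grid [t_0 <= ... <= t_m] of [[0, 1]]: it
   takes the value [coef s] on the box [\prod_i ]t_(s_i), t_(s_i + 1)]], and
   vanishes on the boxes that meet the diagonals. *)
Record elementary_kernel (R : realType) (q : nat) := ElementaryKernel {
  ek_size : nat;
  ek_grid : nat -> R;
  ek_coef : q.-tuple 'I_ek_size -> R;
  ek_grid01 : forall i, ek_grid i \in `[0, 1];
  ek_grid_nd : forall i j, (i <= j)%N -> ek_grid i <= ek_grid j;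
  ek_offdiag : forall s : q.-tuple 'I_ek_size, ~~ uniq s -> ek_coef s = 0 }.

Definition ek_fun (R : realType) (q : nat) (e : elementary_kernel R q)
    (y : q.-tuple R) : R :=
  \sum_(s : q.-tuple 'I_(ek_size e)) ek_coef s *
    \prod_(i < q)
      \1_`]ek_grid e (tnth s i), ek_grid e (tnth s i).+1] (tnth y i).

Definition ek_integral (R : realType) (q : nat) (T : Type) (W : R -> T -> R)
    (e : elementary_kernel R q) (w : T) : R :=
  \sum_(s : q.-tuple 'I_(ek_size e)) ek_coef s *
    \prod_(i < q)
      (W (ek_grid e (tnth s i).+1) w - W (ek_grid e (tnth s i)) w).

(* [X = I_q(f)] (almost surely), the multiple Wiener-Ito integral of
   [f \in L^2([0, 1]^q)]: the [L^2]-limit of the integrals of elementary kernels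
   converging to [f]. With this normalization [E (I_q f)^2 = q! |f|^2] for
   symmetric [f], and [I_1] is the Wiener integral. *)
Definition multiple_integral d (T : measurableType d) (R : realType)
    (P : probability T R) (W : R -> T -> R) (q : nat) (f : q.-tuple R -> R)
    (X : T -> R) : Prop :=
  [/\ measurable_fun (unit_cube R q) f,
      measurable_fun [set: T] X &
      exists e : nat -> elementary_kernel R q,
        (cube_integral (fun y => ((ek_fun (e k) y - f y) ^+ 2)%:E)
           @[k --> \oo] --> 0%E) /\
        cvg_in_L2 P (fun k => ek_integral W (e k)) X].

Definition fbm_kernel (R : realType) (cH H t s : R) : R :=
  if 0 < s < t then
    cH * s `^ (2^-1 - H) *
    (\int[@lebesgue_measure R]_(u in `[s, t])
       ((u - s) `^ (H - 3 / 2) * u `^ (H - 2^-1)))%R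
  else 0.

(* For [q >= 1] and [y] in the unit cube the lower bound of the integral is
   [y_1 \/ ... \/ y_q]. *)
Definition hermite_kernel (R : realType) (cH H : R) (q : nat)
    (y : q.-tuple R) : R :=
  (\int[@lebesgue_measure R]_(u in `[\big[Num.max/0]_(i < q) tnth y i, 1])
     \prod_(i < q) derive1 (fun t => fbm_kernel cH H t (tnth y i)) u)%R.

Definition hermite_rv d (T : measurableType d) (R : realType)
    (P : probability T R) (W : R -> T -> R) (cH H : R) (q : nat)
    (Z : T -> R) : Prop :=
  exists (dqH : R) (I : T -> R),
    [/\ 0 < dqH,
        multiple_integral P W (@hermite_kernel R cH H q) I,
        (forall w, Z w = dqH * I w) &
        ('E_P[(fun w => Z w ^+ 2)%R] = 1)%E].

(* The limit law determines [c], and depends on [B] only through its law, i.e.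
   through [H]. *)
Definition central_constant d (T : measurableType d) (R : realType)
    (P : probability T R) (q : nat) (H : R) (B : R -> T -> R) (c : R) : Prop :=
  0 < c /\
  cvg_in_law P (fun n w => hermite_variation q H B n w / (c * Num.sqrt n%:R))
    (normal_prob 0 1).

(* The fractional Brownian motion here is driven by a Wiener process [W] through
   the kernel [K^H], on a probability space of its own: [c] depends only on [q]
   and [H], and any single such realization determines it. *)
Definition noncentral_constant (R : realType) (q : nat) (H c : R) : Prop :=
  0 < c /\
  exists (d : measure_display) (T : measurableType d) (P : probability T R)
         (W B : R -> T -> R) (cH : R) (Z : T -> R),
    wiener P W /\ 0 < cH /\
    (forall t, t \in `[0, 1] ->
       multiple_integral P W (fun y : 1.-tuple R => fbm_kernel cH H t (thead y))
         (B t)) /\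
    fbm P H B /\
    hermite_rv P W cH H q Z /\
    cvg_in_L2 P
      (fun n w => hermite_variation q H B n w / (c * n%:R `^ (1 - q%:R * (1 - H))))
      Z.

Definition f1 d (T : measurableType d) (R : realType) (P : probability T R)
    (q : nat) (H : R) (B : R -> T -> R) (eps : R) : \bar R :=
  (\sum_(1 <= n <oo) (n%:R^-1)%:E *
     P [set w | eps * n%:R < `|hermite_variation q H B n w|]%R)%E.

Definition f2 d (T : measurableType d) (R : realType) (P : probability T R)
    (q : nat) (H : R) (B : R -> T -> R) (eps : R) : \bar R :=
  (\sum_(1 <= n <oo) (n%:R^-1)%:E *
     P [set w | eps * n%:R `^ (2 - 2 * q%:R * (1 - H)) <
                `|hermite_variation q H B n w|]%R)%E.

(* Main.v *)
(* Only two facts about V_n enter. Its second moment is computed by Mehler's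
   formula E[H_q(X) H_q(Y)] = q! (E[X Y])^q, so that by Chebyshev's inequality
   P(|V_n| > eps n) <= C / (eps n^(1/2))^2 in case (i), and
   P(|V_n| > eps n^(2 a)) <= C / (eps n^a)^2 in case (ii), a = 1 - q (1 - H).
   Conversely, V_n does not concentrate near 0: in case (i) this is read off the
   central limit theorem; in case (ii), project the increments on B_1.
   Conditionally on the orthogonal parts, V_n is a polynomial of degree q in the
   standard normal variable B_1, whose leading coefficient, the sum of the q-th
   powers of nonnegative numbers with sum n^H, is at least n^a. Hence, as
   eps -> 0, the probabilities are close to 1 for eps n^b << 1 and
   negligible for eps n^b >> 1 (b = 1/2 or a), and weighting them by 1/n counts
   log n up to -log(eps) / b. The constants c_1 and c_2 disappear in the limit.
   The independence of B_1 and of the orthogonal parts comes from the uniqueness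
   of Fourier transforms of finite measures, proved by Gaussian smoothing and
   lifted from R to R^m one coordinate at a time, using the weights
   1 + cos(U) to stay within positive measures. *)

From HB Require Import structures.
Require Import Defs.
From mathcomp Require Import all_boot all_order all_algebra.
From mathcomp Require Import all_classical all_reals all_analysis.
From mathcomp Require Import measurable_realfun ring lra zify.
Import Order.TTheory GRing.Theory Num.Theory.
Import numFieldNormedType.Exports.
Local Open Scope classical_set_scope.
Local Open Scope ring_scope.

Set Implicit Arguments.
Unset Strict Implicit.
Unset Printing Implicit Defensive.

(** * Densities and the normal law *)

(** A Gaussian process is given here through the laws of its linear combinations, so the joint law
    of a family is accessible only through its characteristic function; this is why independence has
    to come from Fourier analysis. Integrals of cos(x + b) with a free phase b contain the sines as
    well and replace complex exponentials, so that everything stays real. In case (ii) the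
    difficulty is that the law of the Hermite variable near 0 is not explicit. The bound is
    therefore proved at each fixed n: a polynomial of degree q with leading coefficient l is at most
    k in absolute value only on a set covered by q intervals of length of order (k / |l|)^(1/q),
    whatever its lower coefficients. Those are the ones that depend on the orthogonal parts, so the
    bound is uniform in the conditioning. The threshold H = 1 - 1/(2q) enters through the sum of
    r^(-q (2 - 2 H)) over r <= n, bounded exactly when q (2 - 2 H) > 1. It gives E V_n^2 = O(n) in
    case (i) and O(n^(2 a)) in case (ii). *)

Section density.
Local Open Scope ereal_scope.
Context d (T : measurableType d) (R : realType).
Variables (mu nu : {measure set T -> \bar R}) (g : T -> R).
Hypotheses (mg : measurable_fun setT g) (g0 : forall x, (0 <= g x)%R).
Hypothesis nuE :
  forall A, measurable A -> nu A = \int[mu]_(x in A) (g x)%:E.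

Import HBNNSimple.

(** Simple functions reduce to [nuE] on the level sets by linearity; the general nonnegative case
    follows by monotone convergence. *)
Let ge0_integral_density_nnsfun (f : {nnsfun T >-> R}) :
  \int[nu]_x (f x)%:E = \int[mu]_x ((f x)%:E * (g x)%:E).
Proof.
under [LHS]eq_integral do rewrite fimfunE -fsumEFin//.
rewrite [LHS]ge0_integral_fsum//; last 2 first.
  - by move=> r; exact/measurable_EFinP/measurableT_comp.
  - by move=> n x _; rewrite EFinM nnfun_muleindic_ge0.
under [RHS]eq_integral.
  move=> x xD; rewrite fimfunE -fsumEFin// muleC ge0_mule_fsumr; last first.
    by move=> r; rewrite EFinM nnfun_muleindic_ge0.
  over.
rewrite [RHS]ge0_integral_fsum//; last 2 first.
  - move=> r; apply/emeasurable_funM => //; first exact/measurable_EFinP.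
    by apply/measurable_EFinP; do 2 apply/measurableT_comp => //.
  - move=> r x _; rewrite mule_ge0 ?lee_fin// -lee_fin EFinM.
    exact: nnfun_muleindic_ge0.
apply: eq_fsbigr => r _.
rewrite integralZl_indic_nnsfun//= integral_indic//= setIT nuE//.
have [r0|r0] := leP 0%R r.
  rewrite -[RHS]/(\int[mu]_x ((g x)%:E * (r%:E * (\1_(f @^-1` [set r]) x)%:E))).
  under [RHS]eq_integral do rewrite muleCA.
  rewrite ge0_integralZl//.
  - rewrite integral_mkcond; congr (_ * _); apply: eq_integral => x _.
    by rewrite patchE indicE; case: ifP => _; rewrite ?mule1 ?mule0.
  - apply/emeasurable_funM => //; first exact/measurable_EFinP.
    exact/measurable_EFinP.
  - by move=> x _; rewrite mule_ge0// lee_fin.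
rewrite preimage_nnfun0// integral_set0 mule0 integral0_eq// => x _.
by rewrite indicE in_set0 mulr0 mule0.
Qed.

Lemma ge0_integral_density (f : T -> \bar R) : measurable_fun setT f ->
  (forall x, 0 <= f x) -> \int[nu]_x f x = \int[mu]_x (f x * (g x)%:E).
Proof.
move=> mf f0; pose f_ := nnsfun_approx measurableT mf.
transitivity (lim (\int[nu]_x (f_ n x)%:E @[n --> \oo])).
  rewrite -monotone_convergence//=.
  - apply: eq_integral => ? /[!inE] xD; apply/esym/cvg_lim => //=.
    exact: cvg_nnsfun_approx.
  - by move=> n; exact/measurable_EFinP/measurable_funTS.
  - by move=> n ? _; rewrite lee_fin.
  - by move=> ? _ ? ? mn; rewrite lee_fin; exact/lefP/nd_nnsfun_approx.
under eq_fun do rewrite ge0_integral_density_nnsfun.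
rewrite -monotone_convergence//=.
- apply: eq_integral => x _; apply/cvg_lim => //=.
  under eq_fun do rewrite muleC.
  rewrite muleC; apply: cvgeZl => //; exact: cvg_nnsfun_approx.
- by move=> n; apply/emeasurable_funM => //; exact/measurable_EFinP.
- by move=> n x _; rewrite mule_ge0// lee_fin.
- move=> x _ a b ab; apply: lee_wpmul2r; first by rewrite lee_fin.
  by rewrite lee_fin; exact/lefP/nd_nnsfun_approx.
Qed.

Lemma integrable_density (f : T -> R) : measurable_fun setT f ->
  mu.-integrable setT (EFin \o (f \* g)%R) -> nu.-integrable setT (EFin \o f).
Proof.
move=> mf /integrableP[_ fi]; apply/integrableP; split.
  exact/measurable_EFinP.
rewrite ge0_integral_density//; last first.
  by do 2 apply/measurableT_comp => //; exact/measurable_EFinP.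
apply: le_lt_trans fi; rewrite le_eqVlt; apply/orP; left; apply/eqP.
by apply: eq_integral => x _ /=; rewrite normrM EFinM (ger0_norm (g0 x)).
Qed.

Lemma integral_density (f : T -> R) : measurable_fun setT f ->
  mu.-integrable setT (EFin \o (f \* g)%R) ->
  \int[nu]_x (f x)%:E = \int[mu]_x (f x * g x)%:E.
Proof.
move=> mf fi; rewrite [LHS]integralE [RHS]integralE; congr (_ - _).
- rewrite ge0_integral_density//; last first.
    exact/measurable_funepos/measurable_EFinP.
  apply: eq_integral => x _; rewrite !funeposE -!EFin_max -EFinM.
  by rewrite maxr_pMl// mul0r.
- rewrite ge0_integral_density//; last first.
    exact/measurable_funeneg/measurable_EFinP.
  apply: eq_integral => x _; rewrite !funenegE -!EFinN -!EFin_max -EFinM.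
  by rewrite maxr_pMl// mul0r mulNr.
Qed.

End density.

(** Bundles the measure with density g, so that [weighted_law] can push it forward along a random
    variable. *)
Lemma density_measure d (T : measurableType d) (R : realType)
    (mu : {measure set T -> \bar R}) (g : T -> R) :
  measurable_fun setT g -> (forall x, 0 <= g x) ->
  exists nu : {measure set T -> \bar R},
    forall A, nu A = (\int[mu]_(x in A) (g x)%:E)%E.
Proof.
move=> mg g0.
pose n A := (\int[mu]_(x in A) (g x)%:E)%E.
have n0 : n set0 = 0%E by rewrite /n integral_set0.
have nge0 A : (0 <= n A)%E by apply: integral_ge0 => x _; rewrite lee_fin.
have nsa : semi_sigma_additive n.
  move=> F mF tF mUF; rewrite /n; apply: cvg_toP.
    by apply: is_cvg_nneseries => // k _ _; exact: nge0.
  rewrite ge0_integral_bigcup//.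
    by apply/measurable_EFinP; exact: measurable_funTS.
  by move=> x _; rewrite lee_fin.
pose M := isMeasure.Build _ _ _ n n0 nge0 nsa.
pose nu : {measure set T -> \bar R} := HB.pack n M.
by exists nu.
Qed.

(** On [[m - n, m + n]] the integral is F(m + n) - F(m - n), which tends to 0; dominated convergence
    passes to the whole line. This is integration by parts without boundary terms, as Stein's
    identity requires. *)
Lemma integral_derive0 (R : realType) (F f : R -> R) (m : R) :
  (forall x : R, is_derive x 1 F (f x)) -> continuous f ->
  lebesgue_measure.-integrable [set: R] (EFin \o f) ->
  F (m + n%:R) @[n --> \oo] --> 0 -> F (m - n%:R) @[n --> \oo] --> 0 ->
  (\int[@lebesgue_measure R]_x (f x)%:E = 0)%E.
Proof.
move=> dF cf fi Fy FNy.
have mf : measurable_fun setT f by exact: continuous_measurable_fun.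
pose f_ n x := ((f \_ `[m - n%:R, m + n%:R]) x)%:E.
have cvgf : (\int[lebesgue_measure]_x f_ n x @[n --> \oo] -->
    \int[lebesgue_measure]_x (f x)%:E)%E.
  apply: (@dominated_cvg _ _ _ lebesgue_measure setT measurableT f_
    (EFin \o f) (EFin \o (Num.norm \o f))) => //.
  - move=> n; apply/measurable_EFinP/(measurable_restrictT f) => //.
    exact: measurable_funTS.
  - move=> x _; apply: cvg_near_cst; near=> n.
    rewrite /f_ patchE mem_set//= in_itv/=.
    have : `|x - m| < n%:R by near: n; exact: nbhs_infty_gtr.
    by rewrite ltr_norml => /andP[? ?]; apply/andP; split; lra.
  - exact: integrable_norm.
  - move=> n x _; rewrite /f_ patchE lee_fin; case: ifP => // _.
    by rewrite -[X in `|X|]/(0 : R) normr0 normr_ge0.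
have E n : (\int[lebesgue_measure]_x f_ n x =
    (F (m + n%:R) - F (m - n%:R))%:E)%E.
  (* The fundamental theorem of calculus is stated for a nondegenerate interval; at n = 0 the domain
     is the null set {m}. *)
  have [->|n0] := eqVneq n 0%N.
    rewrite addr0 subr0 subrr.
    apply: etrans (integral_set1 (EFin \o f) m); rewrite [RHS]integral_mkcond.
    apply: eq_integral => x _; rewrite /f_ !patchE addr0 subr0 set_itv1.
    by case: ifP.
  rewrite EFinB -(@continuous_FTC2 _ f F).
  - rewrite [RHS]integral_mkcond; apply: eq_integral => x _.
    by rewrite /f_ !patchE; case: ifP.
  - by rewrite ltrD2l gt0_cp// ltr0n lt0n.
  - exact: continuous_subspaceT.
  - split => [x _||]; first exact: ex_derive.
      apply: cvg_at_right_filter; apply: differentiable_continuous.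
      by apply/derivable1_diffP; exact: ex_derive.
    apply: cvg_at_left_filter; apply: differentiable_continuous.
    by apply/derivable1_diffP; exact: ex_derive.
  - by move=> x _; rewrite derive1E derive_val.
move: cvgf; under eq_fun do rewrite E; move=> cvgf.
apply: (cvg_unique _ cvgf) => //.
apply: cvg_EFin; first exact: nearW.
rewrite -[X in _ --> X](subrr 0); exact: cvgB.
Unshelve. all: by end_near. Qed.

(** * Gaussian integration by parts *)

Section normal_moments.
Variables (R : realType) (m s : R).
Hypothesis s_neq0 : s != 0.
Local Notation mu := (@lebesgue_measure R).

Lemma is_derive_normal_pdf (x : R) :
  is_derive x 1 (normal_pdf m s) (- (x - m) / s ^+ 2 * normal_pdf m s x).
Proof.
rewrite (normal_pdfE _ s_neq0) /normal_fun.
pose g (y : R) : R := - (y - m) ^+ 2 / (s ^+ 2 *+ 2).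
have dg : is_derive x 1 g (- (x - m) / s ^+ 2).
  have -> : g = cst (- (s ^+ 2 *+ 2)^-1) * ((id - cst m) ^+ 2).
    by apply/funext => y; rewrite /g !fctE /= !mulNr mulrC.
  apply: is_derive_eq; rewrite !fctE /GRing.scale/=.
  by rewrite -mulr_natr; field.
have de : is_derive x 1 (expR \o g) (expR (g x) * (- (x - m) / s ^+ 2)).
  exact: is_derive1_comp.
have -> : (fun y => normal_peak s * expR (g y)) = cst (normal_peak s) * (expR \o g).
  by [].
by apply: is_derive_eq; rewrite /GRing.scale/=; rewrite /g; ring.
Qed.

(** Doubling the standard deviation multiplies the Gaussian factor by exp(c (x - m)^2) with c = 1/(2
    s^2) - 1/(8 s^2) = 3/(8 s^2), which absorbs any polynomial. The wider density then serves as an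
    integrable majorant. *)
Lemma normal_pdf_poly_bound k : exists2 C : R, 0 <= C &
  forall x, (1 + (x - m) ^+ k.*2) * normal_pdf m s x <= C * normal_pdf m (2 * s) x.
Proof.
have s20 : 2 * s != 0 by rewrite mulf_neq0.
have ss : 0 < s ^+ 2 by rewrite exprn_even_gt0.
pose c := 3 / (8 * s ^+ 2).
have c0 : 0 < c by rewrite divr_gt0// mulr_gt0.
pose K := 1 + k`!%:R * c ^- k.
have K0 : 0 <= K by rewrite addr_ge0// mulr_ge0// invr_ge0 exprn_ge0// ltW.
(* One term of the exponential series, (c y)^k / k! <= exp(c y), accounts for the second summand of
   [K]. *)
have bnd y : 0 <= y -> 1 + y ^+ k <= K * expR (c * y).
  move=> y0; rewrite /K mulrDl mul1r; apply: lerD.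
    by rewrite -expR0 ler_expR mulr_ge0// ltW.
  have cy0 : 0 <= c * y by rewrite mulr_ge0// ltW.
  have : (c * y) ^+ k <= k`!%:R * expR (c * y).
    case: k {K K0} => [|k]; first by rewrite expr0 mul1r -expR0 ler_expR.
    rewrite -ler_pdivrMl ?ltr0n ?fact_gt0// mulrC.
    by rewrite (le_trans _ (expR_ge1Dxn k cy0))// lerDr.
  rewrite exprMn => h.
  by rewrite mulrAC -ler_pdivrMr ?invr_gt0 ?exprn_gt0// invrK mulrC.
exists (K * normal_peak s / normal_peak (2 * s)).
  by rewrite mulr_ge0 ?invr_ge0 ?normal_peak_ge0// mulr_ge0 ?normal_peak_ge0.
move=> x; rewrite !normal_pdfE//.
have p0 : normal_peak (2 * s) != 0 by rewrite gt_eqF// normal_peak_gt0.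
have -> : normal_fun m (2 * s) x = normal_fun m s x * expR (c * (x - m) ^+ 2).
  rewrite /normal_fun -expRD; congr expR; rewrite /c -[s ^+ 2 *+ 2]mulr_natr.
  rewrite -[(2 * s) ^+ 2 *+ 2]mulr_natr; field; exact: s_neq0.
move: (normal_peak_ge0 s) (normal_fun_ge0 m s x).
move: (normal_peak (2 * s)) p0 (normal_peak s) (normal_fun m s x).
move=> p p0 p' f p'_ge0 f_ge0; rewrite [leRHS]mulrA divfK// mulrCA.
rewrite -[leRHS]mulrA [leRHS]mulrCA; apply: ler_wpM2l => //.
rewrite mulrC [leRHS]mulrCA; apply: ler_wpM2l => //.
by rewrite -mul2n exprM bnd// sqr_ge0.
Qed.

Lemma integrable_normal_bound k (C : R) (f : R -> R) : measurable_fun setT f ->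
  (forall x, `|f x| <= C * (1 + (x - m) ^+ k.*2)) ->
  mu.-integrable setT (EFin \o (f \* normal_pdf m s)).
Proof.
move=> mf fC; have [K K0 hK] := normal_pdf_poly_bound k.
apply: (@le_integrable _ _ _ mu setT _ _
   (fun x => (C * K)%:E * (normal_pdf m (2 * s) x)%:E)%E) => //.
- by apply/measurable_EFinP/measurable_funM => //; exact: measurable_normal_pdf.
- move=> x _; rewrite /= lee_fin [leRHS]ger0_norm; last first.
    rewrite mulr_ge0 ?normal_pdf_ge0// mulr_ge0//.
    have := le_trans (normr_ge0 _) (fC x); rewrite pmulr_lge0//.
    by rewrite ltr_pwDl// -mul2n exprM exprn_ge0// sqr_ge0.
  rewrite normrM (ger0_norm (normal_pdf_ge0 m s x)).
  have C0 : 0 <= C.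
    have := le_trans (normr_ge0 _) (fC x); rewrite pmulr_lge0//.
    by rewrite ltr_pwDl// -mul2n exprM exprn_ge0// sqr_ge0.
  apply: (le_trans (ler_wpM2r (normal_pdf_ge0 _ _ _) (fC x))).
  by rewrite -!mulrA ler_wpM2l.
- apply: integrableZl => //; exact: integrable_normal_pdf.
Qed.

Lemma integrable_normal k (C : R) (f : R -> R) : measurable_fun setT f ->
  (forall x, `|f x| <= C * (1 + (x - m) ^+ k.*2)) ->
  (normal_prob m s).-integrable setT (EFin \o f).
Proof.
move=> mf fC; apply: (@integrable_density _ _ _ mu _ (normal_pdf m s)) => //.
- exact: measurable_normal_pdf.
- by move=> x; exact: normal_pdf_ge0.
- exact: (@integrable_normal_bound k C).
Qed.

(** Stein's identity. The density satisfies phi' = -(x - m)/s^2 phi, so -s^2 f phi is a primitive of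
    ((x - m) f - s^2 f') phi; the growth bounds make this function integrable and its primitive
    vanish at infinity. *)
Lemma normal_stein k (C : R) (f f' : R -> R) :
  (forall x : R, is_derive x 1 f (f' x)) -> continuous f' ->
  (forall x, `|f x| <= C * (1 + (x - m) ^+ k.*2)) ->
  (forall x, `|f' x| <= C * (1 + (x - m) ^+ k.*2)) ->
  (forall x, `|(x - m) * f x| <= C * (1 + (x - m) ^+ k.*2)) ->
  \int[normal_prob m s]_x ((x - m) * f x) =
    s ^+ 2 * \int[normal_prob m s]_x f' x.
Proof.
move=> df cf' fC f'C xfC.
have cf : continuous f.
  move=> x; apply: differentiable_continuous.
  by apply/derivable1_diffP; exact: ex_derive.
have mpdf := @measurable_normal_pdf R m s.
have pdf0 := @normal_pdf_ge0 R m s.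
have mf : measurable_fun setT f by exact: continuous_measurable_fun.
have mf' : measurable_fun setT f' by exact: continuous_measurable_fun.
have mxf : measurable_fun setT (fun x : R => (x - m) * f x).
  by apply: measurable_funM => //; exact: measurable_funB.
have D (h : R -> R) : measurable_fun setT h ->
    (forall x, `|h x| <= C * (1 + (x - m) ^+ k.*2)) ->
    \int[normal_prob m s]_x h x = \int[mu]_x (h x * normal_pdf m s x).
  move=> mh hC; rewrite /Rintegral.
  rewrite (@integral_density _ _ _ mu _ (normal_pdf m s))//.
  exact: (integrable_normal_bound mh hC).
rewrite (D _ mxf xfC) (D _ mf' f'C).
have i1 := integrable_normal_bound mxf xfC.
have i2 := integrable_normal_bound mf' f'C.
rewrite -RintegralZl//; apply/eqP.
rewrite -subr_eq0 -RintegralB//; last exact: (integrableZl _ _ i2).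
rewrite /Rintegral; apply/eqP.
pose F x := - (s ^+ 2) * (f x * normal_pdf m s x).
pose G x := (x - m) * f x * normal_pdf m s x - s ^+ 2 * (f' x * normal_pdf m s x).
have dF (x : R) : is_derive x 1 F (G x).
  have dp := is_derive_normal_pdf x.
  have -> : F = cst (- s ^+ 2) * (f * normal_pdf m s) by [].
  by apply: is_derive_eq; rewrite /GRing.scale/= /G; field.
have cpdf := continuous_normal_pdf (m := m) s_neq0.
have Fb x : `|F x| <= s ^+ 2 * C * (1 + (x - m) ^+ k.*2) * normal_pdf m s x.
  rewrite /F !normrM normrN (ger0_norm (sqr_ge0 s)) (ger0_norm (pdf0 x)).
  move: (s ^+ 2) (sqr_ge0 s) => v v0.
  rewrite -!mulrA; apply: ler_wpM2l => //.
  by rewrite [leRHS]mulrA; apply: ler_wpM2r.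
have [K K0 hK] := normal_pdf_poly_bound k.
have s20 : 2 * s != 0 by rewrite mulf_neq0.
have C0 : 0 <= C.
  have := le_trans (normr_ge0 _) (fC 0); rewrite pmulr_lge0//.
  by rewrite ltr_pwDl// -mul2n exprM exprn_ge0// sqr_ge0.
pose c := ((2 * s) ^+ 2 *+ 2)^-1.
have c0 : 0 < c by rewrite invr_gt0 mulrn_wgt0// exprn_even_gt0.
pose M := s ^+ 2 * C * K * normal_peak (2 * s).
have M0 : 0 <= M.
  by rewrite /M mulr_ge0 ?normal_peak_ge0// mulr_ge0// mulr_ge0// sqr_ge0.
(* The squared form of the hypothesis covers both ends m + n and m - n. *)
have Fb2 (x : R) (n : nat) : (x - m) ^+ 2 = n%:R ^+ 2 ->
    `|F x| <= M * expR (- (c * n%:R ^+ 2)).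
  move=> xmn; apply: (le_trans (Fb x)); rewrite /M.
  move: (s ^+ 2) (sqr_ge0 s) => v v0; rewrite -!mulrA.
  apply: ler_wpM2l => //.
  apply: ler_wpM2l => //; apply: (le_trans (hK x)).
  rewrite normal_pdfE// /normal_fun xmn le_eqVlt; apply/orP; left; apply/eqP.
  by congr (_ * (_ * expR _)); rewrite /c mulNr mulrC.
have cn : (c * n%:R ^+ 2 : R) @[n --> \oo] --> +oo.
  apply/cvgryPge => A; near=> n.
  have : `|A| / c < n%:R by near: n; exact: nbhs_infty_gtr.
  rewrite ltr_pdivrMr// => h.
  have : 1 <= n%:R :> R by near: n; exact: nbhs_infty_ger.
  move=> n1; have : 0 <= c * (n%:R * (n%:R - 1)).
    by apply: mulr_ge0; [exact: ltW|apply: mulr_ge0; rewrite ?subr_ge0].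
  have := ler_norm A; rewrite mulrBr mulrBr mulr1 -expr2; lra.
have Mcvg : M * expR (- (c * n%:R ^+ 2)) @[n --> \oo] --> 0.
  rewrite -(mulr0 M); apply: cvgM; first exact: cvg_cst.
  by have := cvg_comp _ _ cn (@cvgr_expR R).
rewrite (@integral_derive0 _ F G m)//.
- move=> x; apply: cvgB.
    apply: cvgM; last exact: cpdf.
    apply: cvgM; last exact: cf.
    by apply: cvgB; [exact: cvg_id|exact: cvg_cst].
  by apply: cvgM; [exact: cvg_cst|apply: cvgM; [exact: cf'|exact: cpdf]].
- have := integrableB measurableT i1 (integrableZl measurableT (s ^+ 2) i2).
  by [].
- apply/cvgr0Pnorm_le => e e0; have /cvgr0_norm_le/(_ e e0) := Mcvg.
  apply: filterS => n; apply: le_trans; rewrite [leRHS]ger0_norm.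
    by apply: Fb2; rewrite addrAC subrr add0r.
  by rewrite mulr_ge0 ?expR_ge0.
- apply/cvgr0Pnorm_le => e e0; have /cvgr0_norm_le/(_ e e0) := Mcvg.
  apply: filterS => n; apply: le_trans; rewrite [leRHS]ger0_norm.
    by apply: Fb2; rewrite addrAC subrr add0r sqrrN.
  by rewrite mulr_ge0 ?expR_ge0.
Unshelve. all: by end_near. Qed.

End normal_moments.

Section normal_characteristic.
Variables (R : realType) (m s : R).
Hypothesis s_neq0 : s != 0.

Let N : probability (measurableTypeR R) R := normal_prob m s.

Lemma integrable_normal_center :
  N.-integrable setT (EFin \o (fun x : R => x - m)).
Proof.
apply: (@integrable_normal _ _ _ s_neq0 1 1).
  exact: measurable_funB.
move=> x; rewrite mul1r ler_norml; have := sqr_ge0 (x - m - 1).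
have := sqr_ge0 (x - m + 1); rewrite !expr2 => ? ?.
by apply/andP; split; nra.
Qed.

(** Stein's identity for the constant f = 1; the variance below is the case f = x - m. *)
Lemma integral_normal_center : \int[N]_x (x - m) = 0.
Proof.
have := @normal_stein _ m s s_neq0 1 1 (cst 1) (cst 0).
rewrite /cst; under eq_Rintegral do rewrite mulr1.
rewrite Rintegral_cst// mul0r mulr0; apply => //.
- by move=> x; exact: cvg_cst.
- by move=> x; rewrite mul1r normr1 lerDl sqr_ge0.
- by move=> x; rewrite mul1r normr0 addr_ge0// sqr_ge0.
- move=> x; rewrite mul1r mulr1 ler_norml; have := sqr_ge0 (x - m - 1).
  have := sqr_ge0 (x - m + 1); rewrite !expr2 => ? ?.
  by apply/andP; split; nra.
Qed.

Lemma integral_normal_center_sqr : \int[N]_x ((x - m) ^+ 2) = s ^+ 2.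
Proof.
have := @normal_stein _ m s s_neq0 1 1 (id - cst m) (cst 1).
rewrite /cst Rintegral_cst//.
have -> : fine (N setT) = 1 by rewrite probability_setT.
rewrite !mulr1; apply => //.
- by move=> x; apply: is_derive_eq; rewrite subr0.
- by move=> x; exact: cvg_cst.
- move=> x; rewrite !fctE mul1r ler_norml; have := sqr_ge0 (x - m - 1).
  have := sqr_ge0 (x - m + 1); rewrite !expr2 => ? ?.
  by apply/andP; split; nra.
- by move=> x; rewrite mul1r normr1 lerDl sqr_ge0.
- by move=> x; rewrite !fctE mul1r -expr2 ger0_norm ?sqr_ge0// lerDr.
Qed.

End normal_characteristic.

(** * Characteristic function of the normal law *)

Section normal_cos.
Variables (R : realType) (s : R).
Hypothesis s_neq0 : s != 0.

Let N : probability (measurableTypeR R) R := normal_prob 0 s.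

Let is_derive_cos_aff (a b x : R) :
  is_derive x (1 : R) (fun y => cos (a * y + b)) (- a * sin (a * x + b)).
Proof.
have h : is_derive x (1 : R) (fun y => a * y + b) a.
  have -> : (fun y => a * y + b) = cst a * id + cst b by [].
  by apply: is_derive_eq; rewrite /GRing.scale/= mulr0 mulr1 !addr0.
have := @is_derive1_comp _ cos (fun y => a * y + b) x _ _
  (is_derive_cos _) h.
by rewrite mulrC mulrN -mulNr.
Qed.

Let is_derive_sin_aff (a b x : R) :
  is_derive x (1 : R) (fun y => sin (a * y + b)) (a * cos (a * x + b)).
Proof.
have h : is_derive x (1 : R) (fun y => a * y + b) a.
  have -> : (fun y => a * y + b) = cst a * id + cst b by [].
  by apply: is_derive_eq; rewrite /GRing.scale/= mulr0 mulr1 !addr0.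
have := @is_derive1_comp _ sin (fun y => a * y + b) x _ _
  (is_derive_sin _) h.
by rewrite mulrC.
Qed.

Let continuous_aff (a b : R) : continuous (fun y : R => a * y + b).
Proof.
move=> x; apply: cvgD; last exact: cvg_cst.
by apply: cvgM; [exact: cvg_cst|exact: cvg_id].
Qed.

Let continuous_cos_aff (a b : R) : continuous (fun y : R => cos (a * y + b)).
Proof.
move=> x; apply: (@continuous_comp _ _ _ (fun y => a * y + b) cos).
  exact: continuous_aff.
exact: continuous_cos.
Qed.

Let continuous_sin_aff (a b : R) : continuous (fun y : R => sin (a * y + b)).
Proof.
move=> x; apply: (@continuous_comp _ _ _ (fun y => a * y + b) sin).
  exact: continuous_aff.
exact: continuous_sin.
Qed.

Let integrable_cos (a b : R) :
  N.-integrable setT (EFin \o (fun x => cos (a * x + b))).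
Proof.
apply: (@integrable_normal _ 0 s s_neq0 1 1).
  exact: continuous_measurable_fun.
move=> x; rewrite mul1r (le_trans (cos_max _))// lerDl sqr_ge0//.
Qed.

Let stein_sin (a b : R) : \int[N]_x (x * sin (a * x + b)) =
  s ^+ 2 * (a * \int[N]_x cos (a * x + b)).
Proof.
rewrite -RintegralZl//.
under eq_Rintegral do rewrite -[X in X * _]subr0.
pose C := 1 + `|a|.
have C1 : 1 <= C by rewrite lerDl.
have h0 (x : R) : 1 <= 1 + (x - 0) ^+ 2 by rewrite lerDl sqr_ge0.
apply: (@normal_stein _ 0 s s_neq0 1 C) => //.
- move=> x; apply: cvgM; first exact: cvg_cst.
  exact: continuous_cos_aff.
- move=> x; apply: (le_trans (sin_max _)).
  by rewrite -[leLHS]mulr1 ler_pM.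
- move=> x; rewrite normrM -[leLHS]mulr1 -mulrA; apply: ler_pM => //.
  + by rewrite lerDr.
  + by rewrite mulr1 (le_trans (cos_max _)).
- move=> x; rewrite normrM mulrC; apply: ler_pM => //.
    exact: le_trans (sin_max _) _.
  rewrite ler_norml; have := sqr_ge0 (x - 0 - 1).
  have := sqr_ge0 (x - 0 + 1); rewrite !expr2 => ? ?.
  by apply/andP; split; nra.
Qed.

(** As a function F of the frequency t, the integral can be differentiated under the integral sign
    with dominating function |x|, and Stein's identity turns the derivative into F' = -s^2 t F.
    Multiplying by the integrating factor exp(s^2 t^2 / 2) gives a constant, equal to cos b at t =
    0. *)
Lemma normal_cos (a b : R) :
  \int[N]_x cos (a * x + b) = expR (- (a * s) ^+ 2 / 2) * cos b.
Proof.
pose F (t : R) : R := \int[N]_x cos (t * x + b).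
have dF (t : R) : is_derive t (1 : R) F (- s ^+ 2 * t * F t).
  pose f (t x : R) : R := cos (t * x + b).
  have df x (u : R) :
      is_derive u (1 : R) (f ^~ x) (- x * sin (u * x + b)).
    have -> : f ^~ x = fun u => cos (x * u + b).
      by apply/funext => v; rewrite /f mulrC.
    by rewrite [u * x]mulrC; exact: is_derive_cos_aff.
  have It : (`]t - 1, t + 1[%classic : set R) t.
    by rewrite /= in_itv/=; apply/andP; split; lra.
  have intf u : (`]t - 1, t + 1[%classic : set R) u -> N.-integrable setT (EFin \o f u).
    by move=> _; exact: integrable_cos.
  have derf u (x : R) : (`]t - 1, t + 1[%classic : set R) u -> setT x -> derivable (f ^~ x) u 1.
    by move=> _ _; have := df x u => ?; exact: ex_derive.
  have intG : N.-integrable setT (EFin \o (Num.norm : R -> R)).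
    apply: (@integrable_norm _ _ _ N setT id).
    have := @integrable_normal_center R 0 s s_neq0.
    by apply: eq_integrable => // x _; rewrite /= subr0.
  have Gub u (x : R) : (`]t - 1, t + 1[%classic : set R) u -> setT x ->
      `|partial1of2 f u x| <= `|x|.
    move=> _ _; rewrite partial1of2E; have := df x u => ?; rewrite derive_val.
    by rewrite normrM normrN ler_piMr// sin_max.
  have der := @derivable_under_integral R _ _ N f setT measurableT t _ _
    It intf derf Num.norm (@normr_ge0 _ _) intG Gub.
  apply: DeriveDef => //.
  have := @differentiation_under_integral R _ _ N f setT measurableT t _ _
    It intf derf Num.norm (@normr_ge0 _ _) intG Gub.
  rewrite derive1E => ->.
  rewrite !mulNr -[X in - X]mulrA -stein_sin.
  transitivity (\int[N]_y (-1 * (y * sin (t * y + b)))).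
    apply: eq_Rintegral => x _; rewrite partial1of2E.
    by have := df x t => ?; rewrite derive_val mulN1r mulNr.
  rewrite RintegralZl ?mulN1r//.
  apply: (@integrable_normal _ 0 s s_neq0 1 1).
    apply: measurable_funM => //; exact: continuous_measurable_fun.
  move=> x; rewrite mul1r subr0 normrM.
  apply: (@le_trans _ _ `|x|); first by rewrite ler_piMr// sin_max.
  rewrite ler_norml; have := sqr_ge0 (x - 1).
  have := sqr_ge0 (x + 1); rewrite !expr2 => ? ?.
  by apply/andP; split; nra.
pose g (t : R) : R := expR (s ^+ 2 / 2 * t ^+ 2).
have dg (t : R) : is_derive t (1 : R) g (s ^+ 2 * t * g t).
  have h : is_derive t (1 : R) (fun y : R => s ^+ 2 / 2 * y ^+ 2) (s ^+ 2 * t).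
    have -> : (fun y : R => s ^+ 2 / 2 * y ^+ 2) = cst (s ^+ 2 / 2) * (id ^+ 2).
      by apply/funext => y; rewrite !fctE.
    by apply: is_derive_eq; rewrite /GRing.scale/= !fctE/=; field.
  have := @is_derive1_comp _ expR _ t _ _ (is_derive_expR _) h.
  by rewrite [X in is_derive _ _ _ X -> _]mulrC.
have Fg (t : R) : is_derive t (1 : R) (F * g) 0.
  have := dF t; have := dg t => d1 d2.
  by apply: is_derive_eq; rewrite /GRing.scale/=; ring.
have := is_derive_0_is_cst a 0 Fg; rewrite !fctE.
rewrite {2}/g expr0n/= mulr0 expR0 mulr1.
have -> : F 0 = cos b.
  rewrite /F; under eq_Rintegral do rewrite mul0r add0r.
  rewrite Rintegral_cst//.
  have -> : fine (N setT) = 1 by rewrite probability_setT.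
  by rewrite mulr1.
move=> <-; rewrite mulrCA /g -expRD [X in expR X](_ : _ = 0).
  by rewrite expR0 mulr1.
by field.
Qed.

End normal_cos.

(** * Uniqueness of characteristic functions *)

Lemma measurable_cos (R : realType) : measurable_fun [set: R] (@cos R).
Proof. by apply: continuous_measurable_fun; exact: continuous_cos. Qed.

(** Chebyshev's inequality, kept as a product to avoid division of extended reals. *)
Lemma second_moment_tail d (T : measurableType d) (R : realType)
    (mu : {measure set T -> \bar R}) (f : T -> R) (t : R) :
  measurable_fun setT f -> 0 < t ->
  ((t ^+ 2)%:E * mu [set x | t <= `|f x|]%R <= \int[mu]_x (f x ^+ 2)%:E)%E.
Proof.
move=> mf t0; set A := [set x | _].
have mA : measurable A.
  have -> : A = (Num.norm \o f) @^-1` `[t, +oo[.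
    by apply/seteqP; split => x /=; rewrite in_itv/= andbT.
  by rewrite -[X in measurable X]setTI; apply: measurableT_comp.
rewrite -[X in mu X]setIT -(integral_indic mu measurableT mA).
rewrite -ge0_integralZl//; last 2 first.
  - by apply/measurable_EFinP; exact: measurable_indic.
  - by rewrite lee_fin sqr_ge0.
apply: ge0_le_integral => //.
- by move=> x _; rewrite -EFinM lee_fin mulr_ge0 ?sqr_ge0.
- by apply: emeasurable_funM => //; apply/measurable_EFinP; exact: measurable_indic.
- by apply/measurable_EFinP; exact: measurable_funX.
- move=> x _; rewrite -EFinM lee_fin indicE.
  have [xA|xA] := boolP (x \in A); rewrite ?mulr1 ?mulr0 ?sqr_ge0//.
  move: xA; rewrite inE /A/= => tf.
  by rewrite -[leRHS]real_normK ?num_real// lerXn2r// nnegrE ltW.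
Qed.

Lemma normal_prob_far (R : realType) (m s t : R) (A : set (measurableTypeR R)) :
  s != 0 -> 0 < t -> measurable A -> (forall x, A x -> t <= `|x - m|) ->
  (normal_prob m s A <= (s ^+ 2 / t ^+ 2)%:E)%E.
Proof.
move=> s0 t0 mA At; pose N : probability (measurableTypeR R) R := normal_prob m s.
have mc : measurable_fun setT (fun x : measurableTypeR R => x - m).
  exact: measurable_funB.
have := @second_moment_tail _ _ _ N (fun x => x - m) t mc t0.
have := @integral_normal_center_sqr R m s s0.
rewrite /Rintegral -/N => E.
have -> : (\int[N]_x (((x - m) ^+ 2)%R%:E) = (s ^+ 2)%:E)%E.
  rewrite -E fineK//; apply: integrable_fin_num => //.
  apply: (@integrable_normal _ m s s0 1 1); first exact: measurable_funX.
  by move=> x; rewrite mul1r ger0_norm ?sqr_ge0// lerDr.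
move=> h; rewrite mulrC EFinM -lee_pdivrMl ?invr_gt0 ?exprn_gt0//.
rewrite invrK; apply: le_trans h; apply: lee_pmul => //.
  by rewrite lee_fin sqr_ge0.
apply: le_measure; rewrite ?inE//.
rewrite (_ : [set _ | _] = ((fun x : measurableTypeR R => `|x - m|) @^-1` `[t, +oo[)).
  have mn : measurable_fun setT (fun x : measurableTypeR R => `|x - m|).
    by apply: (measurableT_comp _ mc).
  by rewrite -[X in measurable X]setTI; apply: mn.
by apply/seteqP; split => x /=; rewrite in_itv/= andbT.
Qed.

Section fourier_uniqueness.
Variables (R : realType).
Local Notation RR := (measurableTypeR R).
Variables (mu nu : {finite_measure set RR -> \bar R}).
Hypothesis munu : forall a b : R,
  (\int[mu]_x (cos (a * x + b))%:E = \int[nu]_x (cos (a * x + b))%:E)%E.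

Let N : probability RR R := normal_prob 0 1.

(** By [normal_cos], exp(-u^2 / 2) is the mean of cos(u a) over a standard normal a. With u = (c -
    x) / s and Fubini, a Gaussian average of the measure becomes an average of its cosine
    integrals. *)
Let gauss_cosE (k : {finite_measure set RR -> \bar R}) (s c : R) :
  (\int[k]_x (expR (- ((c - x) / s) ^+ 2 / 2))%:E =
   \int[N]_a \int[k]_x (cos ((- a / s) * x + c / s * a))%:E)%E.
Proof.
pose f (z : RR * RR) : R := cos ((c - z.1) / s * z.2).
have mf : measurable_fun setT f.
  apply: measurableT_comp; first exact: measurable_cos.
  apply: measurable_funM => //; apply: measurable_funM => //.
  exact: measurable_funB.
have NT : (N setT < +oo)%E by rewrite probability_setT ltry.
have fi : (k \x N)%E.-integrable setT (EFin \o f).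
  apply: measurable_bounded_integrable => //.
  - rewrite -setXTT [ltLHS]product_measure1E//; apply: lte_mul_pinfty => //.
    by rewrite fin_num_measure.
  - exists 1; split => // M M1 z _; exact: le_trans (cos_max _) (ltW M1).
transitivity (\int[N]_y \int[k]_x (EFin \o f) (x, y))%E; last first.
  apply: eq_integral => a _; apply: eq_integral => x _.
  by rewrite /= /f/=; congr (cos _)%:E; ring.
rewrite -Fubini//; apply: eq_integral => x _.
have := @normal_cos R 1 (oner_neq0 _) ((c - x) / s) 0.
rewrite cos0 !mulr1 -/N => <-; rewrite /Rintegral fineK.
  by apply: eq_integral => a _; rewrite /f/= addr0.
apply: integrable_fin_num => //.
apply: measurable_bounded_integrable => //.
- apply: measurableT_comp; first exact: measurable_cos.
  by apply: measurable_funD => //; apply: measurable_funM.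
- exists 1; split => // M M1 z _; exact: le_trans (cos_max _) (ltW M1).
Qed.

(** The convolutions of the two measures with a normal law have the same density at every point c,
    for every width s. *)
Let smooth (s c : R) : s != 0 ->
  (\int[mu]_x (normal_pdf x s c)%:E = \int[nu]_x (normal_pdf x s c)%:E)%E.
Proof.
move=> s0.
have E (k : {finite_measure set RR -> \bar R}) :
    (\int[k]_x (normal_pdf x s c)%:E = (normal_peak s)%:E *
     \int[k]_x (expR (- ((c - x) / s) ^+ 2 / 2))%:E)%E.
  rewrite -ge0_integralZl//.
  - apply: eq_integral => x _; rewrite normal_pdfE// EFinM.
    congr (_ * (expR _)%:E)%E; rewrite -[s ^+ 2 *+ 2]mulr_natr.
    by field.
  - apply/measurable_EFinP; apply: measurableT_comp => //.
    apply: measurable_funM => //; apply: measurableT_comp => //.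
    apply: measurable_funX; apply: measurable_funM => //.
    exact: measurable_funB.
  - by rewrite lee_fin normal_peak_ge0.
rewrite !E; congr (_ * _)%E; rewrite !gauss_cosE; apply: eq_integral => a _.
exact: munu.
Qed.

Let ray (x : R) : set RR := [set` `]-oo, x]].

Let pdf_ray (s b : R) (z : RR * RR) : \bar R :=
  (normal_pdf z.1 s z.2 * \1_(ray b) z.2)%:E.

Let measurable_pdf_ray s b : s != 0 -> measurable_fun setT (pdf_ray s b).
Proof.
move=> s0; apply/measurable_EFinP; apply: measurable_funM; last first.
  apply: measurableT_comp => //; apply: measurable_indic.
  exact: measurable_itv.
rewrite (_ : (fun _ => _) = fun z : RR * RR =>
    normal_peak s * expR (- (z.2 - z.1) ^+ 2 / (s ^+ 2 *+ 2))); last first.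
  by apply/funext => z; rewrite normal_pdfE.
apply: measurable_funM => //; apply: measurableT_comp => //.
apply: measurable_funM => //; apply: measurableT_comp => //.
by apply: measurable_funX; exact: measurable_funB.
Qed.

Let pdf_ray_ge0 s b z : (0 <= pdf_ray s b z)%E.
Proof. by rewrite lee_fin mulr_ge0// normal_pdf_ge0. Qed.

Let normal_rayE s b (x : RR) : normal_prob x s (ray b) =
  (\int[lebesgue_measure]_c pdf_ray s b (x, c))%E.
Proof.
rewrite /normal_prob [LHS]integral_mkcond; apply: eq_integral => c _.
by rewrite /pdf_ray/= patchE indicE; case: ifP; rewrite ?mulr1 ?mulr0.
Qed.

Let measurable_normal_ray s b : s != 0 ->
  measurable_fun [set: RR] (fun x : RR => normal_prob x s (ray b)).
Proof.
move=> s0; under eq_fun do rewrite normal_rayE.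
apply: (measurable_fun_fubini_tonelli_F (pdf_ray s b)) => //.
exact: measurable_pdf_ray.
Qed.

Let smooth_ray (s b : R) : s != 0 ->
  (\int[mu]_x normal_prob x s (ray b) = \int[nu]_x normal_prob x s (ray b))%E.
Proof.
move=> s0.
have E (k : {finite_measure set RR -> \bar R}) :
    (\int[k]_x normal_prob x s (ray b) =
    \int[lebesgue_measure]_(c in ray b) \int[k]_x (normal_pdf x s c)%:E)%E.
  transitivity (\int[k]_x \int[lebesgue_measure]_c pdf_ray s b (x, c))%E.
    by apply: eq_integral => x _; exact: normal_rayE.
  have mf := measurable_pdf_ray b s0.
  apply: (etrans (fubini_tonelli (m1 := k) (m2 := lebesgue_measure)
    (pdf_ray s b) mf (@pdf_ray_ge0 s b))).
  rewrite [RHS]integral_mkcond.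
  apply: eq_integral => c _; rewrite /pdf_ray/= patchE indicE.
  case: ifP => _; first by under eq_integral do rewrite mulr1.
  by rewrite integral0_eq// => x _; rewrite mulr0.
rewrite !E; apply: eq_integral => c _; exact: smooth.
Qed.

Let oray (x : R) : set RR := [set` `]-oo, x[].

(** Both measures are smoothed by a normal law of standard deviation k^2, which by Chebyshev
    displaces a point by k or more with probability at most k^2. This compares mu on the ray up to b
    - 2 k with nu on the ray up to b, and k -> 0 exhausts the open ray. Equality follows by
    exchanging mu and nu. *)
Lemma fourier_ray_le (b : R) : (mu (oray b) <= nu (oray b))%E.
Proof.
have fin1 A : measurable A -> mu A \is a fin_num.
  by move=> mA; exact: fin_num_measure.
have fin2 A : measurable A -> nu A \is a fin_num.
  by move=> mA; exact: fin_num_measure.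
have mray (x : R) : measurable (ray x) by exact: measurable_itv.
have mopen (x : R) : measurable (oray x).
  exact: measurable_itv.
pose C := fine (mu setT) + fine (nu setT).
have C0 : 0 <= C by rewrite addr_ge0// fine_ge0.
have main (k : R) : 0 < k <= 1 ->
    (mu (oray (b - 2 * k)) <= nu (oray b) + (k * C)%:E)%E.
  move=> /andP[k0 k1].
  have k20 : k ^+ 2 != 0 by rewrite expf_neq0// gt_eqF.
  have kk : (k ^+ 2) ^+ 2 / k ^+ 2 = k ^+ 2 by field; exact: lt0r_neq0.
  have far (x : RR) (A : set RR) : measurable A ->
      (forall c, A c -> k <= `|c - x|) ->
      (normal_prob x (k ^+ 2) A <= (k ^+ 2)%:E)%E.
    by move=> mA Ak; rewrite -[in leRHS]kk; exact: normal_prob_far.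
  (* The mass that the smoothing sends from x into the ray up to b - k: at most k^2 if x >= b, at
     least 1 - k^2 if x < b - 2 k. *)
  pose h (x : RR) := normal_prob x (k ^+ 2) (ray (b - k)).
  have h1 x : (h x <= (\1_(oray b) x + k ^+ 2)%:E)%E.
    rewrite indicE /oray; have [xb|xb] := boolP (x \in _).
      apply: (@le_trans _ _ 1%E); first exact: probability_le1.
      by rewrite lee_fin lerDl sqr_ge0.
    rewrite add0r; apply: far => // c; rewrite /ray/= in_itv/=.
    move: xb; rewrite notin_setE/= in_itv/= => /negP; rewrite -leNgt => xb cb.
    by rewrite distrC ger0_norm; lra.
  have h2 x : (((1 - k ^+ 2) * \1_(oray (b - 2 * k)) x)%:E <= h x)%E.
    rewrite indicE /oray; have [xb|xb] := boolP (x \in _); last by rewrite mulr0.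
    rewrite mulr1 /h; have := @probability_setC _ _ _
      (normal_prob x (k ^+ 2) : probability RR R) (~` ray (b - k))
      (measurableC (mray _)).
    rewrite setCK => ->; rewrite EFinB; apply: leeB => //.
    apply: far; first exact: measurableC.
    move=> c; rewrite /ray/= in_itv/= => /negP; rewrite -ltNge => cb.
    by move: xb; rewrite inE/= in_itv/= => xb; rewrite ger0_norm; lra.
  have I2 : ((1 - k ^+ 2)%:E * mu (oray (b - 2 * k)) <= \int[mu]_x h x)%E.
    rewrite -[X in mu X]setIT -(integral_indic mu measurableT (mopen _)).
    rewrite -ge0_integralZl//; last 2 first.
    - by apply/measurable_EFinP; exact: measurable_indic.
    - by rewrite lee_fin subr_ge0 expr_le1// ltW.
    apply: ge0_le_integral => //.
    - move=> x _; rewrite -EFinM lee_fin mulr_ge0//.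
      by rewrite subr_ge0 expr_le1// ltW.
    - apply: emeasurable_funM => //.
      by apply/measurable_EFinP; exact: measurable_indic.
    - exact: measurable_normal_ray.
    - by move=> x _; rewrite -EFinM; exact: h2.
  have I1 : (\int[nu]_x h x <=
      nu (oray b) + (k ^+ 2)%:E * nu setT)%E.
    rewrite -[X in nu X + _]setIT -(integral_indic nu measurableT (mopen _)).
    rewrite -[X in (_ <= _ + X)%E]integral_cst// -ge0_integralD//; last 2 first.
    - by apply/measurable_EFinP; exact: measurable_indic.
    - by move=> x _; rewrite /= lee_fin sqr_ge0.
    apply: ge0_le_integral => //.
    - exact: measurable_normal_ray.
    - apply: emeasurable_funD => //.
      by apply/measurable_EFinP; exact: measurable_indic.
  have {I1 I2} : ((1 - k ^+ 2)%:E * mu (oray (b - 2 * k)) <=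
      nu (oray b) + (k ^+ 2)%:E * nu setT)%E.
    by apply: le_trans I2 _; rewrite smooth_ray.
  rewrite -(fineK (fin1 _ (mopen _))) -(fineK (fin2 _ (mopen _))).
  rewrite -(fineK (fin2 _ measurableT)) -!EFinM -!EFinD !lee_fin => vu.
  have u_le : fine (mu (oray (b - 2 * k))) <= fine (mu setT).
    apply: fine_le; [exact: fin1 (mopen _)|exact: fin1|].
    by apply: le_measure => //; rewrite inE//; exact: mopen.
  have nT0 : 0 <= fine (nu setT) by rewrite fine_ge0.
  rewrite /C in C0 *; move: vu u_le nT0 C0.
  move: (fine (mu (oray (b - 2 * k)))) (fine (mu setT)) (fine (nu setT)).
  move: (fine (nu (oray b))) => v u U M vu uU M0 UM0.
  have u0 : 0 <= k ^+ 2 * (U - u) by rewrite mulr_ge0 ?sqr_ge0 ?subr_ge0.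
  have : 0 <= k * (1 - k) * (U + M).
    by rewrite mulr_ge0// mulr_ge0 ?subr_ge0// ltW.
  by nra.
have le1 (k0 : R) : 0 < k0 -> (mu (oray (b - 2 * k0)) <= nu (oray b))%E.
  move=> k00; apply/lee_addgt0Pr => e e0.
  (* Below k0 for monotonicity of the rays, below 1 as [main] requires, and small enough that the
     error k C is at most e. *)
  pose k := Num.min (Num.min k0 1) (e / (C + 1)).
  have C1 : 0 < C + 1 by rewrite ltr_wpDl.
  have k_gt0 : 0 < k by rewrite !lt_min k00 ltr01 divr_gt0.
  have kk0 : k <= k0 by rewrite !ge_min lexx.
  have k1 : k <= 1 by rewrite !ge_min lexx orbT.
  have ke : k * (C + 1) <= e by rewrite -ler_pdivlMr// !ge_min lexx orbT.
  apply: (@le_trans _ _ (mu (oray (b - 2 * k)))).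
    apply: le_measure; rewrite ?inE//; try exact: mopen.
    by move=> x; rewrite /oray/= !in_itv/=; lra.
  apply: (le_trans (main k _)); first by rewrite k_gt0.
  by rewrite leeD2l// lee_fin; nra.
have U : oray b = \bigcup_n oray (b - 2 * n.+1%:R^-1).
  apply/seteqP; split => x; rewrite /oray/= ?in_itv/=.
    move=> xb; exists (Num.trunc (2 / (b - x))) => //=; rewrite in_itv/=.
    rewrite ltrBrDr -ltrBrDl ltr_pdivrMr//.
    by rewrite mulrC -ltr_pdivrMr ?subr_gt0// Num.Theory.truncnS_gt.
  move=> [n _]/=; rewrite in_itv/= => h; apply: (lt_le_trans h).
  by rewrite gerBl mulr_ge0// invr_ge0.
have ndF : nondecreasing_seq (fun n : nat => oray (b - 2 * n.+1%:R^-1)).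
  move=> n m nm; apply/subsetPset => x; rewrite /oray/= !in_itv/= => h.
  apply: (lt_le_trans h); rewrite lerD2l lerN2 ler_pM2l//.
  by rewrite lef_pV2 ?posrE ?ltr0n// ler_nat.
rewrite [X in mu X]U; have /cvg_lim <- // := @nondecreasing_cvg_mu _ _ _ mu
  (fun n : nat => oray (b - 2 * n.+1%:R^-1)) (fun n => mopen _)
  (bigcupT_measurable _ (fun n => mopen _)) ndF.
apply: lime_le; first exact: (ereal_nondecreasing_is_cvgn
  (fun n m nm => le_measure _ (mem_set (mopen _)) (mem_set (mopen _))
     (subsetPset _ _ (ndF n m nm)))).
by apply: nearW => n /=; apply: le1; rewrite invr_gt0.
Qed.

End fourier_uniqueness.

Lemma fourier_uniqueness (R : realType)
    (mu nu : {finite_measure set (measurableTypeR R) -> \bar R}) :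
  (forall a b : R, (\int[mu]_x (cos (a * x + b))%:E =
                    \int[nu]_x (cos (a * x + b))%:E)%E) ->
  forall A, measurable A -> mu A = nu A.
Proof.
move=> munu A mA; pose g (n : nat) : set (measurableTypeR R) := [set` `]-oo, n%:R[].
apply: (@measure_unique _ R (measurableTypeR R) (@RGenInftyO.G R) g
  _ _ _ _ mu nu _ _ A mA) => //.
- exact: RGenInftyO.measurableE.
- move=> _ _ [x ->] [y ->]; exists (Num.min x y); apply/seteqP; split => z /=.
    by rewrite !in_itv/= lt_min => -[-> ->].
  by rewrite !in_itv/= lt_min => /andP[].
- by move=> n; exists n%:R.
- apply/seteqP; split => x //= _; exists (Num.trunc `|x|).+1 => //=.
  by rewrite /g/= in_itv/= (le_lt_trans (ler_norm x))// Num.Theory.truncnS_gt.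
- move=> _ [x ->]; apply/eqP; rewrite eq_le !fourier_ray_le//.
- move=> n; rewrite -ge0_fin_numE//; apply: fin_num_measure.
  exact: measurable_itv.
Qed.

Lemma bounded_integrable d (T : measurableType d) (R : realType)
    (P : probability T R) (f : T -> R) (M : R) :
  measurable_fun setT f -> (forall w, `|f w| <= M) ->
  P.-integrable setT (EFin \o f).
Proof.
move=> mf fM; apply: measurable_bounded_integrable => //.
  by rewrite [X in (X < _)%E]probability_setT ltry.
by exists M; split; [exact: num_real|move=> N MN w _; exact: le_trans (ltW MN)].
Qed.

(** The law of X under the measure with density G. Admitting a bounded nonnegative weight is what
    makes the induction on coordinates in [joint_law_boxes] possible. *)
Lemma weighted_law d (T : measurableType d) (R : realType)
    (P : probability T R) (X G : T -> R) (M : R) :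
  measurable_fun setT X -> measurable_fun setT G ->
  (forall w, 0 <= G w <= M) ->
  exists k : {finite_measure set (measurableTypeR R) -> \bar R},
    (forall A, measurable A -> k A = (\int[P]_w (G w * \1_A (X w)))%:E) /\
    (forall a b, (\int[k]_x (cos (a * x + b))%:E =
                  (\int[P]_w (G w * cos (a * X w + b)))%:E)%E).
Proof.
move=> mX mG GM; have G0 w : 0 <= G w by have /andP[] := GM w.
have M0 : 0 <= M by have /andP[] := GM point; exact: le_trans.
have [nu nuE] := density_measure P mG G0.
have mcos a b : measurable_fun setT (fun w => cos (a * X w + b)).
  apply: measurableT_comp; first exact: measurable_cos.
  by apply: measurable_funD => //; exact: measurable_funM.
have nuE' (A : set (measurableTypeR R)) : measurable A ->
    nu (X @^-1` A) = (\int[P]_w (G w * \1_A (X w)))%:E.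
  move=> mA; have mXA : measurable (X @^-1` A).
    by rewrite -[X in measurable X]setTI; exact: mX.
  rewrite nuE /Rintegral fineK.
    rewrite integral_mkcond; apply: eq_integral => w _.
    rewrite patchE indicE (_ : (w \in X @^-1` A) = (X w \in A)).
      by case: ifP; rewrite ?mulr1 ?mulr0.
    by apply/idP/idP; rewrite !inE.
  apply: integrable_fin_num => //; apply: (@bounded_integrable _ _ _ _ _ M).
    apply: measurable_funM => //.
    apply: (@measurableT_comp _ _ _ _ _ _ (\1_A : R -> R) _ X) => //.
  move=> w; have /andP[_ GwM] := GM w; rewrite normrM (ger0_norm (G0 w)).
  rewrite -[leRHS]mulr1; apply: ler_pM => //.
  by rewrite indicE; case: (_ \in _); rewrite ?normr1 ?normr0.
pose XR : T -> measurableTypeR R := X.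
have mXR : measurable_fun setT XR by [].
pose k1 : {measure set (measurableTypeR R) -> \bar R} := pushforward nu XR.
pose k0 := k1 mXR.
have k0fin : fin_num_fun k0.
  by move=> A mA; rewrite /k0/= /pushforward nuE'.
pose k : {finite_measure set (measurableTypeR R) -> \bar R} :=
  HB.pack (Measure.sort k0) (@Measure_isFinite.Build _ _ R k0 k0fin).
exists k; split => [A mA|a b]; first exact: nuE'.
transitivity (\int[pushforward nu XR]_x (cos (a * x + b))%:E)%E => //.
have Gcos : P.-integrable setT (EFin \o (fun w => G w * cos (a * X w + b))).
  apply: (@bounded_integrable _ _ _ _ _ M); first exact: measurable_funM.
  move=> w; have /andP[_ GwM] := GM w; rewrite normrM (ger0_norm (G0 w)).
  by rewrite -[leRHS]mulr1; apply: ler_pM => //; exact: cos_max.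
have Gcos' : P.-integrable setT (EFin \o ((fun w => cos (a * X w + b)) \* G)).
  by apply: eq_integrable Gcos => // w _ /=; rewrite mulrC.
have nucos : nu.-integrable setT (EFin \o (fun w => cos (a * X w + b))).
  exact: (integrable_density mG G0 (fun A _ => nuE A)).
rewrite (integral_pushforward mXR) //; last first.
  apply/measurable_EFinP; apply: measurableT_comp; first exact: measurable_cos.
  by apply: measurable_funD => //; exact: measurable_funM.
rewrite preimage_setT.
rewrite [LHS](@integral_density _ _ _ P _ G mG G0 (fun A _ => nuE A)
  (fun w => cos (a * X w + b)))//.
rewrite /Rintegral fineK; last exact: integrable_fin_num.
by apply: eq_integral => w _; rewrite mulrC.
Qed.

Lemma weighted_law_unique (R : realType)
    d (T : measurableType d) (P : probability T R) (X G : T -> R)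
    d' (T' : measurableType d') (P' : probability T' R) (X' G' : T' -> R)
    (M M' : R) :
  measurable_fun setT X -> measurable_fun setT G -> (forall w, 0 <= G w <= M) ->
  measurable_fun setT X' -> measurable_fun setT G' -> (forall w, 0 <= G' w <= M') ->
  (forall a b, \int[P]_w (G w * cos (a * X w + b)) =
               \int[P']_w (G' w * cos (a * X' w + b))) ->
  forall A, measurable A -> \int[P]_w (G w * \1_A (X w)) =
                            \int[P']_w (G' w * \1_A (X' w)).
Proof.
move=> mX mG GM mX' mG' GM' h A mA.
have [k [kA kcos]] := weighted_law P mX mG GM.
have [k' [kA' kcos']] := weighted_law P' mX' mG' GM'.
apply: EFin_inj; rewrite -kA// -kA'//.
by apply: fourier_uniqueness => // a b; rewrite kcos kcos' h.
Qed.

(** * Joint laws determined by cosine integrals *)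

Lemma measurable_cos_comp d (T : measurableType d) (R : realType) (U : T -> R) :
  measurable_fun setT U -> measurable_fun setT (fun w => cos (U w)).
Proof. by move=> mU; apply: measurableT_comp => //; exact: measurable_cos. Qed.

Lemma measurable_indic_comp d (T : measurableType d) (R : realType)
    (U : T -> R) (A : set R) : measurable A ->
  measurable_fun setT U -> measurable_fun setT (fun w => \1_A (U w) : R).
Proof.
move=> mA mU; apply: (@measurableT_comp _ _ _ _ _ _ (\1_A : R -> R) _ U) => //.
Qed.

Section cos_weight.
Context d (T : measurableType d) (R : realType) (P : probability T R).
Variables (G U V : T -> R) (M : R).
Hypotheses (mG : measurable_fun setT G) (GM : forall w, 0 <= G w <= M).
Hypotheses (mU : measurable_fun setT U) (mV : measurable_fun setT V).

Let integrable_G (f : T -> R) : measurable_fun setT f ->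
  (forall w, `|f w| <= 1) -> P.-integrable setT (EFin \o (fun w => G w * f w)).
Proof.
move=> mf f1; apply: (@bounded_integrable _ _ _ _ _ M).
  exact: measurable_funM.
move=> w; have /andP[G0 GwM] := GM w; rewrite normrM (ger0_norm G0).
by rewrite -[leRHS]mulr1; apply: ler_pM.
Qed.

Let integrable_cos (W : T -> R) : measurable_fun setT W ->
  P.-integrable setT (EFin \o (fun w => G w * cos (W w))).
Proof.
move=> mW; apply: integrable_G; first exact: measurable_cos_comp.
by move=> w; exact: cos_max.
Qed.

(** The product cos U cos V is half of cos(V + U) + cos(V - U), so the weight G (1 + cos U) yields
    only cosine integrals with weight G. *)
Lemma Rintegral_weight_cos :
  \int[P]_w (G w * (1 + cos (U w)) * cos (V w)) = \int[P]_w (G w * cos (V w)) +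
  2^-1 * (\int[P]_w (G w * cos (V w + U w)) + \int[P]_w (G w * cos (V w - U w))).
Proof.
have iV := integrable_cos mV.
have iD := integrable_cos (measurable_funD mV mU).
have iB := integrable_cos (measurable_funB mV mU).
rewrite -RintegralD// -RintegralZl//; last first.
  exact: (integrableD measurableT iD iB).
rewrite -RintegralD//; last first.
  exact: (integrableZl measurableT _ (integrableD measurableT iD iB)).
by apply: eq_Rintegral => w _; rewrite cosD cosB; field.
Qed.

Lemma Rintegral_weight_indic (A : set R) : measurable A ->
  \int[P]_w (G w * (1 + cos (U w)) * \1_A (V w)) =
  \int[P]_w (G w * \1_A (V w)) + \int[P]_w (G w * \1_A (V w) * cos (U w)).
Proof.
move=> mA; have mAV := measurable_indic_comp mA mV.
have A1 w : `|\1_A (V w) : R| <= 1.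
  by rewrite indicE; case: (_ \in _); rewrite ?normr1 ?normr0.
have iV := integrable_G mAV A1.
have iU : P.-integrable setT (EFin \o (fun w => G w * \1_A (V w) * cos (U w))).
  under [X in _.-integrable _ (_ \o X)]eq_fun do rewrite -mulrA.
  apply: integrable_G; first by apply: measurable_funM => //; exact: measurable_cos_comp.
  by move=> w; rewrite normrM mulr_ile1// cos_max.
rewrite -RintegralD//.
by apply: eq_Rintegral => w _; ring.
Qed.

End cos_weight.

(** Induction on m with the weight generalized: the indicator of the first coordinate is absorbed
    into [G], and the remaining coordinates are handled by the induction hypothesis. *)
Lemma joint_law_boxes (R : realType) m
    d (T : measurableType d) (P : probability T R) (X : 'I_m -> T -> R) (G : T -> R)
    d' (T' : measurableType d') (P' : probability T' R) (X' : 'I_m -> T' -> R)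
    (G' : T' -> R) (M : R) :
  (forall i, measurable_fun setT (X i)) -> measurable_fun setT G ->
  (forall w, 0 <= G w <= M) ->
  (forall i, measurable_fun setT (X' i)) -> measurable_fun setT G' ->
  (forall w, 0 <= G' w <= M) ->
  (forall (a : 'I_m -> R) b,
    \int[P]_w (G w * cos (\sum_i a i * X i w + b)) =
    \int[P']_w (G' w * cos (\sum_i a i * X' i w + b))) ->
  forall A : 'I_m -> set R, (forall i, measurable (A i)) ->
    \int[P]_w (G w * \prod_i \1_(A i) (X i w)) =
    \int[P']_w (G' w * \prod_i \1_(A i) (X' i w)).
Proof.
elim: m T P X G T' P' X' G' => [|m IH] T P X G T' P' X' G' mX mG GM mX' mG' GM' h A mA.
  transitivity (\int[P]_w (G w * cos (\sum_i 0 * X i w + 0))).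
    by apply: eq_Rintegral => w _; rewrite !big_ord0 addr0 cos0.
  rewrite (h (fun=> 0)); apply: eq_Rintegral => w _.
  by rewrite !big_ord0 addr0 cos0.
pose S (a : 'I_m -> R) w := \sum_i a i * X (lift ord0 i) w.
pose S' (a : 'I_m -> R) w := \sum_i a i * X' (lift ord0 i) w.
have mS a : measurable_fun setT (S a).
  by apply: measurable_sum => i; exact: measurable_funM.
have mS' a : measurable_fun setT (S' a).
  by apply: measurable_sum => i; exact: measurable_funM.
have H c a b : \int[P]_w (G w * cos (c * X ord0 w + (S a w + b))) =
    \int[P']_w (G' w * cos (c * X' ord0 w + (S' a w + b))).
  pose ca i := oapp a c (unlift ord0 i).
  have E w : \sum_i ca i * X i w = c * X ord0 w + S a w.
    rewrite big_ord_recl /ca unlift_none/=; congr +%R.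
    by apply: eq_bigr => i _; rewrite liftK.
  have E' w : \sum_i ca i * X' i w = c * X' ord0 w + S' a w.
    rewrite big_ord_recl /ca unlift_none/=; congr +%R.
    by apply: eq_bigr => i _; rewrite liftK.
  transitivity (\int[P]_w (G w * cos (\sum_i ca i * X i w + b))).
    by apply: eq_Rintegral => w _; rewrite E addrA.
  by rewrite h; apply: eq_Rintegral => w _; rewrite E' addrA.
have S0 w : S (fun=> 0) w = 0 by rewrite /S big1// => i _; rewrite mul0r.
have S'0 w : S' (fun=> 0) w = 0 by rewrite /S' big1// => i _; rewrite mul0r.
have H0 c b : \int[P]_w (G w * cos (c * X ord0 w + b)) =
    \int[P']_w (G' w * cos (c * X' ord0 w + b)).
  transitivity (\int[P]_w (G w * cos (c * X ord0 w + (S (fun=> 0) w + b)))).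
    by apply: eq_Rintegral => w _; rewrite S0 add0r.
  by rewrite H; apply: eq_Rintegral => w _; rewrite S'0 add0r.
have mA0 := mA ord0.
have I0 : \int[P]_w (G w * \1_(A ord0) (X ord0 w)) =
    \int[P']_w (G' w * \1_(A ord0) (X' ord0 w)).
  exact: (weighted_law_unique (mX ord0) mG GM (mX' ord0) mG' GM' H0).
(* The hypothesis of the induction for the weight G 1_A(X_0). One-dimensional uniqueness is applied
   to X_0 under the nonnegative weight G (1 + cos U); subtracting [I0], the same identity under G,
   leaves the term with cos U. *)
have I1 a b : \int[P]_w (G w * \1_(A ord0) (X ord0 w) * cos (S a w + b)) =
    \int[P']_w (G' w * \1_(A ord0) (X' ord0 w) * cos (S' a w + b)).
  pose U w := S a w + b; pose U' w := S' a w + b.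
  have mU : measurable_fun setT U by exact: measurable_funD.
  have mU' : measurable_fun setT U' by exact: measurable_funD.
  have W2 : forall w, 0 <= G w * (1 + cos (U w)) <= M * 2.
    move=> w; have /andP[G0 GwM] := GM w; have := cos_geN1 (U w).
    by have := cos_le1 (U w) => ? ?; apply/andP; split; nra.
  have W2' : forall w, 0 <= G' w * (1 + cos (U' w)) <= M * 2.
    move=> w; have /andP[G0 GwM] := GM' w; have := cos_geN1 (U' w).
    by have := cos_le1 (U' w) => ? ?; apply/andP; split; nra.
  have mW : measurable_fun setT (fun w => G w * (1 + cos (U w))).
    apply: measurable_funM => //; apply: measurable_funD => //.
    exact: measurable_cos_comp.
  have mW' : measurable_fun setT (fun w => G' w * (1 + cos (U' w))).
    apply: measurable_funM => //; apply: measurable_funD => //.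
    exact: measurable_cos_comp.
  have E : (forall c e, \int[P]_w (G w * (1 + cos (U w)) * cos (c * X ord0 w + e)) =
      \int[P']_w (G' w * (1 + cos (U' w)) * cos (c * X' ord0 w + e))) ->
      \int[P]_w (G w * (1 + cos (U w)) * \1_(A ord0) (X ord0 w)) =
      \int[P']_w (G' w * (1 + cos (U' w)) * \1_(A ord0) (X' ord0 w)).
    move=> h0.
    exact: (weighted_law_unique (mX ord0) mW W2 (mX' ord0) mW' W2' h0 mA0).
  rewrite (Rintegral_weight_indic P mG GM mU (mX ord0) mA0) in E.
  rewrite (Rintegral_weight_indic P' mG' GM' mU' (mX' ord0) mA0) I0 in E.
  apply: (addrI (\int[P']_w (G' w * \1_(A ord0) (X' ord0 w)))).
  apply: E => c e; pose V w := c * X ord0 w + e; pose V' w := c * X' ord0 w + e.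
  have mV : measurable_fun setT V.
    by apply: measurable_funD => //; exact: measurable_funM.
  have mV' : measurable_fun setT V'.
    by apply: measurable_funD => //; exact: measurable_funM.
  rewrite [LHS](Rintegral_weight_cos P mG GM mU mV).
  rewrite [RHS](Rintegral_weight_cos P' mG' GM' mU' mV') H0.
  congr (_ + _ * (_ + _)).
    transitivity (\int[P]_w (G w * cos (c * X ord0 w + (S a w + (b + e))))).
      by apply: eq_Rintegral => w _; congr (_ * cos _); rewrite /V /U; ring.
    by rewrite H; apply: eq_Rintegral => w _; congr (_ * cos _); rewrite /V' /U'; ring.
  (* Parity of the cosine replaces V - U by U - V, so that [S a] keeps its sign and [H] applies with
     frequency -c. *)
  transitivity (\int[P]_w (G w * cos (- c * X ord0 w + (S a w + (b - e))))).
    apply: eq_Rintegral => w _; rewrite -cosN; congr (_ * cos _).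
    by rewrite /V /U; ring.
  rewrite H; apply: eq_Rintegral => w _; rewrite -cosN; congr (_ * cos _).
  by rewrite /V' /U'; ring.
pose K w := G w * \1_(A ord0) (X ord0 w).
pose K' w := G' w * \1_(A ord0) (X' ord0 w).
have KM w : 0 <= K w <= M.
  have /andP[G0 GwM] := GM w; rewrite /K indicE.
  by case: (_ \in _); rewrite ?mulr1 ?mulr0 ?G0 ?lexx// (le_trans G0).
have KM' w : 0 <= K' w <= M.
  have /andP[G0 GwM] := GM' w; rewrite /K' indicE.
  by case: (_ \in _); rewrite ?mulr1 ?mulr0 ?G0 ?lexx// (le_trans G0).
have mK : measurable_fun setT K.
  by apply: measurable_funM => //; exact: measurable_indic_comp.
have mK' : measurable_fun setT K'.
  by apply: measurable_funM => //; exact: measurable_indic_comp.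
have := IH T P (fun i => X (lift ord0 i)) K T' P' (fun i => X' (lift ord0 i)) K'
  (fun i => mX _) mK KM (fun i => mX' _) mK' KM' I1 (fun i => A (lift ord0 i))
  (fun i => mA _).
rewrite (@eq_Rintegral _ _ _ P _ (fun w => G w * \prod_i \1_(A i) (X i w))).
  move=> ->; apply: eq_Rintegral => w _.
  by rewrite big_ord_recl mulrA.
by move=> w _; rewrite big_ord_recl mulrA.
Qed.

Section joint_law.
Context (R : realType) (m : nat).
Context d (T : measurableType d) (P : probability T R) (X : 'I_m -> T -> R).
Context d' (T' : measurableType d') (P' : probability T' R).
Variable X' : 'I_m -> T' -> R.
Hypothesis mX : forall i, measurable_fun setT (X i).
Hypothesis mX' : forall i, measurable_fun setT (X' i).
Hypothesis XX' : forall (a : 'I_m -> R) b,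
  \int[P]_w cos (\sum_i a i * X i w + b) =
  \int[P']_w cos (\sum_i a i * X' i w + b).

Let TR := m.-tuple (measurableTypeR R).
Let tX (w : T) : TR := [tuple X i w | i < m].
Let tX' (w : T') : TR := [tuple X' i w | i < m].

Let mtX : measurable_fun setT tX.
Proof.
apply/measurable_fun_tnthP => i.
rewrite (_ : _ \o _ = X i); first exact: mX.
by apply/funext => w; rewrite /= tnth_mktuple.
Qed.

Let mtX' : measurable_fun setT tX'.
Proof.
apply/measurable_fun_tnthP => i.
rewrite (_ : _ \o _ = X' i); first exact: mX'.
by apply/funext => w; rewrite /= tnth_mktuple.
Qed.

Let box (A : 'I_m -> set (measurableTypeR R)) : set TR :=
  [set t | forall i, A i (tnth t i)].

Let boxes : set (set TR) :=
  [set B | exists2 A, (forall i, measurable (A i)) & B = box A].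

Let measurable_box A : (forall i, measurable (A i)) -> measurable (box A).
Proof.
move=> mA; have -> : box A = \bigcap_(i in [set: 'I_m]) ((@tnth m _ ^~ i) @^-1` A i).
  by apply/seteqP; split => t h; [move=> i _; exact: h|move=> i; exact: h].
apply: fin_bigcap_measurable => // i _.
by rewrite -[X in measurable X]setTI; apply: measurable_tnth.
Qed.

(** A cylinder over one coordinate is a box with full sides elsewhere; conversely a box is a finite
    intersection of cylinders. Boxes are stable under intersection, as [measure_unique] demands. *)
Let measurable_tupleE : @measurable _ TR = <<s boxes >>.
Proof.
apply/seteqP; split => [B|].
  apply: smallest_sub; first exact: smallest_sigma_algebra.
  apply: (big_ind (fun S => S `<=` <<s boxes >>)) => // [S1 S2 h1 h2|i _].
  - by move=> ? [] => [/h1|/h2].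
  - move=> _ [Y mY <-]; apply: sub_sigma_algebra.
    exists (fun j => if j == i then Y else setT).
      by move=> j; case: ifP.
    apply/seteqP; split => t /=.
      by move=> [_ Yt] j; case: eqVneq => // ->.
    by move=> h; split => //; have := h i; rewrite eqxx.
apply: smallest_sub; first exact: sigma_algebra_measurable.
by move=> _ [A mA ->]; exact: measurable_box.
Qed.

(** The factor 1 is the constant weight with which [joint_law_boxes] is applied. *)
Let boxE d0 (T0 : measurableType d0) (P0 : probability T0 R) (X0 : 'I_m -> T0 -> R)
    (mX0 : forall i, measurable_fun setT (X0 i)) A :
  (forall i, measurable (A i)) ->
  P0 [set w | box A [tuple X0 i w | i < m]] =
  (\int[P0]_w (1 * \prod_i \1_(A i) (X0 i w)))%:E.
Proof.
move=> mA; set B := [set w | _].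
have mB : measurable B.
  have -> : B = \bigcap_(i in [set: 'I_m]) (X0 i @^-1` A i).
    apply/seteqP; split => w.
      by move=> h i _; have := h i; rewrite tnth_mktuple.
    by move=> h i; rewrite tnth_mktuple; exact: h.
  apply: fin_bigcap_measurable => // i _.
  by rewrite -[X in measurable X]setTI; apply: mX0 => //; exact: mA.
rewrite -[X in P0 X]setIT -(integral_indic P0 measurableT mB) /Rintegral.
have E w : \1_B w = 1 * \prod_i \1_(A i) (X0 i w) :> R.
  rewrite mul1r indicE; have [|] := boolP (w \in B).
    rewrite inE => h; rewrite big1// => i _; have := h i.
    by rewrite tnth_mktuple => hi; rewrite indicE mem_set.
  rewrite notin_setE => /existsNP[i]; rewrite tnth_mktuple => hi.
  by rewrite (bigD1 i)//= indicE memNset// mul0r.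
under eq_integral do rewrite E; rewrite fineK//.
apply: integrable_fin_num => //.
apply: (@bounded_integrable _ _ _ _ _ 1) => [|w].
  by under eq_fun do rewrite -E; exact: measurable_indic.
by rewrite -E indicE; case: (_ \in _); rewrite ?normr1 ?normr0.
Qed.

Let joint_law_pushforward (D : set TR) : measurable D ->
  pushforward P tX D = pushforward P' tX' D.
Proof.
pose k1 : {measure set TR -> \bar R} := pushforward P tX.
pose k2 : {measure set TR -> \bar R} := pushforward P' tX'.
move=> mD; apply: (@measure_unique _ R TR boxes (fun=> setT) _ _ _ _
  (k1 mtX) (k2 mtX') _ _ D mD) => //.
- move=> _ _ [A mA ->] [B mB ->]; exists (fun i => A i `&` B i).
    by move=> i; exact: measurableI.
  apply/seteqP; split => t /=; first by move=> [hA hB] i; split.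
  by move=> h; split => i; have [] := h i.
- by move=> _; exists (fun=> setT) => //; apply/seteqP.
- by rewrite bigcup_const.
- move=> _ [A mA ->].
  rewrite -[LHS]/(P [set w | box A (tX w)]) -[RHS]/(P' [set w | box A (tX' w)]).
  rewrite !boxE//; congr EFin.
  apply: (@joint_law_boxes _ _ _ _ P X (cst 1) _ _ P' X' (cst 1) 1) => //.
  - by move=> w; rewrite /cst ler01 lexx.
  - by move=> w; rewrite /cst ler01 lexx.
  move=> a b; rewrite /cst; under eq_Rintegral do rewrite mul1r.
  by rewrite XX'; apply: eq_Rintegral => w _; rewrite mul1r.
- by move=> _; rewrite /= /pushforward preimage_setT probability_setT ltry.
Qed.

Lemma joint_law_ge0_integral (F : m.-tuple R -> \bar R) :
  measurable_fun [set: TR] F -> (forall t, 0 <= F t)%E ->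
  (\int[P]_w F [tuple X i w | i < m] = \int[P']_w F [tuple X' i w | i < m])%E.
Proof.
move=> mF F0.
transitivity (\int[pushforward P tX]_t F t)%E.
  by rewrite (ge0_integral_pushforward mtX)// preimage_setT.
rewrite (eq_measure_integral (pushforward P' tX')); last first.
  by move=> D mD _; exact: joint_law_pushforward.
by rewrite (ge0_integral_pushforward mtX')// preimage_setT.
Qed.

Local Open Scope ereal_scope.

Lemma joint_law_integral (F : m.-tuple R -> R) :
  measurable_fun [set: TR] F ->
  (\int[P]_w (F [tuple X i w | i < m])%:E =
   \int[P']_w (F [tuple X' i w | i < m])%:E)%E.
Proof.
move=> mF.
rewrite [LHS]integralE [RHS]integralE; congr (_ - _)%E.
- have E : (EFin \o F)^\+ = fun t => maxe (F t)%:E 0.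
    by apply/funext => t; rewrite funeposE.
  have mF' : measurable_fun [set: TR] (fun t => maxe (F t)%:E 0).
    by rewrite -E; apply: measurable_funepos; exact/measurable_EFinP.
  under eq_integral do rewrite funeposE.
  rewrite (joint_law_ge0_integral mF'); last by move=> t; rewrite le_max lexx orbT.
  by apply: eq_integral => w _; rewrite funeposE.
- have E : (EFin \o F)^\- = fun t => maxe (- (F t)%:E) 0.
    by apply/funext => t; rewrite funenegE.
  have mF' : measurable_fun [set: TR] (fun t => maxe (- (F t)%:E) 0).
    by rewrite -E; apply: measurable_funeneg; exact/measurable_EFinP.
  under eq_integral do rewrite funenegE.
  rewrite (joint_law_ge0_integral mF'); last by move=> t; rewrite le_max lexx orbT.
  by apply: eq_integral => w _; rewrite funenegE.
Qed.

End joint_law.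

(** * Gaussian spaces *)

Section law.
Context d (T : measurableType d) (R : realType) (P : probability T R).
Variables (X : T -> R) (k : {measure set (measurableTypeR R) -> \bar R}).
Hypothesis mX : measurable_fun setT X.
Hypothesis Xk : forall A : set R, measurable A -> P (X @^-1` A) = k A.
Local Open Scope ereal_scope.

Let XR : T -> measurableTypeR R := X.

Let mXR : measurable_fun setT XR. Proof. by []. Qed.

Lemma law_ge0_integral (f : R -> \bar R) : measurable_fun setT f ->
  (forall x, 0 <= f x) -> \int[P]_w f (X w) = \int[k]_x f x.
Proof.
move=> mf f0.
transitivity (\int[pushforward P XR]_x f x).
  by rewrite (ge0_integral_pushforward mXR)// preimage_setT.
by apply: eq_measure_integral => A mA _; exact: Xk.
Qed.

Lemma law_integral (f : R -> R) : measurable_fun setT f ->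
  \int[P]_w (f (X w))%:E = \int[k]_x (f x)%:E.
Proof.
move=> mf; rewrite [LHS]integralE [RHS]integralE; congr (_ - _).
- have E : (EFin \o f)^\+ = fun t => maxe (f t)%:E 0.
    by apply/funext => t; rewrite funeposE.
  have mf' : measurable_fun [set: R] (fun t => maxe (f t)%:E 0).
    by rewrite -E; apply: measurable_funepos; exact/measurable_EFinP.
  under eq_integral do rewrite funeposE.
  rewrite (law_ge0_integral mf'); last by move=> t; rewrite le_max lexx orbT.
  by apply: eq_integral => w _; rewrite funeposE.
- have E : (EFin \o f)^\- = fun t => maxe (- (f t)%:E) 0.
    by apply/funext => t; rewrite funenegE.
  have mf' : measurable_fun [set: R] (fun t => maxe (- (f t)%:E) 0).
    by rewrite -E; apply: measurable_funeneg; exact/measurable_EFinP.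
  under eq_integral do rewrite funenegE.
  rewrite (law_ge0_integral mf'); last by move=> t; rewrite le_max lexx orbT.
  by apply: eq_integral => w _; rewrite funenegE.
Qed.

Lemma law_integrable (f : R -> R) : measurable_fun setT f ->
  k.-integrable setT (EFin \o f) -> P.-integrable setT (EFin \o (f \o X)).
Proof.
move=> mf /integrableP[_ fi]; apply/integrableP; split.
  by apply/measurable_EFinP; exact: measurableT_comp.
rewrite (law_ge0_integral (f := fun x => `|(f x)%:E|))//.
by apply: measurableT_comp => //; exact/measurable_EFinP.
Qed.

End law.

Section centered_gaussian_rv.
Context d (T : measurableType d) (R : realType) (P : probability T R).
Variable X : T -> R.
Hypotheses (gX : gaussian_rv P X) (EX : ('E_P[X] = 0)%E).

(** [gaussian_rv] allows any mean and separates s = 0; in each of the two cases the vanishing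
    expectation forces m = 0. *)
Lemma centered_gaussian_law :
  (forall A : set R, measurable A -> P (X @^-1` A) = \d_(0 : R) A) \/
  (exists2 s, s != 0 & forall A : set R, measurable A ->
    P (X @^-1` A) = normal_prob 0 s A).
Proof.
have [mX [m [s [s0 XA]]]] := gX.
have [s_eq0|s_neq0] := eqVneq s 0.
  left; have Xm (A : set R) : measurable A -> P (X @^-1` A) = \d_m A.
    by move=> mA; rewrite XA// s_eq0 eqxx.
  have I (f : R -> R) : measurable_fun setT f ->
      (\int[P]_w (f (X w))%:E = (f m)%:E)%E.
    move=> mf; rewrite (law_integral (k := dirac (m : measurableTypeR R)) mX Xm)//.
    rewrite integral_dirac//; first by rewrite diracT mul1e.
    exact/measurable_EFinP.
  have m0 : m = 0.
    apply: EFin_inj; apply: etrans EX; rewrite unlock.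
    by symmetry; exact: (I id).
  by rewrite -m0.
right; exists s => //; have Xm (A : set R) : measurable A ->
    P (X @^-1` A) = normal_prob m s A.
  by move=> mA; rewrite XA// (negbTE s_neq0).
pose N : probability (measurableTypeR R) R := normal_prob m s.
have m0 : m = 0.
  have i1 : N.-integrable setT (EFin \o (fun x : R => x - m)).
    exact: integrable_normal_center.
  have i2 : N.-integrable setT (EFin \o (cst m : R -> R)).
    by apply: (@bounded_integrable _ _ _ _ _ `|m|) => // x; exact: lexx.
  apply: EFin_inj; apply: etrans EX; rewrite unlock; symmetry.
  apply: (etrans (law_integral (k := N) mX Xm (f := id) _)) => //.
  have -> : (\int[N]_x (id x)%:E = \int[N]_x ((x - m)%:E + (cst m x)%:E))%E.
    by apply: eq_integral => x _; rewrite -EFinD subrK.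
  rewrite (integralD measurableT i1 i2).
  have := @integral_normal_center R m s s_neq0; rewrite /Rintegral -/N.
  move=> h; rewrite -[X in (X + _)%E]fineK; last exact: integrable_fin_num.
  rewrite h add0e -[LHS]/(\int[N]_x cst m%:E x)%E integral_cst// [X in (_ * X)%E]probability_setT.
  by rewrite mule1.
by rewrite -m0.
Qed.

Lemma centered_gaussian_integrableX k :
  P.-integrable setT (EFin \o (fun w => X w ^+ k)).
Proof.
have [mX _] := gX.
have mk : measurable_fun setT (fun x : R => x ^+ k) by exact: measurable_funX.
case: centered_gaussian_law => [XA|[s s0 XA]].
  apply: (@law_integrable _ _ _ P _ (dirac (0 : measurableTypeR R)) mX XA _ mk).
  apply/integrableP; split; first exact/measurable_EFinP.
  rewrite integral_dirac//=; last first.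
    by apply/measurable_EFinP; apply: measurableT_comp.
  by rewrite diracT mul1e ltry.
pose N : probability (measurableTypeR R) R := normal_prob 0 s.
apply: (@law_integrable _ _ _ P _ N mX XA _ mk).
apply: (@integrable_normal _ 0 s s0 k 1) => // x.
rewrite mul1r subr0 -mul2n mulnC exprM normrX.
have := sqr_ge0 (`|x| ^+ k - 1).
have : 0 <= `|x| ^+ k by rewrite exprn_ge0.
rewrite -[x ^+ k ^+ 2]real_normK ?num_real// normrX.
by rewrite !expr2 => ? ?; nra.
Qed.

Lemma normal_second_moment (s : R) : s != 0 ->
  (forall A : set R, measurable A -> P (X @^-1` A) = normal_prob 0 s A) ->
  \int[P]_w (X w ^+ 2) = s ^+ 2.
Proof.
move=> s0 XA; have [mX _] := gX.
have m2 : measurable_fun setT (fun x : R => x ^+ 2) by exact: measurable_funX.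
pose N : probability (measurableTypeR R) R := normal_prob 0 s.
rewrite /Rintegral (law_integral (k := N) mX XA m2).
rewrite -(@integral_normal_center_sqr R 0 s s0) /Rintegral.
by congr fine; apply: eq_integral => x _; rewrite subr0.
Qed.

(** Written with the second moment instead of s, the formula also holds for the Dirac law, and needs
    no case distinction afterwards. *)
Lemma centered_gaussian_cos b :
  \int[P]_w cos (X w + b) = expR (- (\int[P]_w (X w ^+ 2)) / 2) * cos b.
Proof.
have [mX _] := gX.
have mcos : measurable_fun setT (fun x : R => cos (x + b)).
  by apply: measurable_cos_comp; exact: measurable_funD.
have m2 : measurable_fun setT (fun x : R => x ^+ 2) by exact: measurable_funX.
case: centered_gaussian_law => [XA|[s s0 XA]].
  rewrite /Rintegral (law_integral (k := dirac (0 : measurableTypeR R)) mX XA mcos).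
  rewrite (law_integral (k := dirac (0 : measurableTypeR R)) mX XA m2).
  rewrite !integral_dirac//; last 2 first.
  - exact/measurable_EFinP.
  - exact/measurable_EFinP.
  by rewrite diracT !mul1e/= expr0n/= oppr0 mul0r expR0 mul1r add0r.
rewrite (normal_second_moment s0 XA) /Rintegral.
pose N : probability (measurableTypeR R) R := normal_prob 0 s.
rewrite (law_integral (k := N) mX XA mcos).
have := @normal_cos R s s0 1 b; rewrite mul1r => <-; rewrite /Rintegral -/N.
by under [in RHS]eq_integral do rewrite mul1r.
Qed.

Lemma standard_gaussian_law : \int[P]_w (X w ^+ 2) = 1 ->
  forall A : set R, measurable A -> P (X @^-1` A) = normal_prob 0 1 A.
Proof.
have [mX _] := gX.
have m2 : measurable_fun setT (fun x : R => x ^+ 2) by exact: measurable_funX.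
move=> X1; case: centered_gaussian_law => [XA|[s s0 XA]].
  move: X1; rewrite /Rintegral.
  rewrite (law_integral (k := dirac (0 : measurableTypeR R)) mX XA m2).
  rewrite integral_dirac//; last exact/measurable_EFinP.
  by rewrite diracT mul1e/= expr0n/= => /esym/eqP; rewrite oner_eq0.
move: X1; rewrite (normal_second_moment s0 XA) => /eqP.
(* [centered_gaussian_law] retains only s != 0, so s = -1 remains; the density depends on s through
   s^2. *)
rewrite sqrf_eq1 => /orP[] /eqP s1; move: XA; rewrite s1 //.
move=> XA A mA; rewrite XA// /normal_prob.
apply: eq_integral => x _.
by rewrite !normal_pdfE ?oppr_eq0// /normal_peak /normal_fun sqrrN.
Qed.

End centered_gaussian_rv.

(** All linear combinations of members are centered Gaussian, which is joint Gaussianity. With 0 in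
    S, the single closure condition gives both sums and multiples. *)
Definition gaussian_space d (T : measurableType d) (R : realType)
    (P : probability T R) (S : set (T -> R)) : Prop :=
  [/\ forall X, S X -> gaussian_rv P X /\ ('E_P[X] = 0)%E,
      S (fun=> 0) &
      forall (a : R) X Y, S X -> S Y -> S (fun w => a * X w + Y w)].

Section gaussian_space.
Context d (T : measurableType d) (R : realType) (P : probability T R).
Variable S : set (T -> R).
Hypothesis gS : gaussian_space P S.

Lemma gaussian_space_sum m (a : 'I_m -> R) (X : 'I_m -> T -> R) :
  (forall i, S (X i)) -> S (fun w => \sum_i a i * X i w).
Proof.
have [_ S0 SD] := gS; elim: m a X => [|m IH] a X SX.
  by under eq_fun do rewrite big_ord0.
by under eq_fun do rewrite big_ord_recl; apply: SD => //; exact: IH.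
Qed.

Lemma gaussian_space_measurable X : S X -> measurable_fun setT X.
Proof. by have [h _ _] := gS => /h[[]]. Qed.

Lemma gaussian_space_integrableX X k : S X ->
  P.-integrable setT (EFin \o (fun w => X w ^+ k)).
Proof.
by have [h _ _] := gS => /h[gX EX]; exact: centered_gaussian_integrableX gX EX k.
Qed.

Lemma gaussian_space_integrableM X Y : S X -> S Y ->
  P.-integrable setT (EFin \o (fun w => X w * Y w)).
Proof.
move=> SX SY; have iX := gaussian_space_integrableX 2 SX.
have iY := gaussian_space_integrableX 2 SY.
apply: (le_integrable measurableT _ _ (integrableD measurableT iX iY)).
  by apply/measurable_EFinP; apply: measurable_funM; exact: gaussian_space_measurable.
move=> w _; rewrite /= lee_fin [leRHS]ger0_norm ?addr_ge0 ?sqr_ge0//.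
by rewrite ler_norml; apply/andP; split; nra.
Qed.

Lemma gaussian_space_cos X b : S X ->
  \int[P]_w cos (X w + b) = expR (- (\int[P]_w (X w ^+ 2)) / 2) * cos b.
Proof.
by have [h _ _] := gS => /h[gX EX]; exact: centered_gaussian_cos gX EX b.
Qed.

Lemma gaussian_space_sqrD X Y : S X -> S Y ->
  \int[P]_w (X w * Y w) = 0 ->
  \int[P]_w ((X w + Y w) ^+ 2) = \int[P]_w (X w ^+ 2) + \int[P]_w (Y w ^+ 2).
Proof.
move=> SX SY XY; have iX := gaussian_space_integrableX 2 SX.
have iY := gaussian_space_integrableX 2 SY.
have iXY := gaussian_space_integrableM SX SY.
transitivity (\int[P]_w ((X w ^+ 2 + Y w ^+ 2) + 2 * (X w * Y w))).
  by apply: eq_Rintegral => w _; ring.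
rewrite RintegralD//; last 2 first.
- exact: (integrableD measurableT iX iY).
- exact: (integrableZl measurableT _ iXY).
by rewrite RintegralD// RintegralZl// XY mulr0 addr0.
Qed.

Section independence.
Variables (m : nat) (xi : T -> R) (Y : 'I_m -> T -> R).
Hypotheses (Sxi : S xi) (SY : forall i, S (Y i)).
Hypothesis xiY : forall i, \int[P]_w (xi w * Y i w) = 0.

(** The list (xi, Y_0, ..., Y_(m-1)), with xi at index 0. [X'] is the same list on the product
    space, with xi and the Y_i read at two independent points; independence is the equality of the
    two joint laws. *)
Let X (i : 'I_m.+1) w := oapp (Y ^~ w) (xi w) (unlift ord0 i).
Let X' (i : 'I_m.+1) (z : T * T) := oapp (Y ^~ z.2) (xi z.1) (unlift ord0 i).

Let mX i : measurable_fun setT (X i).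
Proof.
by rewrite /X; case: unliftP => [j|] _ /=; exact: gaussian_space_measurable.
Qed.

Let mX' i : measurable_fun setT (X' i).
Proof.
rewrite /X'; case: unliftP => [j|] _ /=; apply: measurableT_comp => //;
  exact: gaussian_space_measurable.
Qed.

(** Orthogonality of xi to each Y_i makes the variance of a linear combination the sum of those of
    its xi part and its Y part, so the Gaussian exponential factorizes exactly as on the product
    space. *)
Let XX' (a : 'I_m.+1 -> R) b :
  \int[P]_w cos (\sum_i a i * X i w + b) =
  \int[(P \x P)%E]_z cos (\sum_i a i * X' i z + b).
Proof.
pose U w := \sum_i a (lift ord0 i) * Y i w.
have SU : S U by exact: gaussian_space_sum.
have [_ S0 SD] := gS.
have Sa : S (fun w => a ord0 * xi w).
  by have := SD (a ord0) xi _ Sxi S0; under eq_fun do rewrite addr0.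
have EL w : \sum_i a i * X i w = a ord0 * xi w + U w.
  rewrite big_ord_recl /X unlift_none; congr +%R.
  by apply: eq_bigr => i _; rewrite liftK.
have ER z : \sum_i a i * X' i z = a ord0 * xi z.1 + U z.2.
  rewrite big_ord_recl /X' unlift_none; congr +%R.
  by apply: eq_bigr => i _; rewrite liftK.
have mU := gaussian_space_measurable SU.
have ma := gaussian_space_measurable Sa.
have aU : \int[P]_w (a ord0 * xi w * U w) = 0.
  transitivity (\int[P]_w (\sum_i (a ord0 * a (lift ord0 i)) * (xi w * Y i w))).
    apply: eq_Rintegral => w _; rewrite /U mulr_sumr.
    by apply: eq_bigr => i _; ring.
  rewrite /Rintegral; under eq_integral do rewrite -sumEFin.
  rewrite integral_sum//; last first.
    move=> i; exact: (integrableZl measurableT (a ord0 * a (lift ord0 i))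
      (gaussian_space_integrableM Sxi (SY i))).
  rewrite big1// => i _.
  have iM := gaussian_space_integrableM Sxi (SY i).
  have := RintegralZl (a ord0 * a (lift ord0 i)) measurableT iM.
  rewrite xiY mulr0 /Rintegral => h; rewrite -[LHS]fineK ?h//.
  apply: integrable_fin_num => //.
  exact: (integrableZl measurableT (a ord0 * a (lift ord0 i)) iM).
transitivity (\int[P]_w cos ((a ord0 * xi w + U w) + b)).
  by apply: eq_Rintegral => w _; rewrite EL.
rewrite gaussian_space_cos ?gaussian_space_sqrD//; last first.
  by under eq_fun do rewrite -[a ord0 * _]mul1r; exact: SD.
pose f (z : T * T) := cos (a ord0 * xi z.1 + (U z.2 + b)).
have mf : measurable_fun setT f.
  apply: measurable_cos_comp; apply: measurable_funD.
    by apply: (measurableT_comp ma).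
  by apply: measurable_funD => //; apply: (measurableT_comp mU).
have fi : (P \x P)%E.-integrable setT (EFin \o f).
  by apply: (@bounded_integrable _ _ _ (P \x P)%E _ 1) => // z; exact: cos_max.
transitivity (\int[(P \x P)%E]_z f z); last first.
  by apply: eq_Rintegral => z _; rewrite ER /f addrA.
pose e := expR (- (\int[P]_w ((a ord0 * xi w) ^+ 2)) / 2).
have icos c : P.-integrable setT (EFin \o (fun w => cos (a ord0 * xi w + c))).
  apply: (@bounded_integrable _ _ _ _ _ 1) => [|w]; last exact: cos_max.
  by apply: measurable_cos_comp; exact: measurable_funD.
have iU : P.-integrable setT (EFin \o (fun w => cos (U w + b))).
  apply: (@bounded_integrable _ _ _ _ _ 1) => [|w]; last exact: cos_max.
  by apply: measurable_cos_comp; exact: measurable_funD.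
have -> : \int[(P \x P)%E]_z f z = \int[P]_y (e * cos (U y + b)).
  rewrite [LHS]/Rintegral -(integral21_prod_meas1 fi); congr fine.
  apply: eq_integral => y _; rewrite -(gaussian_space_cos (U y + b) Sa).
  rewrite [RHS]fineK//; exact: (integrable_fin_num measurableT (icos _)).
rewrite RintegralZl// gaussian_space_cos//.
by rewrite mulrA -expRD; congr (expR _ * _); ring.
Qed.

(** The inner integral runs over xi with the orthogonal part frozen at v; this is how conditioning
    on the orthogonal part is expressed. *)
Lemma gaussian_indep_ge0 (F : m.+1.-tuple R -> \bar R) :
  measurable_fun [set: m.+1.-tuple (measurableTypeR R)] F ->
  (forall t, 0 <= F t)%E ->
  (\int[P]_w F [tuple X i w | i < m.+1] =
   \int[P]_v \int[P]_w F [tuple X' i (w, v) | i < m.+1])%E.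
Proof.
move=> mF F0; rewrite (joint_law_ge0_integral mX mX' XX')//.
pose tX' (z : T * T) : m.+1.-tuple (measurableTypeR R) := [tuple X' i z | i < m.+1].
have mtX' : measurable_fun setT tX'.
  apply/measurable_fun_tnthP => i.
  rewrite (_ : _ \o _ = X' i); first exact: mX'.
  by apply/funext => w; rewrite /= tnth_mktuple.
have mG : measurable_fun setT (F \o tX') by exact: measurableT_comp.
exact: (fubini_tonelli2 (m1 := P) (m2 := P) (F \o tX') mG (fun z => F0 _)).
Qed.

Lemma gaussian_indep (F : m.+1.-tuple R -> R) :
  measurable_fun [set: m.+1.-tuple (measurableTypeR R)] F ->
  P.-integrable setT (EFin \o (fun w => F [tuple X i w | i < m.+1])) ->
  (\int[P]_w (F [tuple X i w | i < m.+1])%:E =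
   \int[P]_v \int[P]_w (F [tuple X' i (w, v) | i < m.+1])%:E)%E.
Proof.
move=> mF /integrableP[_ iF]; rewrite (joint_law_integral mX mX' XX')//.
pose tX' (z : T * T) : m.+1.-tuple (measurableTypeR R) := [tuple X' i z | i < m.+1].
have mtX' : measurable_fun setT tX'.
  apply/measurable_fun_tnthP => i.
  rewrite (_ : _ \o _ = X' i); first exact: mX'.
  by apply/funext => w; rewrite /= tnth_mktuple.
have mG : measurable_fun setT (F \o tX') by exact: measurableT_comp.
have iG : (P \x P)%E.-integrable setT (EFin \o (F \o tX')).
  apply/integrableP; split; first exact/measurable_EFinP.
  move: iF; rewrite (joint_law_ge0_integral mX mX' XX' (F := fun t => `|(F t)%:E|%E))//.
  by apply/measurableT_comp => //; exact/measurable_EFinP.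
by rewrite -(integral21_prod_meas1 iG).
Qed.

End independence.

End gaussian_space.

(** * Hermite polynomials *)

(** The recurrence produced by differentiating H_p(x) exp(-x^2 / 2) once more and changing the sign;
    [hermiteE] identifies it with [hermite]. *)
Fixpoint hermite_poly (R : realType) (q : nat) : {poly R} :=
  if q is p.+1 then 'X * hermite_poly R p - (hermite_poly R p)^`() else 1.

Lemma leq_size_deriv (R : nzRingType) (p : {poly R}) :
  (size p^`() <= size p)%N.
Proof.
have [->|p0] := eqVneq p 0; first by rewrite deriv0.
exact/ltnW/lt_size_deriv.
Qed.
Arguments leq_size_deriv {R} p.

Section hermite_poly.
Variable R : realType.
Local Notation hp := (hermite_poly R).

Lemma hermiteE q (x : R) : hermite q x = (hp q).[x].
Proof.
pose e (y : R) := expR (- (y ^+ 2 / 2)).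
have de (y : R) : is_derive y (1 : R) e (- y * e y).
  have h : is_derive y (1 : R) (fun z : R => - (z ^+ 2 / 2)) (- y).
    have -> : (fun z : R => - (z ^+ 2 / 2)) = cst (- 2^-1) * (id ^+ 2).
      by apply/funext => z; rewrite !fctE mulNr mulrC.
    by apply: is_derive_eq; rewrite /GRing.scale/= !fctE/=; field.
  have := @is_derive1_comp _ expR _ y _ _ (is_derive_expR _) h.
  by rewrite [X in is_derive _ _ _ X -> _]mulrC.
have De n : derive1n n e = fun y => (-1) ^+ n * (hp n).[y] * e y.
  elim: n => [|n IH]; apply/funext => y.
    by rewrite derive1n0 expr0 hornerC !mul1r.
  rewrite derive1nS IH derive1E.
  have d1 : is_derive y (1 : R) (horner (hp n) * e)
      ((hp n).[y] * (- y * e y) + e y * (hp n)^`().[y]).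
    have := de y; have := is_derive_poly (hp n) y => d1 d2.
    by apply: is_derive_eq.
  have -> : (fun y => (-1) ^+ n * (hp n).[y] * e y) =
      cst ((-1) ^+ n) * (horner (hp n) * e).
    by apply/funext => z; rewrite !fctE mulrA.
  rewrite derive_val /GRing.scale/= !fctE !hornerE exprS.
  by rewrite /=; ring.
rewrite /hermite -/e De.
transitivity (((-1) ^+ q) ^+ 2 * (expR (x ^+ 2 / 2) * e x) * (hp q).[x]).
  by rewrite [in RHS]expr2; ring.
by rewrite sqrr_sign /e expRxMexpNx_1 !mul1r.
Qed.

Lemma deriv_hermite_poly q : (hp q.+1)^`() = q.+1%:R *: hp q.
Proof.
elim: q => [|q IH].
  by rewrite /= mulr1 derivB derivX derivC deriv0 subr0 scale1r.
rewrite -[hp q.+2]/('X * hp q.+1 - (hp q.+1)^`()) derivB derivM derivX mul1r IH.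
rewrite derivZ -addrA -scalerAr -scalerBr -[X in _ + X]/(q.+1%:R *: hp q.+1).
by rewrite -[X in X + _]scale1r -scalerDl addrC natr1.
Qed.

Lemma size_hermite_poly q : (size (hp q) <= q.+1)%N.
Proof.
elim: q => [|q IH]; first by rewrite size_poly1.
rewrite (leq_trans (size_polyD _ _))// geq_max size_polyN; apply/andP; split.
  by rewrite (leq_trans (size_polyMleq _ _))// size_polyX.
by rewrite (leq_trans (leq_size_deriv _))// (leq_trans IH).
Qed.

(** Each derivative lowers the degree and yields a factor r by the chain rule
    ([deriv_hermite_poly]), so the result does not depend on the shift c. Both Mehler's formula and
    the deterministic leading coefficient of V_n rest on this. *)
Lemma derivn_hermite_aff q (r c : R) :
  (hp q \Po (r *: 'X + c%:P))^`(q) = (r ^+ q * q`!%:R)%:P.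
Proof.
elim: q => [|q IH]; first by rewrite derivn0 comp_polyC expr0 mul1r.
rewrite derivSn deriv_comp deriv_hermite_poly.
rewrite derivD derivZ derivX derivC addr0 alg_polyC comp_polyZ.
rewrite mulrC mul_polyC scalerA derivnZ IH -mul_polyC -polyCM.
by congr (_%:P); rewrite factS natrM exprS; ring.
Qed.

(** The difference with 0 and the even exponent reproduce the growth condition of [normal_stein] at
    mean 0. *)
Lemma poly_bound (p : {poly R}) k : (size p <= k)%N -> exists2 C : R, 0 <= C &
  forall x, `|p.[x]| <= C * (1 + (x - 0) ^+ k.*2).
Proof.
move=> pk; exists (\sum_(i < size p) `|p`_i|); first by rewrite sumr_ge0.
move=> x; rewrite subr0 horner_coef (le_trans (ler_norm_sum _ _ _))// mulr_suml.
apply: ler_sum => i _; rewrite normrM ler_wpM2l//.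
have -> : x ^+ k.*2 = `|x| ^+ k.*2.
  by rewrite -mul2n !exprM real_normK ?num_real.
rewrite normrX; have [x1|x1] := leP `|x| 1.
  by rewrite (@le_trans _ _ 1)// ?exprn_ile1// lerDl exprn_ge0.
rewrite (@le_trans _ _ (`|x| ^+ k.*2))// ?lerDr ?ler01//.
by rewrite ler_eXn2l// -addnn (leq_trans (ltnW (ltn_ord i)))// (leq_trans pk)// leq_addl.
Qed.

Local Notation N := (normal_prob 0 1 : probability (measurableTypeR R) R).

Lemma measurable_horner (p : {poly R}) : measurable_fun [set: R] (horner p).
Proof. by apply: continuous_measurable_fun; exact: continuous_horner. Qed.

Lemma integrable_normal_poly (p : {poly R}) :
  N.-integrable setT (EFin \o horner p).
Proof.
have [C _ hC] := poly_bound (leqnn (size p)).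
apply: (@integrable_normal _ 0 1 (oner_neq0 _) (size p) C) => //.
exact: measurable_horner.
Qed.

Lemma normal_polyX (p : {poly R}) : \int[N]_x ('X * p).[x] = \int[N]_x p^`().[x].
Proof.
have s1 : (size ('X * p)%R <= (size p).+1)%N.
  by rewrite (leq_trans (size_polyMleq _ _))// size_polyX.
have s2 : (size p <= (size p).+1)%N by [].
have s3 : (size p^`() <= (size p).+1)%N.
  by rewrite (leq_trans (leq_size_deriv _)).
have [C1 C10 h1] := poly_bound s1; have [C2 C20 h2] := poly_bound s2.
have [C3 C30 h3] := poly_bound s3.
pose C := C1 + C2 + C3.
have hx (x : R) : 0 <= 1 + (x - 0) ^+ (size p).+1.*2.
  by rewrite addr_ge0// -mul2n exprM exprn_ge0// sqr_ge0.
have := @normal_stein R 0 1 (oner_neq0 _) (size p).+1 C (horner p)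
  (horner p^`()).
rewrite expr1n mul1r => <-.
- by apply: eq_Rintegral => x _; rewrite subr0 !hornerE.
- exact: continuous_horner.
- by move=> x; apply: (le_trans (h2 x)); rewrite ler_wpM2r ?hx// /C; lra.
- by move=> x; apply: (le_trans (h3 x)); rewrite ler_wpM2r ?hx// /C; lra.
- move=> x; have := h1 x; rewrite !hornerE subr0 => /le_trans; apply.
  by have := hx x; rewrite subr0 => ?; rewrite ler_wpM2r// /C; lra.
Qed.

Lemma normal_polyB (p r : {poly R}) :
  \int[N]_x (p - r).[x] = \int[N]_x p.[x] - \int[N]_x r.[x].
Proof.
rewrite -RintegralB//; try exact: integrable_normal_poly.
by apply: eq_Rintegral => x _; rewrite !hornerE.
Qed.

(** Under the standard normal law, p -> X p - p' is the adjoint of differentiation, by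
    [normal_polyX]; each step of the recurrence moves one derivative onto g. *)
Lemma normal_hermite_poly q (g : {poly R}) :
  \int[N]_x (hp q * g).[x] = \int[N]_x g^`(q).[x].
Proof.
elim: q g => [|q IH] g; first by rewrite mul1r derivn0.
rewrite derivSn -IH -[hp q.+1]/('X * hp q - (hp q)^`()).
rewrite mulrBl -mulrA normal_polyB normal_polyX -normal_polyB.
by congr (\int[_]_x _); apply/funext => x; rewrite derivM addrAC subrr add0r.
Qed.

End hermite_poly.

Section mehler.
Context d (T : measurableType d) (R : realType) (P : probability T R).
Variable S : set (T -> R).
Hypothesis gS : gaussian_space P S.

Lemma gaussian_space_integrable_poly X (p : {poly R}) : S X ->
  P.-integrable setT (EFin \o (fun w => p.[X w])).
Proof.
move=> SX; rewrite (_ : _ \o _ =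
    fun w => (\sum_(i <- index_enum 'I_(size p)) (p`_i)%:E * (X w ^+ i)%:E)%E).
  apply: integrable_sum => // i _.
  exact: (integrableZl measurableT _ (gaussian_space_integrableX gS i SX)).
by apply/funext => w; rewrite /= horner_coef -sumEFin.
Qed.

Lemma gaussian_space_poly_measurable X (p : {poly R}) : S X ->
  measurable_fun setT (fun w => p.[X w]).
Proof.
move=> SX; apply: (@measurableT_comp _ _ _ _ _ _ (horner p)).
  exact: measurable_horner.
exact: (gaussian_space_measurable gS).
Qed.

Lemma gaussian_space_integrable_polyM X Y (p r : {poly R}) : S X -> S Y ->
  P.-integrable setT (EFin \o (fun w => p.[X w] * r.[Y w])).
Proof.
move=> SX SY; have iX := gaussian_space_integrable_poly (p ^+ 2) SX.
have iY := gaussian_space_integrable_poly (r ^+ 2) SY.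
apply: (le_integrable measurableT _ _ (integrableD measurableT iX iY)).
  by apply/measurable_EFinP; apply: measurable_funM;
    exact: gaussian_space_poly_measurable.
move=> w _; rewrite /= lee_fin !horner_exp.
move: p.[X w] r.[Y w] => a b; rewrite [leRHS]ger0_norm ?addr_ge0 ?sqr_ge0//.
by rewrite ler_norml; apply/andP; split; nra.
Qed.

(* Mehler's formula; writing [Y = rho X + W] with [W] independent of [X], the
   integral over [X] alone is already constant. *)
Lemma gaussian_space_hermite X Y q : S X -> S Y -> \int[P]_w (X w ^+ 2) = 1 ->
  \int[P]_w ((hermite_poly R q).[X w] * (hermite_poly R q).[Y w]) =
  (\int[P]_w (X w * Y w)) ^+ q * q`!%:R.
Proof.
move=> SX SY X1; set rho := \int[P]_w (X w * Y w); set hp := hermite_poly R q.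
have [hS _ SD] := gS.
pose W w := - rho * X w + Y w; have SW : S W by exact: SD.
have XW : \int[P]_w (X w * W w) = 0.
  transitivity (\int[P]_w (- rho * (X w ^+ 2) + X w * Y w)).
    by apply: eq_Rintegral => w _; rewrite /W; ring.
  have i1 := gaussian_space_integrableX gS 2 SX.
  have i2 := gaussian_space_integrableM gS SX SY.
  rewrite RintegralD//; last exact: (integrableZl measurableT (- rho) i1).
  by rewrite RintegralZl// X1 mulr1 addrC subrr.
pose F (t : 2.-tuple R) := hp.[tnth t ord0] *
   hp.[rho * tnth t ord0 + tnth t (lift ord0 ord0)].
have mhp : measurable_fun setT (horner hp).
  exact: measurable_horner.
have mF : measurable_fun [set: 2.-tuple (measurableTypeR R)] F.
  have m0 := @measurable_tnth _ (measurableTypeR R) 2 ord0.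
  have m1 := @measurable_tnth _ (measurableTypeR R) 2 (lift ord0 ord0).
  apply: measurable_funM; first by apply: (measurableT_comp mhp).
  apply: (measurableT_comp mhp); apply: measurable_funD => //.
  exact: measurable_funM.
have FE w v : F [tuple oapp (fun=> W v) (X w) (unlift ord0 i) | i < 2] =
    hp.[X w] * hp.[rho * X w + W v].
  by rewrite /F !tnth_mktuple unlift_none liftK.
have E1 : (fun w => F [tuple oapp (fun=> W w) (X w) (unlift ord0 i) | i < 2]) =
    fun w => hp.[X w] * hp.[Y w].
  by apply/funext => w; rewrite FE; congr (_ * hp.[_]); rewrite /W; ring.
have iF : P.-integrable setT (EFin \o (fun w =>
    F [tuple oapp (fun=> W w) (X w) (unlift ord0 i) | i < 2])).
  by rewrite E1; exact: gaussian_space_integrable_polyM.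
have E := gaussian_indep gS (m := 1) (Y := fun=> W) SX (fun=> SW) (fun=> XW)
  mF iF.
rewrite /Rintegral (_ : (\int[P]_w _ = (rho ^+ q * q`!%:R)%:E)%E)//.
transitivity (\int[P]_w (F [tuple oapp (fun=> W w) (X w) (unlift ord0 i) | i < 2])%:E)%E.
  apply: eq_integral => w _; rewrite FE; congr (_ * hp.[_])%:E.
  by rewrite /W; ring.
rewrite E; transitivity (\int[P]_v (cst (rho ^+ q * q`!%:R)%:E) v)%E; last first.
  by rewrite integral_cst// [X in (_ * X)%E]probability_setT mule1.
apply: eq_integral => v _ /=.
(* For fixed v the second factor is a polynomial in X(w), and its q-th derivative is the constant
   rho^q q!. *)
pose g := hp \Po (rho *: 'X + (W v)%:P).
pose N : probability (measurableTypeR R) R := normal_prob 0 1.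
have [gX EX] := hS _ SX; have [mX _] := gX.
have XN := standard_gaussian_law gX EX X1.
transitivity (\int[N]_x ((hp * g).[x])%:E)%E.
  rewrite -(law_integral (k := N) mX XN).
    apply: eq_integral => w _; rewrite FE hornerM horner_comp.
    by rewrite !hornerE.
  exact: measurable_horner.
have := normal_hermite_poly q g; rewrite -/hp derivn_hermite_aff.
rewrite -/N; under [in X in _ = X -> _]eq_Rintegral do rewrite hornerC.
rewrite Rintegral_cst//.
have -> : fine (N setT) = 1 by rewrite probability_setT.
rewrite mulr1 => <-; rewrite /Rintegral fineK//.
apply: integrable_fin_num => //; exact: integrable_normal_poly.
Qed.

End mehler.

(** * Small balls for polynomials of a normal variable *)

Section small_ball.
Variable R : realType.

Definition separated (h : R) (s : seq R) := pairwise (fun x y => h <= `|x - y|) s.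

(* Divided differences: each step replaces [f] by [(f - f(t)) / ('X - t)], which
   keeps the leading coefficient and costs a factor [2 / h]. *)
Lemma separated_coef q (f : {poly R}) (h k : R) (s : seq R) : 0 < h ->
  (size f <= q.+1)%N -> size s = q.+1 -> separated h s ->
  (forall t, t \in s -> `|f.[t]| <= k) -> `|f`_q| * h ^+ q <= 2 ^+ q * k.
Proof.
move=> h0; elim: q f k s => [|q IH] f k [//|t s] sf /= [ss] /andP[ts hs] fk.
  have := fk t; rewrite inE eqxx => /(_ isT).
  by rewrite [f]size1_polyC// coefC hornerC !expr0 mulr1 mul1r.
have /factor_theorem[g gE] : root (f - f.[t]%:P) t.
  by rewrite rootE !hornerE subrr.
have fE : f = g * ('X - t%:P) + f.[t]%:P by rewrite -gE subrK.
have sg : (size g <= q.+1)%N.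
  have [->|g0] := eqVneq g 0; first by rewrite size_poly0.
  have := leq_trans (size_polyD f (- f.[t]%:P)) _; rewrite gE.
  rewrite size_Mmonic ?monicXsubC// size_XsubC addn2/= => /(_ q.+2).
  rewrite ltnS; apply; rewrite geq_max sf size_polyN.
  by rewrite (leq_trans (size_polyC_leq1 _)).
have gq : g`_q = f`_q.+1.
  have := congr1 (fun r : {poly R} => r`_q.+1) fE => /= ->.
  rewrite mulrBr coefD coefB coefMX coefMC coefC/=.
  by rewrite (nth_default _ sg) mul0r subr0 addr0.
have gk t' : t' \in s -> `|g.[t']| <= 2 * k / h.
  move=> t's; have htt : h <= `|t - t'| by move/allP : ts => /(_ _ t's).
  have tt0 : 0 < `|t' - t| by rewrite distrC (lt_le_trans h0).
  have E : g.[t'] * (t' - t) = f.[t'] - f.[t].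
    by have := congr1 (horner^~ t') fE; rewrite !hornerE => ->; rewrite addrK.
  have k0 : `|f.[t'] - f.[t]| <= 2 * k.
    have f1 := fk t; rewrite inE eqxx in f1; have {f1} := f1 isT.
    have := fk t'; rewrite inE t's orbT => /(_ isT).
    by have := ler_normB f.[t'] f.[t]; lra.
  rewrite ler_pdivlMr// (le_trans _ k0)// -E normrM ler_wpM2l// distrC//.
have := IH g _ s sg ss hs gk; rewrite gq.
rewrite !mulrA ler_pdivlMr// => H.
by rewrite (exprSr h) mulrA (le_trans H)// (exprSr 2).
Qed.

(** Greedy choice: a separated list in A either extends by one more point of A, or every point of A
    is within h of the list. *)
Lemma separated_cover (A : set R) (h : R) n :
  (exists s, (size s <= n)%N /\ forall x, A x -> exists2 t, t \in s & `|x - t| <= h) \/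
  (exists s, [/\ size s = n.+1, separated h s & forall t, t \in s -> A t]).
Proof.
elim: n => [|n [[s [sn sA]]|[s [sn hs sA]]]].
- have [[a Aa]|nA] := pselect (exists a, A a).
    by right; exists [:: a]; split => // t; rewrite inE => /eqP ->.
  by left; exists [::]; split => // x Ax; exfalso; apply: nA; exists x.
- by left; exists s; split => //; exact: leqW.
- have [[a [Aa ha]]|nA] := pselect (exists a, A a /\ forall t, t \in s -> h <= `|a - t|).
    right; exists (a :: s); split => /=; first by rewrite sn.
      by apply/andP; split => //; apply/allP.
    by move=> t; rewrite inE => /orP[/eqP ->//|]; exact: sA.
  left; exists s; split; first by rewrite sn.
  move=> x Ax; apply: contrapT => hx; apply: nA; exists x; split => // t ts.
  rewrite leNgt; apply/negP => xt; apply: hx; exists t => //; exact: ltW.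
Qed.

Local Notation N := (normal_prob 0 1 : probability (measurableTypeR R) R).

Let I (t h : R) : set (measurableTypeR R) := [set` `[t - h, t + h]].

Let normal_itv_le (t h : R) : 0 < h ->
  (N (I t h) <= (2 * h)%:E)%E.
Proof.
move=> h0; rewrite [leLHS]/(normal_prob 0 1 _) /normal_prob.
have p1 : normal_peak 1 <= 1 :> R.
  have pos : 0 < Num.sqrt (1 ^+ 2 * pi *+ 2) :> R.
    by rewrite sqrtr_gt0 expr1n mul1r mulrn_wgt0// pi_gt0.
  rewrite /normal_peak invf_le1// -[leLHS]sqrtr1 ler_wsqrtr// expr1n mul1r.
  by have := pi_ge2 R; rewrite mulr2n; lra.
apply: (@le_trans _ _ (\int[lebesgue_measure]_(x in I t h) cst 1 x)%E).
  apply: ge0_le_integral => //.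
  - exact: measurable_itv.
  - by move=> x _; rewrite lee_fin normal_pdf_ge0.
  - by apply/measurable_EFinP; apply: measurable_funTS; exact: measurable_normal_pdf.
  - by move=> x _; rewrite lee_fin (le_trans (normal_pdf_ub _ _ _)).
rewrite integral_cst; last exact: measurable_itv.
rewrite /= lebesgue_measure_itv/= lte_fin.
case: ifP => _; last by rewrite mule0 lee_fin mulr_ge0// ltW.
by rewrite mul1e -EFinD lee_fin; lra.
Qed.

Lemma normal_cover_le (s : seq R) (h : R) (A : set (measurableTypeR R)) :
  0 < h -> measurable A ->
  (forall x, A x -> exists2 t, t \in s & `|x - t| <= h) ->
  (N A <= ((size s)%:R * (2 * h))%:E)%E.
Proof.
move=> h0; elim: s A => [|t s IH] A mA sA.
  rewrite mul0r (_ : A = set0) ?measure0//.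
  by apply/seteqP; split => x // /sA[].
have mI : measurable (I t h).
  exact: measurable_itv.
have AI : (N (A `&` I t h) <= (2 * h)%:E)%E.
  apply: le_trans (normal_itv_le t h0); apply: le_measure; rewrite ?inE//.
  exact: measurableI.
have AD : (N (A `\` I t h) <= ((size s)%:R * (2 * h))%:E)%E.
  apply: IH; first exact: measurableD.
  move=> x [/sA[t' t's xt'] xI]; exists t' => //.
  move: t's; rewrite inE => /orP[/eqP tt'|//]; exfalso; apply: xI.
  move: xt'; rewrite tt' ler_norml => /andP[? ?].
  by rewrite /I/= in_itv/=; apply/andP; split; lra.
rewrite -(setUIDK A (I t h)) measureU//; last 3 first.
- exact: measurableI.
- exact: measurableD.
- by rewrite setDE setIACA setICr setI0.
by rewrite /= mulrS mulrDl mul1r EFinD leeD.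
Qed.

(** By [separated_coef], the hypothesis on k excludes q + 1 points of the sublevel set at mutual
    distances at least h. Hence q intervals of length 2 h cover it, each of normal mass at most 2 h
    since the density is at most 1. *)
Lemma normal_small_ball q (f : {poly R}) (h k : R) : 0 < h ->
  (size f <= q.+1)%N -> 2 ^+ q * k < `|f`_q| * h ^+ q ->
  (N [set x | `|f.[x]| <= k]%R <= (q%:R * (2 * h))%:E)%E.
Proof.
move=> h0 sf fk; set A := [set x | _].
have mA : measurable (A : set (measurableTypeR R)).
  have -> : A = (Num.norm \o horner f) @^-1` `]-oo, k].
    by apply/seteqP; split => x /=; rewrite in_itv/=.
  rewrite -[X in measurable X]setTI.
  apply: (measurableT_comp _ (measurable_horner f)) => //.
case: (separated_cover A h q) => [[s [sq sA]]|[s [sq hs sA]]].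
  apply: (le_trans (normal_cover_le h0 mA sA)).
  rewrite lee_fin; apply: ler_wpM2r; last by rewrite ler_nat.
  by rewrite mulr_ge0// ltW.
by have := separated_coef h0 sf sq hs sA; rewrite leNgt fk.
Qed.

End small_ball.

(** * Logarithmic averages *)

Section log_averages.
Variable R : realType.

(** This bound and the next one come from ln(1 + x) <= x; they compare the weights 1/n with
    increments of the logarithm. *)
Lemma invn_le_ln (n : nat) : (0 < n)%N ->
  n.+1%:R^-1 <= ln n.+1%:R - ln n%:R :> R.
Proof.
move=> n0; have n0' : 0 < n%:R :> R by rewrite ltr0n.
have n1 : 0 < n.+1%:R :> R by rewrite ltr0n.
rewrite -lerN2 opprB -ln_div ?posrE//.
have -> : n%:R / n.+1%:R = 1 + - n.+1%:R^-1 :> R.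
  by rewrite -[n.+1%:R]natr1; field; rewrite natr1 gt_eqF.
by apply: le_ln1Dx; rewrite ltrN2 invf_lt1// ltr1n ltnS.
Qed.

Lemma ln_le_invn (n : nat) : (0 < n)%N ->
  ln n.+1%:R - ln n%:R <= n%:R^-1 :> R.
Proof.
move=> n0; have n0' : 0 < n%:R :> R by rewrite ltr0n.
have n1 : 0 < n.+1%:R :> R by rewrite ltr0n.
rewrite -ln_div ?posrE//.
have -> : n.+1%:R / n%:R = 1 + n%:R^-1 :> R.
  by rewrite -[n.+1%:R]natr1; field; rewrite gt_eqF.
by apply: le_ln1Dx; rewrite (lt_trans (ltrN10 _))// invr_gt0.
Qed.

Section upper.
Variables (beta C L : R) (p : nat -> R).
Hypotheses (beta0 : 0 < beta) (C0 : 0 <= C) (L0 : 0 <= L).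
Hypothesis p01 : forall n, 0 <= p n <= 1.
(** Logarithmic position relative to the transition: with L = - ln eps, s vanishes where eps n^beta
    = 1, and [ps] reads p n <= C / (eps n^beta)^2. *)
Let s (n : nat) : R := ln n%:R - L / beta.
Hypothesis ps : forall n, (0 < n)%N -> p n <= C * expR (- (2 * beta * s n)).

(* Splits the increment of [s] at [0]: below, [p <= 1]; above, the exponential
   bound is integrated. *)
Let Phi (x : R) := Num.min x 0 - C / (2 * beta) * expR (- (2 * beta * Num.max x 0)).

Let Phi_step (a b r t : R) : a <= b -> 0 <= r <= b - a -> 0 <= t <= 1 ->
  t <= C * expR (- (2 * beta * b)) -> r * t <= Phi b - Phi a.
Proof.
move=> ab /andP[r0 rab] /andP[t0 t1] tC.
have H : (b - a) * t <= Phi b - Phi a; last by apply: le_trans H; rewrite ler_wpM2r.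
have b20 : 0 < 2 * beta by rewrite mulr_gt0.
rewrite /Phi; have [b0|] := boolP (b <= 0); last rewrite -ltNge => b0.
  have a0 : a <= 0 by exact: le_trans b0.
  rewrite min_l// max_r// min_l// max_r//.
  have : (b - a) * t <= b - a by rewrite ler_piMr// subr_ge0.
  by lra.
rewrite (min_r (ltW b0)) (max_l (ltW b0)).
(* The value of a decreasing exponential at the right end, times the length, is at most its
   integral; concretely e^u >= 1 + u. *)
have key (x : R) : x <= b -> (b - x) * t <=
    C / (2 * beta) * expR (- (2 * beta * x)) - C / (2 * beta) * expR (- (2 * beta * b)).
  move=> xb; apply: (@le_trans _ _ ((b - x) * (C * expR (- (2 * beta * b))))).
    by rewrite ler_wpM2l// subr_ge0.
  have := expR_ge1Dx (2 * beta * (b - x)).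
  have -> : - (2 * beta * x) = 2 * beta * (b - x) + - (2 * beta * b) by ring.
  rewrite expRD; move: (expR (2 * beta * (b - x))) => e he.
  have := expR_gt0 (- (2 * beta * b)); move: (expR _) => g g0.
  rewrite [leRHS](_ : _ = C / (2 * beta) * ((e - 1) * g)); last by ring.
  rewrite [leLHS](_ : _ = C / (2 * beta) * ((2 * beta * (b - x)) * g)); last first.
    by field; exact: lt0r_neq0.
  apply: ler_wpM2l; first by rewrite divr_ge0// ltW.
  by rewrite ler_pM2r// lerBrDl.
have [a0|] := boolP (a <= 0); last rewrite -ltNge => a0.
  rewrite (min_l a0) (max_r a0) mulr0 oppr0.
  have := key 0 (ltW b0); rewrite mulr0 oppr0 addr0.
  have : - a * t <= - a by rewrite ler_piMr// oppr_ge0.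
  by lra.
rewrite (min_r (ltW a0)) (max_l (ltW a0)).
by have := key a ab; lra.
Qed.

(** The terms from n = 2 on telescope through [Phi], which is nonpositive and equals -L/beta - C/(2
    beta) at s 1; the summand 1 bounds the term n = 1. *)
Lemma log_sum_le (N : nat) :
  \sum_(1 <= n < N.+1) n%:R^-1 * p n <= 1 + L / beta + C / (2 * beta).
Proof.
have Cb : 0 <= C / (2 * beta) by rewrite divr_ge0// mulr_ge0// ltW.
have s1 : s 1 = - (L / beta) by rewrite /s ln1 sub0r.
have Lb : 0 <= L / beta by rewrite divr_ge0// ltW.
have Phi1 : Phi (s 1) = - (L / beta) - C / (2 * beta).
  rewrite /Phi s1 min_l ?oppr_le0// max_r ?oppr_le0//.
  by rewrite mulr0 oppr0 expR0 mulr1.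
have H n : \sum_(1 <= k < n.+2) k%:R^-1 * p k <= 1 + Phi (s n.+1) - Phi (s 1).
  elim: n => [|n IH].
    by rewrite big_nat1 invr1 mul1r addrK; have /andP[] := p01 1.
  rewrite big_nat_recr//=.
  have st : n.+2%:R^-1 * p n.+2 <= Phi (s n.+2) - Phi (s n.+1).
    apply: Phi_step => //; last exact: ps.
      by rewrite lerD2r ler_ln ?posrE ?ltr0n// ler_nat.
    rewrite invr_ge0 ler0n /s opprB addrA subrK.
    exact: invn_le_ln.
  apply: (le_trans (lerD IH st)); move: (Phi _) (Phi _) (Phi _) => x y z.
    by lra.
case: N => [|N].
  by rewrite big_geq// !addr_ge0.
apply: (le_trans (H N)); rewrite Phi1.
have : Phi (s N.+1) <= 0.
  rewrite /Phi subr_le0 (@le_trans _ _ 0)//; first by rewrite ge_min lexx orbT.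
  by rewrite mulr_ge0// expR_ge0.
by lra.
Qed.

End upper.

(** The indices N0 <= n <= e^M have p n >= a, and the harmonic sum up to K = floor(e^M) is at least
    ln(K + 1) - ln N0 >= M - ln N0. *)
Lemma log_sum_ge (a : R) (p : nat -> R) (N0 : nat) (M : R) : 0 <= a ->
  (0 < N0)%N -> (forall n, 0 <= p n) ->
  (forall n, (N0 <= n)%N -> ln n%:R <= M -> a <= p n) ->
  exists K : nat, a * (M - ln N0%:R) <= \sum_(1 <= n < K.+1) n%:R^-1 * p n.
Proof.
move=> a0 N00 p0 pa.
have [MN|NM] := leP M (ln N0%:R).
  exists 0; rewrite big_geq// mulr_ge0_le0// subr_le0//.
pose K := Num.truncn (expR M); exists K.
have KM : M <= ln K.+1%:R.
  rewrite -[leLHS]expRK ler_ln ?posrE ?expR_gt0 ?ltr0n//.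
  by rewrite ltW// Num.Theory.truncnS_gt.
have KM' n : (0 < n <= K)%N -> ln n%:R <= M.
  move=> /andP[n0 nK]; rewrite -[leRHS]expRK ler_ln ?posrE ?expR_gt0 ?ltr0n//.
  by rewrite (@le_trans _ _ K%:R) ?ler_nat// truncn_le expR_ge0.
have H j : (N0 + j <= K.+1)%N ->
    a * (ln (N0 + j)%:R - ln N0%:R) <= \sum_(1 <= k < N0 + j) k%:R^-1 * p k.
  elim: j => [|j IH] jK.
    by rewrite addn0 subrr mulr0 sumr_ge0// => k _; rewrite mulr_ge0.
  rewrite addnS in jK *; rewrite big_nat_recr/=; last by rewrite (leq_trans N00) ?leq_addr.
  have Nj0 : (0 < N0 + j)%N by rewrite (leq_trans N00) ?leq_addr.
  have ap : a <= p (N0 + j)%N.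
    by apply: pa; [exact: leq_addr|apply: KM'; rewrite Nj0].
  apply: le_trans (lerD (IH (ltnW jK)) (_ : a * (N0 + j)%:R^-1 <= _)); last first.
    by rewrite mulrC ler_wpM2l// invr_ge0.
  rewrite -mulrDr ler_wpM2l//; have := ln_le_invn Nj0; lra.
have N0K : (N0 <= K.+1)%N.
  rewrite -(ler_nat R) -ler_ln ?posrE ?ltr0n//.
  exact: ltW (lt_le_trans NM KM).
have := H (K.+1 - N0)%N; rewrite subnKC// => /(_ (leqnn _)); apply: le_trans.
by rewrite ler_wpM2l// lerD2r.
Qed.

(** The sum lies between (1 - d) (- ln e / beta - B) and - ln e / beta + A, where B depends on d and
    neither constant on e. Division by - ln e + ln c removes A, B and c in the limit, and then d is
    arbitrary. *)
Lemma log_average_cvg (p : nat -> R -> R) (beta C c : R) :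
  0 < beta -> 0 <= C -> 0 < c ->
  (forall n e, 0 <= p n e <= 1) ->
  (forall n e, (0 < n)%N -> 0 < e -> p n e * (e * n%:R `^ beta) ^+ 2 <= C) ->
  (forall d, 0 < d -> exists2 eta, 0 < eta & exists N, forall n e,
    (N <= n)%N -> 0 < e -> e * n%:R `^ beta <= eta -> 1 - d <= p n e) ->
  (((- ln (c^-1 * e))^-1)%:E * \sum_(1 <= n <oo) (n%:R^-1 * p n e)%:E)%E
    @[e --> 0^'+] --> (beta^-1)%:E.
Proof.
move=> beta0 C0 c0 p01 pC pd.
have pge0 n e : 0 <= p n e by have /andP[] := p01 n e.
pose f e := (\sum_(1 <= n <oo) (n%:R^-1 * p n e)%:E)%E.
have f_le e : 0 < e -> ln e <= 0 -> (f e <= (- ln e / beta + (1 + C / (2 * beta)))%:E)%E.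
  move=> e0 le0; apply: lime_le.
    by apply: is_cvg_nneseries => n _ _; rewrite lee_fin mulr_ge0.
  apply: nearW => -[|N].
    rewrite big_geq// lee_fin !addr_ge0// ?divr_ge0 ?oppr_ge0// ?ltW//.
    by rewrite mulr_gt0.
  rewrite sumEFin lee_fin.
  have L0 : 0 <= - ln e by rewrite oppr_ge0.
  apply: le_trans (@log_sum_le beta C (- ln e) (p ^~ e) beta0 C0 L0 _ _ N) _.
  - by move=> n; exact: p01.
  - move=> n n0; have np : 0 < n%:R :> R by rewrite ltr0n.
    have E : e * n%:R `^ beta = expR (beta * (ln n%:R - - ln e / beta)).
      rewrite /powR gt_eqF// -{1}[e]lnK ?posrE// -expRD; congr expR.
      by field; exact: lt0r_neq0.
    have := pC n e n0 e0; rewrite E -expRM_natl.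
    rewrite -ler_pdivlMr ?expR_gt0// => /le_trans; apply.
    by rewrite -expRN le_eqVlt; apply/orP; left; apply/eqP; congr (_ * expR _); ring.
  - by lra.
have f_fin e : 0 < e -> ln e <= 0 -> f e \is a fin_num.
  move=> e0 le0; rewrite ge0_fin_numE; last first.
    by apply: nneseries_ge0 => n _ _; rewrite lee_fin mulr_ge0.
  exact: le_lt_trans (f_le e e0 le0) (ltry _).
have f_ge d : 0 < d <= 1 -> exists B, forall e, 0 < e ->
    (((1 - d) * (- ln e / beta - B))%:E <= f e)%E.
  move=> /andP[d0 d1]; have [eta eta0 [N pN]] := pd d d0.
  (* The condition e n^beta <= eta means ln n <= (ln eta - ln e) / beta; B collects what does not
     involve e. The shift to N + 1 keeps the first index positive. *)
  exists (ln N.+1%:R - ln eta / beta) => e e0.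
  have := @log_sum_ge (1 - d) (p ^~ e) N.+1 ((ln eta - ln e) / beta) _ isT
    (fun n => pge0 n e) _.
  have H : forall n : nat, (N < n)%N -> ln n%:R <= (ln eta - ln e) / beta ->
      1 - d <= p n e.
    move=> n Nn; rewrite ler_pdivlMr// => h; apply: pN => //; first exact: ltnW.
    have np : 0 < n%:R :> R by rewrite ltr0n (leq_ltn_trans _ Nn).
    rewrite /powR gt_eqF// -{1}[e]lnK ?posrE// -expRD -[leRHS]lnK ?posrE//.
    by rewrite ler_expR; lra.
  rewrite subr_ge0 => /(_ d1 H)[K hK].
  apply: (@le_trans _ _ (\sum_(1 <= n < K.+1) (n%:R^-1 * p n e)%:E)%E); last first.
    by apply: nneseries_lim_ge => n _ _; rewrite lee_fin mulr_ge0.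
  rewrite sumEFin lee_fin; apply: le_trans hK.
  by rewrite le_eqVlt; apply/orP; left; apply/eqP; congr (_ * _); ring.
have lnbig (A : R) : \forall e \near 0^'+, A <= - ln e.
  near=> e; rewrite lerNr; near: e.
  by have /cvgrNyPle/(_ (- A)) := @lnNy R.
apply/fine_cvgP; split.
  near=> e; rewrite fin_numM// f_fin//.
  by rewrite -oppr_ge0; near: e; exact: lnbig.
apply/cvgrPdist_le => r r0.
(* Half of the tolerance r pays for d / beta; the other half pays for [K1] and [K2], once - ln e is
   large. *)
pose d := Num.min 1 (r * beta / 2).
have d01 : 0 < d <= 1.
  by rewrite lt_min ltr01 ge_min lexx/= divr_gt0// mulr_gt0.
have [B fB] := f_ge d d01.
pose A := 1 + C / (2 * beta).
pose K1 := (1 - d) * (ln c / beta + B).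
pose K2 := A - ln c / beta.
near=> e.
have e0 : 0 < e by near: e; exact: nbhs_right_gt.
have l0 : ln e <= 0 by rewrite -oppr_ge0; near: e; exact: lnbig.
have lnE : - ln (c^-1 * e) = - ln e + ln c.
  by rewrite lnM ?posrE ?invr_gt0// lnV ?posrE//; ring.
have D0 : 0 < - ln e + ln c.
  rewrite (@lt_le_trans _ _ 1)// -lerBlDr; near: e; exact: lnbig.
have fe := f_le e e0 l0; have fe' := fB e e0.
rewrite [X in `|_ - X|]/= lnE -/(f e).
rewrite -(fineK (f_fin e e0 l0)) in fe fe' *.
move: fe fe'; rewrite !lee_fin; move: (fine (f e)) => F F1 F2.
have -> : fine (((- ln e + ln c)^-1)%:E * F%:E)%E = F / (- ln e + ln c).
  by rewrite /= mulrC.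
have K12 : 2 * (`|K1| + `|K2|) / r <= - ln e + ln c.
  by rewrite -lerBlDr; near: e; exact: lnbig.
rewrite ler_pdivrMr// in K12.
rewrite -[X in `|X|](mulfK (lt0r_neq0 D0)) mulrBl divfK ?lt0r_neq0//.
rewrite normrM normfV (gtr0_norm D0) ler_pdivrMr//.
have dr : d <= r * beta / 2 by rewrite ge_min lexx orbT.
have /andP[d0 d1] := d01.
have dD : d * (- ln e + ln c) / beta <= r * (- ln e + ln c) / 2.
  rewrite ler_pdivrMr// mulrAC [leRHS](_ : _ = (r * beta / 2) * (- ln e + ln c)).
    by rewrite ler_wpM2r// ltW.
  by ring.
have e1 : beta^-1 * (- ln e + ln c) - (1 - d) * (- ln e / beta - B) =
    d * (- ln e + ln c) / beta + K1.
  by rewrite /K1; field; exact: lt0r_neq0.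
have e2 : beta^-1 * (- ln e + ln c) - (- ln e / beta + A) = - K2.
  by rewrite /K2; field; exact: lt0r_neq0.
rewrite -/A in F1; move: F1 F2 K12 e1 e2 dD.
have := ler_norm K1; have := ler_norm K2; have := normr_ge0 K1.
have := normr_ge0 K2.
set D := - ln e + ln c; set x := (1 - d) * _; set y := _ / beta + A.
set z := beta^-1 * _; set t := _ / beta.
move: D x y z t => D x y z t ? ? ? ? ? ? ? ? ? ?.
by rewrite ler_norml; apply/andP; split; lra.
Unshelve. all: by end_near. Qed.

End log_averages.

(** * Covariance of the increments *)

Section power_sums.
Variable R : realType.

Lemma le0_ler_powR (p x y : R) : p <= 0 -> 0 < x -> x <= y -> y `^ p <= x `^ p.
Proof.
move=> p0 x0 xy; have y0 := lt_le_trans x0 xy.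
by rewrite /powR !gt_eqF// ler_expR ler_wnM2l// ler_ln.
Qed.

Lemma MVT_powR (p a b : R) : 0 < a -> a < b ->
  exists2 c, a < c < b & b `^ p - a `^ p = p * c `^ (p - 1) * (b - a).
Proof.
move=> a0 ab.
have df x : x \in `]a, b[ ->
    is_derive x (1 : R) (fun y : R => y `^ p) (p * x `^ (p - 1)).
  rewrite in_itv/= => /andP[ax _].
  by apply: is_derive1_powR; exact: lt_trans ax.
have cf : {within `[a, b], continuous (fun y : R => y `^ p)}.
  apply: derivable_within_continuous => x; rewrite in_itv/= => /andP[ax _].
  have x0 : 0 < x by exact: lt_le_trans ax.
  by have := is_derive1_powR p x0 => ?; exact: ex_derive.
by have [c] := MVT ab df cf; rewrite in_itv/=; exists c.
Qed.

(** Comparison with the integral of x^(-g) over [1, n + 1], carried out by the mean value theorem on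
    each unit step. One formula covers g > 1 and g < 1. *)
Lemma sum_powR_le (g : R) (n : nat) : 0 < g -> g != 1 ->
  \sum_(r < n.+1) r.+1%:R `^ (- g) <= 1 + (n.+1%:R `^ (1 - g) - 1) / (1 - g).
Proof.
move=> g0 g1; have g1' : 1 - g != 0 by rewrite subr_eq0 eq_sym.
elim: n => [|n IH].
  by rewrite big_ord_recr big_ord0/= !powR1 subrr mul0r add0r addr0.
rewrite big_ord_recr/=; apply: (le_trans (lerD IH (lexx _))).
have n0 : 0 < n.+1%:R :> R by rewrite ltr0n.
have n1 : n.+1%:R < n.+2%:R :> R by rewrite ltr_nat.
have [c /andP[ac cb] E] := MVT_powR (1 - g) n0 n1.
have n21 : n.+2%:R - n.+1%:R = 1 :> R by rewrite -[n.+2%:R]natr1 addrC addKr.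
have cc : n.+2%:R `^ (- g) <= c `^ (- g).
  by apply: le0_ler_powR; rewrite ?oppr_le0 ?ltW// (lt_trans n0).
apply: (@le_trans _ _ (1 + (n.+1%:R `^ (1 - g) - 1) / (1 - g) + c `^ (- g))).
  by rewrite lerD2l.
have Ec : c `^ (- g) = (n.+2%:R `^ (1 - g) - n.+1%:R `^ (1 - g)) / (1 - g).
  rewrite E n21 mulr1 (_ : 1 - g - 1 = - g); last by ring.
  by field.
rewrite Ec le_eqVlt; apply/orP; left; apply/eqP.
by field.
Qed.

Lemma sum_powR_gt1 (g : R) : 1 < g -> exists2 C : R, 0 <= C &
  forall n, \sum_(r < n) r.+1%:R `^ (- g) <= C.
Proof.
move=> g1; have g0 : 0 < g by exact: lt_trans g1.
have gg : 0 < g - 1 by rewrite subr_gt0.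
exists (1 + (g - 1)^-1); first by rewrite addr_ge0// invr_ge0 ltW.
case=> [|n]; first by rewrite big_ord0 addr_ge0// invr_ge0 ltW.
apply: (le_trans (sum_powR_le n g0 _)); first by rewrite gt_eqF.
rewrite lerD2l -[1 - g]opprB invrN mulrN -mulNr opprB.
by rewrite ler_piMl ?invr_ge0 ?ltW// gerBl powR_ge0.
Qed.

Lemma sum_powR_lt1 (g : R) : 0 < g < 1 -> exists2 C : R, 0 <= C &
  forall n, \sum_(r < n) r.+1%:R `^ (- g) <= C * n%:R `^ (1 - g).
Proof.
move=> /andP[g0 g1]; have gg : 0 < 1 - g by rewrite subr_gt0.
exists (1 - g)^-1; first by rewrite invr_ge0 ltW.
case=> [|n]; first by rewrite big_ord0 mulr_ge0 ?powR_ge0// invr_ge0 ltW.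
apply: (le_trans (sum_powR_le n g0 _)); first by rewrite lt_eqF.
rewrite mulrBl mul1r [leRHS]mulrC addrCA gerDl subr_le0.
by rewrite invf_ge1// gerBl ltW.
Qed.

(** [maxn k l - minn k l] is |k - l|. Enlarging n by one adds a row, a column and a diagonal term:
    one of the two lines, and the other together with the diagonal, are each at most the sum of a
    over r <= n. *)
Lemma sum_dist_le (a : nat -> R) (n : nat) : (forall r, 0 <= a r) ->
  \sum_(k < n) \sum_(l < n) a (maxn k l - minn k l)%N <=
  2 * (n%:R * \sum_(r < n) a r).
Proof.
move=> a0; elim: n => [|n IH]; first by rewrite big_ord0 mul0r mulr0.
pose A m := \sum_(r < m) a r.
have Amono : A n <= A n.+1 by rewrite /A big_ord_recr lerDl.
have S1 : \sum_(l < n) a (n - l)%N <= A n.+1.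
  rewrite (reindex_inj rev_ord_inj)/= /A big_ord_recl.
  rewrite (eq_bigr (fun l : 'I_n => a l.+1)) ?lerDr//.
  by move=> l _; congr a; have := ltn_ord l; lia.
rewrite big_ord_recr/= big_ord_recr/= maxnn minnn subnn.
rewrite (eq_bigr (fun k : 'I_n =>
    \sum_(l < n) a (maxn k l - minn k l)%N + a (n - k)%N)); last first.
  move=> k _; rewrite big_ord_recr/=; congr (_ + a _).
  by have := ltn_ord k; lia.
rewrite big_split/=.
rewrite [X in _ + (X + _)](eq_bigr (fun l : 'I_n => a (n - l)%N)); last first.
  by move=> l _; congr a; have := ltn_ord l; lia.
have Aa : a 0%N <= A n.+1 by rewrite /A big_ord_recl lerDl sumr_ge0.
have S2 : \sum_(l < n) a (n - l)%N + a 0%N <= A n.+1.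
  rewrite (reindex_inj rev_ord_inj)/= /A big_ord_recl addrC lerD2l.
  rewrite (eq_bigr (fun l : 'I_n => a l.+1))//.
  by move=> l _; congr a; have := ltn_ord l; lia.
rewrite -/(A n.+1) -/(A n) in IH *.
have nA : n%:R * A n <= n%:R * A n.+1 by rewrite ler_wpM2l.
rewrite -natr1 mulrDl mul1r; lra.
Qed.

(** Covariance at lag r of fractional Gaussian noise; the absolute value makes the formula give the
    variance 1 at r = 0 when H > 0. *)
Definition fgn_cov (H : R) (r : nat) : R :=
  (r.+1%:R `^ (2 * H) + `|r%:R - 1| `^ (2 * H) - 2 * r%:R `^ (2 * H)) / 2.

(** Half a second difference of y^(2 H), equal to H (2 H - 1) z^(2 H - 2) at an intermediate point z
    by two uses of the mean value theorem. This needs r >= 2, to stay away from the singularity at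
    0. *)
Lemma fgn_cov_le (H : R) (r : nat) : 0 < H < 1 ->
  `|fgn_cov H r| <= 12 * r.+1%:R `^ (- (2 - 2 * H)).
Proof.
move=> /andP[H0 H1]; have e0 : - (2 - 2 * H) <= 0 by lra.
have H20 : 2 * H != 0 by rewrite mulf_neq0// gt_eqF.
(* The lags 0 and 1 fix the constant 12: the crude bound 3 at lag 1 is compared with 12 times
   2^(-2). *)
have low (x : R) : 0 < x <= 2 -> 3 <= 12 * x `^ (- (2 - 2 * H)).
  move=> /andP[x0 x2].
  have : 2 `^ (- (2 - 2 * H)) <= x `^ (- (2 - 2 * H)) by exact: le0_ler_powR.
  have : 2 `^ (- 2%:R) <= 2 `^ (- (2 - 2 * H)) :> R.
    by apply: ler_powR; lra.
  by rewrite powR_invn//; lra.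
case: r => [|[|r]].
- rewrite /fgn_cov powR0// mulr0 subr0 sub0r normrN normr1 !powR1.
  by rewrite divff// normr1; lra.
- apply: (@le_trans _ _ 3); last by apply: low; lra.
  rewrite /fgn_cov subrr normr0 powR0// addr0 powR1 mulr1.
  have h1 : 2 `^ (2 * H) <= 2 `^ 2%:R :> R by apply: ler_powR; lra.
  rewrite powR_mulrn// in h1; have h0 : 0 <= 2 `^ (2 * H) :> R by exact: powR_ge0.
  by rewrite ler_norml; apply/andP; split; lra.
set x : R := r.+1%:R.
have x0 : 0 < x by rewrite ltr0n.
have x1 : r.+2%:R = x + 1 by rewrite natr1.
have x2 : r.+3%:R = x + 2 by rewrite -natr1 x1; ring.
rewrite /fgn_cov x1 x2 addrK (gtr0_norm x0).
pose g (y : R) := (y + 1) `^ (2 * H) - y `^ (2 * H).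
have dg (y : R) : 0 < y -> is_derive y (1 : R) g
    (2 * H * (y + 1) `^ (2 * H - 1) - 2 * H * y `^ (2 * H - 1)).
  move=> y0; have y1 : 0 < y + 1 by rewrite addr_gt0.
  have d1 := is_derive1_powR (2 * H) y0.
  have d2 : is_derive y (1 : R) ((fun z : R => z `^ (2 * H)) \o (fun z => z + 1))
      (2 * H * (y + 1) `^ (2 * H - 1) * 1).
    apply: is_derive1_comp; first exact: is_derive1_powR.
    have -> : (fun z : R => z + 1) = id + cst 1 by [].
    by apply: is_derive_eq; rewrite addr0.
  have -> : g = ((fun z : R => z `^ (2 * H)) \o (fun z => z + 1)) -
      (fun z : R => z `^ (2 * H)) by [].
  by apply: is_derive_eq; rewrite mulr1.
have xx1 : x < x + 1 by rewrite ltrDl.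
have dg' y : y \in `]x, x + 1[ -> is_derive y (1 : R) g
    (2 * H * (y + 1) `^ (2 * H - 1) - 2 * H * y `^ (2 * H - 1)).
  by rewrite in_itv/= => /andP[xy _]; apply: dg; exact: lt_trans xy.
have cg : {within `[x, x + 1], continuous g}.
  apply: derivable_within_continuous => y; rewrite in_itv/= => /andP[xy _].
  by have := dg y (lt_le_trans x0 xy) => ?; exact: ex_derive.
have [y] := MVT xx1 dg' cg; rewrite in_itv/= => /andP[xy _] Eg.
have y0 : 0 < y by exact: lt_trans xy.
have yy1 : y < y + 1 by rewrite ltrDl.
have [z /andP[yz _] Ez] := MVT_powR (2 * H - 1) y0 yy1.
have z0 : 0 < z by exact: lt_trans yz.
have xz : x <= z by exact: ltW (lt_trans xy yz).
rewrite (_ : _ / 2 = H * (2 * H - 1) * z `^ (- (2 - 2 * H))); last first.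
  have -> : x + 2 = x + 1 + 1 by ring.
  have Ez' : (y + 1) `^ (2 * H - 1) - y `^ (2 * H - 1) =
      (2 * H - 1) * z `^ (- (2 - 2 * H)).
    rewrite Ez (_ : 2 * H - 1 - 1 = - (2 - 2 * H)); last by ring.
    by ring.
  have : g (x + 1) - g x = 2 * H * ((2 * H - 1) * z `^ (- (2 - 2 * H))).
    by rewrite Eg -Ez'; ring.
  by rewrite /g; lra.
have z1 : z `^ (- (2 - 2 * H)) <= x `^ (- (2 - 2 * H)) by exact: le0_ler_powR.
(* As x >= 1, x is at least (x + 2) / 3; returning to x + 2, the original r + 1, costs a factor at
   most 3^2 = 9. *)
have z2 : x `^ (- (2 - 2 * H)) <= ((x + 2) / 3) `^ (- (2 - 2 * H)).
  apply: le0_ler_powR => //; first by rewrite divr_gt0// addr_gt0.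
  have : 1 <= x by rewrite ler1n.
  by rewrite ler_pdivrMr//; lra.
have z3 : ((x + 2) / 3) `^ (- (2 - 2 * H)) <= 9 * (x + 2) `^ (- (2 - 2 * H)).
  have x20 : 0 <= x + 2 by rewrite addr_ge0// ltW.
  rewrite powRM ?invr_ge0// [leLHS]mulrC; apply: ler_wpM2r; first exact: powR_ge0.
  rewrite -[3^-1]powR_inv1// -powRrM mulN1r opprK.
  have -> : 9 = 3 `^ 2%:R :> R by rewrite powR_mulrn//; ring.
  by apply: ler_powR; lra.
have z4 : 0 <= z `^ (- (2 - 2 * H)) by exact: powR_ge0.
have h1 : `|H * (2 * H - 1)| <= 1.
  by rewrite ler_norml; apply/andP; split; nra.
rewrite normrM (ger0_norm z4).
have : `|H * (2 * H - 1)| * z `^ (- (2 - 2 * H)) <= z `^ (- (2 - 2 * H)).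
  by rewrite ler_piMl.
have := powR_ge0 (x + 2) (- (2 - 2 * H)).
by lra.
Qed.

End power_sums.

(** * The Hermite variation of fractional Brownian motion *)

Section fbm.
Context d (T : measurableType d) (R : realType) (P : probability T R).
Variables (H : R) (B : R -> T -> R).
Hypotheses (H_gt0 : 0 < H) (H_lt1 : H < 1) (fbmB : fbm P H B).

(** Explicit finite combinations, in the form of the first clause of [centered_gaussian_process],
    which thus gives Gaussianity directly. *)
Definition process_span : set (T -> R) := [set X |
  exists (n : nat) (t a : 'I_n -> R), (forall i, t i \in `[0, 1]) /\
    X = fun w => \sum_(i < n) a i * B (t i) w].

Local Notation S := process_span.

Let gaussian_B t : t \in `[0, 1] -> gaussian_rv P (B t).
Proof.
move=> t01; have [h _ _] := fbmB.
have := h 1%N (fun=> t) (fun=> 1) (fun=> t01).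
by under eq_fun do rewrite big_ord1 mul1r.
Qed.

Lemma process_span_B t : t \in `[0, 1] -> S (B t).
Proof.
move=> t01; exists 1%N, (fun=> t), (fun=> 1); split => //.
by apply/funext => w; rewrite big_ord1 mul1r.
Qed.

Lemma gaussian_process_span : gaussian_space P S.
Proof.
have [hg hE _] := fbmB; split.
- move=> _ [n [t [a [t01 ->]]]]; split; first exact: hg.
  have iB i : P.-integrable setT (EFin \o (fun w => a i * B (t i) w)).
    have := centered_gaussian_integrableX (gaussian_B (t01 i)) (hE _ (t01 i)) 1.
    exact: (integrableZl measurableT (a i)).
  rewrite unlock; under eq_integral do rewrite -sumEFin.
  rewrite integral_sum// big1// => i _.
  have iBi := centered_gaussian_integrableX (gaussian_B (t01 i)) (hE _ (t01 i)) 1.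
  transitivity ((a i)%:E * \int[P]_w (B (t i) w)%:E)%E.
    exact: (integralZl measurableT iBi (a i)).
  by have := hE _ (t01 i); rewrite unlock => ->; rewrite mule0.
- exists 0%N, (fun=> 0), (fun=> 0); split; first by case.
  by apply/funext => w; rewrite big_ord0.
- move=> a _ _ [n [t [b [t01 ->]]]] [m [u [c [u01 ->]]]].
  exists (n + m)%N, (fun i => match fintype.split i with inl j => t j | inr j => u j end),
    (fun i => match fintype.split i with inl j => a * b j | inr j => c j end).
  split; first by move=> i; case: fintype.split.
  apply/funext => w; rewrite big_split_ord/= mulr_sumr; congr +%R.
    apply: eq_bigr => i _; rewrite mulrA.
    by rewrite -[lshift m i]/(unsplit (inl i)) unsplitK.
  by apply: eq_bigr => i _; rewrite -[rshift n i]/(unsplit (inr i)) unsplitK.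
Qed.

Local Notation gS := gaussian_process_span.

Let cov (t s : R) : R := (t `^ (2 * H) + s `^ (2 * H) - `|t - s| `^ (2 * H)) / 2.

Lemma fbm_cov t s : t \in `[0, 1] -> s \in `[0, 1] ->
  \int[P]_w (B t w * B s w) = cov t s.
Proof.
move=> t01 s01; have [_ _ hC] := fbmB.
by have := hC t s t01 s01; rewrite unlock /Rintegral => ->.
Qed.

Lemma fbm_incr_cov (c c' t t' s s' : R) : t \in `[0, 1] -> t' \in `[0, 1] ->
  s \in `[0, 1] -> s' \in `[0, 1] ->
  \int[P]_w (c * (B t w - B t' w) * (c' * (B s w - B s' w))) =
  c * c' * (cov t s - cov t s' - cov t' s + cov t' s').
Proof.
move=> t01 t'01 s01 s'01.
have iM u v : u \in `[0, 1] -> v \in `[0, 1] ->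
    P.-integrable setT (EFin \o (fun w => B u w * B v w)).
  by move=> u01 v01; apply: (gaussian_space_integrableM gS); exact: process_span_B.
have i1 := iM _ _ t01 s01; have i2 := iM _ _ t01 s'01.
have i3 := iM _ _ t'01 s01; have i4 := iM _ _ t'01 s'01.
transitivity (\int[P]_w (c * c' * ((B t w * B s w - B t w * B s' w) +
    (B t' w * B s' w - B t' w * B s w)))).
  by apply: eq_Rintegral => w _; ring.
have i12 := integrableB measurableT i1 i2.
have i43 := integrableB measurableT i4 i3.
rewrite RintegralZl//; last exact: (integrableD measurableT i12 i43).
rewrite RintegralD// RintegralB// RintegralB// !fbm_cov//.
by congr (_ * _); ring.
Qed.

Variable n : nat.

Let X (k : nat) (w : T) : R :=
  n%:R `^ H * (B (k.+1%:R / n%:R) w - B (k%:R / n%:R) w).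

Let grid01 (k : nat) : (k <= n)%N -> (k%:R / n%:R : R) \in `[0, 1].
Proof.
move=> kn; rewrite in_itv/= divr_ge0//=.
(* For n = 0 the quotient is 0, because the inverse of 0 is 0. *)
case: n kn => [|m] km; first by rewrite invr0 mulr0.
by rewrite ler_pdivrMr ?ltr0n// mul1r ler_nat.
Qed.

Lemma fbm_incr_span k : (k < n)%N -> S (X k).
Proof.
move=> kn; have [_ S0 SD] := gS.
have S1 := process_span_B (grid01 kn).
have S2 := process_span_B (grid01 (ltnW kn)).
have := SD (n%:R `^ H) _ _ (SD (-1) _ _ S2 S1) S0.
rewrite (_ : (fun w => _) = X k)//.
by apply/funext => w; rewrite /X; ring.
Qed.

(** Self-similarity cancels the factor n^(2 H), and stationarity of the increments leaves only |k -
    l|. *)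
Lemma fbm_incr_cov_fgn k l : (k < n)%N -> (l < n)%N ->
  \int[P]_w (X k w * X l w) = fgn_cov H (maxn k l - minn k l).
Proof.
move=> kn ln; rewrite fbm_incr_cov; try exact: grid01; try exact/grid01/ltnW.
have n0 : (0 < n)%N by exact: leq_ltn_trans kn.
have n0' : 0 < n%:R :> R by rewrite ltr0n.
have nH : n%:R `^ H * n%:R `^ H = n%:R `^ (2 * H).
  rewrite -powRD; last by rewrite (gt_eqF n0') implybT.
  by congr (_ `^ _); ring.
have nH0 : n%:R `^ (2 * H) != 0 :> R by rewrite gt_eqF// powR_gt0.
have E (x : R) : `|x / n%:R| `^ (2 * H) = `|x| `^ (2 * H) / n%:R `^ (2 * H).
  rewrite normrM normfV (gtr0_norm n0') powRM// ?invr_ge0 ?ltW//.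
  by rewrite -[n%:R^-1]powR_inv1 ?ltW// -powRrM mulN1r powRN.
have D (i j : nat) : `|i%:R / n%:R - j%:R / n%:R| `^ (2 * H) =
    `|i%:R - j%:R : R| `^ (2 * H) / n%:R `^ (2 * H).
  by rewrite -mulrBl E.
rewrite nH /cov !D.
rewrite [LHS](_ : _ = (`|k.+1%:R - l%:R : R| `^ (2 * H) + `|k%:R - l.+1%:R : R| `^ (2 * H)
  - `|k.+1%:R - l.+1%:R : R| `^ (2 * H) - `|k%:R - l%:R : R| `^ (2 * H)) / 2); last first.
  by field.
have kl1 : k.+1%:R - l.+1%:R = k%:R - l%:R :> R.
  by rewrite -(natr1 k) -(natr1 l); ring.
rewrite kl1 /fgn_cov; have [kl|lk] := leqP k l.
  set r := (l - k)%N; have lE : l%:R = k%:R + r%:R :> R by rewrite -natrD subnKC.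
  have a1 : `|k.+1%:R - l%:R| = `|r%:R - 1| :> R.
    by rewrite distrC; congr `|_|; rewrite lE -natr1; ring.
  have a2 : `|k%:R - l.+1%:R| = r.+1%:R :> R.
    rewrite distrC (_ : _ - _ = r.+1%:R) ?normr_nat//.
    by rewrite -natr1 lE -[r.+1%:R]natr1; ring.
  have a3 : `|k%:R - l%:R| = r%:R :> R.
    by rewrite distrC (_ : _ - _ = r%:R) ?normr_nat// lE; ring.
  by rewrite a1 a2 a3; ring.
set r := (k - l)%N; have kE : k%:R = l%:R + r%:R :> R.
  by rewrite -natrD subnKC// ltnW.
have a1 : `|k.+1%:R - l%:R| = r.+1%:R :> R.
  rewrite (_ : _ - _ = r.+1%:R) ?normr_nat//.
  by rewrite -natr1 kE -[r.+1%:R]natr1; ring.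
have a2 : `|k%:R - l.+1%:R| = `|r%:R - 1| :> R.
  by congr `|_|; rewrite kE -natr1; ring.
have a3 : `|k%:R - l%:R| = r%:R :> R.
  by rewrite (_ : _ - _ = r%:R) ?normr_nat// kE; ring.
by rewrite a1 a2 a3; ring.
Qed.

Lemma fbm_incr_var k : (k < n)%N -> \int[P]_w (X k w ^+ 2) = 1.
Proof.
move=> kn; under eq_Rintegral do rewrite expr2.
rewrite fbm_incr_cov_fgn// maxnn minnn subnn /fgn_cov.
rewrite powR0 ?mulr0 ?subr0 ?mulf_neq0 ?gt_eqF// powR1 sub0r normrN normr1 powR1.
by rewrite divff.
Qed.

Variable q : nat.

Let V := hermite_variation q H B n.

Let VE w : V w = \sum_(k < n) (hermite_poly R q).[X k w].
Proof. by apply: eq_bigr => k _; rewrite hermiteE. Qed.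

Lemma hermite_variation_measurable : measurable_fun setT V.
Proof.
rewrite (_ : V = fun w => \sum_(k < n) (hermite_poly R q).[X k w]); last first.
  exact/funext.
apply: measurable_sum => k.
exact: (gaussian_space_poly_measurable gS _ (fbm_incr_span (ltn_ord k))).
Qed.

Lemma hermite_variation_sqr : (\int[P]_w (V w ^+ 2)%:E =
  (\sum_(k < n) \sum_(l < n) fgn_cov H (maxn k l - minn k l) ^+ q * q`!%:R)%:E)%E.
Proof.
have iM (k l : 'I_n) : P.-integrable setT (EFin \o (fun w =>
    (hermite_poly R q).[X k w] * (hermite_poly R q).[X l w])).
  exact: (gaussian_space_integrable_polyM gS _ _ (fbm_incr_span (ltn_ord k))
    (fbm_incr_span (ltn_ord l))).
transitivity (\int[P]_w (\sum_(k < n) (\sum_(l < n)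
    ((hermite_poly R q).[X k w] * (hermite_poly R q).[X l w])%:E)))%E.
  apply: eq_integral => w _; rewrite VE expr2 mulr_suml -sumEFin.
  by apply: eq_bigr => k _; rewrite mulr_sumr -sumEFin.
rewrite integral_sum//; last by move=> k; apply: integrable_sum => // l _; exact: iM.
rewrite -sumEFin; apply: eq_bigr => k _.
rewrite integral_sum//; last by move=> l; exact: iM.
rewrite -sumEFin; apply: eq_bigr => l _.
have := gaussian_space_hermite gS q (fbm_incr_span (ltn_ord k))
  (fbm_incr_span (ltn_ord l)) (fbm_incr_var (ltn_ord k)).
rewrite fbm_incr_cov_fgn// => <-; rewrite /Rintegral fineK//.
by apply: integrable_fin_num => //; exact: iM.
Qed.

(** The q-th power of the covariance decays like r^(-q (2 - 2 H)), and each distance between two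
    indices occurs at most 2 n times. *)
Lemma hermite_variation_sqr_le : (\int[P]_w (V w ^+ 2)%:E <=
  (2 * 12 ^+ q * q`!%:R * (n%:R * \sum_(r < n) r.+1%:R `^ (- (q%:R * (2 - 2 * H)))))%:E)%E.
Proof.
rewrite hermite_variation_sqr lee_fin.
pose a (r : nat) : R := r.+1%:R `^ (- (q%:R * (2 - 2 * H))).
have aE r : `|fgn_cov H r ^+ q| <= 12 ^+ q * a r.
  have H01 : 0 < H < 1 by rewrite H_gt0.
  rewrite normrX; apply: (@le_trans _ _ ((12 * r.+1%:R `^ (- (2 - 2 * H))) ^+ q)).
    by rewrite lerXn2r ?nnegrE ?mulr_ge0 ?powR_ge0// fgn_cov_le.
  rewrite exprMn -[(_ `^ _) ^+ q]powR_mulrn ?powR_ge0// -powRrM /a.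
  by rewrite (_ : - (2 - 2 * H) * q%:R = - (q%:R * (2 - 2 * H))); last by ring.
apply: (@le_trans _ _ (\sum_(k < n) \sum_(l < n)
    (12 ^+ q * q`!%:R) * a (maxn k l - minn k l)%N)).
  apply: ler_sum => k _; apply: ler_sum => l _.
  rewrite mulrAC ler_wpM2r//.
  exact: le_trans (ler_norm _) (aE _).
under eq_bigr do rewrite -mulr_sumr.
rewrite -mulr_sumr.
have := sum_dist_le n (fun r => powR_ge0 r.+1%:R (- (q%:R * (2 - 2 * H)))).
rewrite -/(a _) => h; rewrite -!mulrA [leRHS]mulrCA ler_wpM2l ?exprn_ge0//.
by rewrite [leRHS]mulrCA ler_wpM2l.
Qed.

End fbm.

(** * Small balls for the Hermite variation *)

Section hermite_small_ball.
Context d (T : measurableType d) (R : realType) (P : probability T R).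
Variable S : set (T -> R).
Hypothesis gS : gaussian_space P S.

(* Conditionally on the part of [X] orthogonal to [xi], the sum is a polynomial
   in [xi] whose leading coefficient is deterministic. *)
Lemma hermite_sum_small_ball n q (xi : T -> R) (X : 'I_n -> T -> R) (h k : R) :
  S xi -> (forall i, S (X i)) -> \int[P]_w (xi w ^+ 2) = 1 -> 0 < h ->
  2 ^+ q * k < (\sum_i (\int[P]_w (xi w * X i w)) ^+ q) * h ^+ q -> 0 <= k ->
  (P [set w | `|\sum_i (hermite_poly R q).[X i w]| <= k]%R <= (q%:R * (2 * h))%:E)%E.
Proof.
move=> Sxi SX xi1 h0 kh k0; set hp := hermite_poly R q.
have [hS _ SD] := gS.
pose u i := \int[P]_w (xi w * X i w).
pose Y i w := - u i * xi w + X i w; have SY i : S (Y i) by exact: SD.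
have xiY i : \int[P]_w (xi w * Y i w) = 0.
  transitivity (\int[P]_w (- u i * (xi w ^+ 2) + xi w * X i w)).
    by apply: eq_Rintegral => w _; rewrite /Y; ring.
  have i1 := gaussian_space_integrableX gS 2 Sxi.
  have i2 := gaussian_space_integrableM gS Sxi (SX i).
  rewrite RintegralD//; last exact: (integrableZl measurableT (- u i) i1).
  by rewrite RintegralZl// xi1 mulr1 addrC subrr.
pose Q (t : n.+1.-tuple R) : R :=
  \sum_i hp.[u i * tnth t ord0 + tnth t (lift ord0 i)].
have mQ : measurable_fun [set: n.+1.-tuple (measurableTypeR R)] Q.
  apply: measurable_sum => i; apply: (measurableT_comp (measurable_horner hp)).
  have m0 := @measurable_tnth _ (measurableTypeR R) n.+1 ord0.
  have m1 := @measurable_tnth _ (measurableTypeR R) n.+1 (lift ord0 i).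
  by apply: measurable_funD => //; exact: measurable_funM.
pose I := [set x : R | `|x| <= k].
have mI : measurable I.
  have -> : I = [set` `[- k, k]].
    by apply/seteqP; split => x; rewrite /I/= in_itv/= ler_norml.
  exact: measurable_itv.
pose F t := (\1_I (Q t))%:E : \bar R.
have mF : measurable_fun [set: n.+1.-tuple (measurableTypeR R)] F.
  by apply/measurable_EFinP; exact: measurable_indic_comp.
have F0 t : (0 <= F t)%E by rewrite lee_fin.
have QE w v : Q [tuple oapp (Y ^~ v) (xi w) (unlift ord0 i) | i < n.+1] =
    \sum_i hp.[u i * xi w + Y i v].
  apply: eq_bigr => i _.
  by rewrite !tnth_mktuple unlift_none liftK.
have E := gaussian_indep_ge0 gS Sxi SY xiY mF F0.
have mV : measurable_fun setT (fun w => \sum_i hp.[X i w]).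
  by apply: measurable_sum => i; exact: (gaussian_space_poly_measurable gS).
have mA : measurable [set w | `|\sum_i hp.[X i w]| <= k].
  by rewrite -[X in measurable X]setTI; exact: (mV measurableT _ mI).
rewrite -[X in P X]setIT -(integral_indic P measurableT mA).
rewrite [leLHS](_ : _ = \int[P]_w
    F [tuple oapp (Y ^~ w) (xi w) (unlift ord0 i) | i < n.+1])%E; last first.
  apply: eq_integral => w _; rewrite /F QE; congr EFin.
  rewrite (_ : \sum_i hp.[u i * xi w + Y i w] = \sum_i hp.[X i w])//.
  by apply: eq_bigr => i _; congr hp.[_]; rewrite /Y; ring.
rewrite E; pose b : \bar R := (q%:R * (2 * h))%:E.
apply: (@le_trans _ _ (\int[P]_v (cst b v))%E); last first.
  by rewrite integral_cst// [X in (_ * X)%E]probability_setT mule1.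
have mG : measurable_fun setT (fun v : T => (\int[P]_w
    F [tuple oapp (Y ^~ v) (xi w) (unlift ord0 i) | i < n.+1])%E).
  pose tX (z : T * T) : n.+1.-tuple (measurableTypeR R) :=
    [tuple oapp (Y ^~ z.2) (xi z.1) (unlift ord0 i) | i < n.+1].
  have mtX : measurable_fun setT tX.
    apply/measurable_fun_tnthP => i.
    rewrite (_ : _ \o _ = fun z => oapp (Y ^~ z.2) (xi z.1) (unlift ord0 i)).
      case: unliftP => [j|] _ /=; apply: measurableT_comp => //;
        exact: (gaussian_space_measurable gS).
    by apply/funext => z; rewrite /= tnth_mktuple.
  have mFX : measurable_fun setT (F \o tX) by exact: measurableT_comp.
  exact: (measurable_fun_fubini_tonelli_G (m1 := P) (F \o tX) mFX (fun z => F0 _)).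
apply: ge0_le_integral => //.
- by move=> v _; exact: integral_ge0.
move=> v _; rewrite /cst.
pose f := \sum_i (hp \Po (u i *: 'X + (Y i v)%:P)).
have fE x : f.[x] = \sum_i hp.[u i * x + Y i v].
  by rewrite /f horner_sum; apply: eq_bigr => i _; rewrite horner_comp !hornerE.
have sf : (size f <= q.+1)%N.
  rewrite /f; apply: (big_ind (fun p : {poly R} => size p <= q.+1)%N).
  - by rewrite size_poly0.
  - by move=> p r hp' hr; rewrite (leq_trans (size_polyD _ _))// geq_max hp' hr.
  - move=> i _; rewrite (leq_trans (size_comp_poly_leq _ _))// ltnS.
    have s1 : ((size hp).-1 <= q)%N by have := size_hermite_poly R q; rewrite -/hp; lia.
    have s2 : ((size (u i *: 'X + (Y i v)%:P)%R).-1 <= 1)%N.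
      have : (size (u i *: 'X + (Y i v)%:P)%R <= 2)%N.
        rewrite (leq_trans (size_polyD _ _))// geq_max.
        rewrite (leq_trans (size_scale_leq _ _)) ?size_polyX//=.
        by rewrite (leq_trans (size_polyC_leq1 _)).
      by lia.
    by rewrite -[leqRHS]muln1 leq_mul.
(* The coefficient is read off the q-th derivative, where the shifts Y i v have disappeared. *)
have fq : f`_q = \sum_i u i ^+ q.
  have D : f^`(q) = (\sum_i u i ^+ q * q`!%:R)%:P.
    rewrite /f linear_sum/= raddf_sum; apply: eq_bigr => i _.
    exact: derivn_hermite_aff.
  have := congr1 (fun p : {poly R} => p`_0) D.
  rewrite coef_derivn addn0 ffactnn coefC/= -mulr_suml -[f`_q *+ _]mulr_natr.
  by move=> /mulIf; apply; rewrite pnatr_eq0 -lt0n fact_gt0.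
have fk : 2 ^+ q * k < `|f`_q| * h ^+ q.
  apply: (lt_le_trans kh); rewrite fq; apply: ler_wpM2r; last exact: ler_norm.
  by rewrite exprn_ge0// ltW.
have [gxi Exi] := hS _ Sxi; have [mxi _] := gxi.
have XN := standard_gaussian_law gxi Exi xi1.
set D := [set x : R | `|f.[x]| <= k].
have mD : measurable D.
  rewrite -[X in measurable X]setTI.
  exact: (measurable_horner f measurableT mI).
have mxD : measurable (xi @^-1` D).
  by rewrite -[X in measurable X]setTI; exact: mxi.
apply: (@le_trans _ _ (P (xi @^-1` D))); last first.
  by rewrite (XN D mD); exact: (normal_small_ball h0 sf fk).
rewrite -[X in (_ <= P X)%E]setIT -(integral_indic P measurableT mxD).
rewrite le_eqVlt; apply/orP; left; apply/eqP.
by apply: eq_integral => w _; rewrite /F QE -fE.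
Qed.

End hermite_small_ball.

(** Convexity: the power lies above its tangent at m. The induction step multiplies by u and leaves
    the nonnegative remainder (q + 1) m^q (u - m)^2. *)
Lemma exprn_tangent_le (R : realDomainType) q (m u : R) : 0 <= m -> 0 <= u ->
  m ^+ q.+1 + q.+1%:R * m ^+ q * (u - m) <= u ^+ q.+1.
Proof.
move=> m0 u0; elim: q => [|q IH]; first by rewrite expr0 !expr1; lra.
rewrite [leRHS]exprS (le_trans _ (ler_wpM2l u0 IH))// -subr_ge0.
rewrite (_ : _ - _ = q.+1%:R * m ^+ q * (u - m) ^+ 2).
  by rewrite mulr_ge0 ?sqr_ge0// mulr_ge0 ?exprn_ge0.
by rewrite -[q.+2%:R]natr1 !exprS; ring.
Qed.

(** Jensen's inequality: the tangents are taken at the mean, so the linear terms cancel. *)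
Lemma sum_exprn_ge (R : realDomainType) n q (m : R) (u : 'I_n -> R) : 0 <= m ->
  (forall i, 0 <= u i) -> \sum_i u i = n%:R * m ->
  n%:R * m ^+ q.+1 <= \sum_i u i ^+ q.+1.
Proof.
move=> m0 u0 um.
apply: (@le_trans _ _ (\sum_i (m ^+ q.+1 + q.+1%:R * m ^+ q * (u i - m)))).
  rewrite big_split/= -mulr_sumr sumrB um !sumr_const card_ord.
  by rewrite -[m *+ n]mulr_natl subrr mulr0 addr0 mulr_natl.
by apply: ler_sum => i _; exact: exprn_tangent_le.
Qed.

Section fbm_small_ball.
Context d (T : measurableType d) (R : realType) (P : probability T R).
Variables (H : R) (B : R -> T -> R).
Hypotheses (H_gt0 : 0 < H) (H_lt1 : H < 1) (fbmB : fbm P H B).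

Lemma hermite_variation_small_ball n q (h k : R) : (0 < n)%N -> (0 < q)%N ->
  0 < h -> 0 <= k -> 2 ^+ q * k < n%:R `^ (1 - q%:R * (1 - H)) * h ^+ q ->
  (P [set w | `|hermite_variation q H B n w| <= k]%R <= (q%:R * (2 * h))%:E)%E.
Proof.
move=> n0 q0 h0 k0 kh.
have [t0 t1] : (0 : R) \in `[0, 1] /\ (1 : R) \in `[0, 1].
  by rewrite !in_itv/= !lexx ler01.
have n0' : 0 < n%:R :> R by rewrite ltr0n.
have H20 : 2 * H != 0 by rewrite mulf_neq0// gt_eqF.
have H20' : 0 <= 2 * H by rewrite mulr_ge0// ltW.
have grid (j : nat) : (j <= n)%N -> (j%:R / n%:R : R) \in `[0, 1].
  by move=> jn; rewrite in_itv/= divr_ge0//= ler_pdivrMr// mul1r ler_nat.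
have gS := gaussian_process_span fbmB.
(* Almost surely equal to B_1; written as a scaled increment so that [fbm_incr_cov] applies. *)
pose xi (w : T) := 1 * (B 1 w - B 0 w).
pose X (i : nat) (w : T) := n%:R `^ H * (B (i.+1%:R / n%:R) w - B (i%:R / n%:R) w).
(* The covariance of B_1 and B_s. Both s^(2 H) and -(1 - s)^(2 H) are nondecreasing, whence the
   nonnegativity of the projections. *)
pose g (s : R) := (1 + s `^ (2 * H) - (1 - s) `^ (2 * H)) / 2.
have Sxi : process_span B xi.
  have [_ _ SD] := gS.
  rewrite (_ : xi = fun w => -1 * B 0 w + B 1 w).
    by apply: SD; apply: process_span_B.
  by apply/funext => w; rewrite /xi; ring.
have xi2 : \int[P]_w (xi w ^+ 2) = 1.
  rewrite (_ : (fun w => _) = fun w => xi w * xi w); last exact/funext.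
  rewrite (fbm_incr_cov fbmB)// !subrr normr0 !subr0 sub0r normrN normr1 powR1.
  by rewrite powR0//; field.
have uE (i : 'I_n) : \int[P]_w (xi w * X i w) =
    n%:R `^ H * (g (i.+1%:R / n%:R) - g (i%:R / n%:R)).
  have gi := grid _ (ltn_ord i); have gi' := grid _ (ltnW (ltn_ord i)).
  rewrite (fbm_incr_cov fbmB)// powR1 powR0// !sub0r !normrN.
  have ab (s : R) : s \in `[0, 1] -> `|1 - s| = 1 - s /\ `|s| = s.
    rewrite in_itv/= => /andP[s0 s1]; split; first by rewrite ger0_norm// subr_ge0.
    exact: ger0_norm.
  have [-> ->] := ab _ gi; have [-> ->] := ab _ gi'.
  by rewrite /g; ring.
have u0 (i : 'I_n) : 0 <= \int[P]_w (xi w * X i w).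
  rewrite uE mulr_ge0 ?powR_ge0// subr_ge0.
  have gi := grid _ (ltn_ord i); have gi' := grid _ (ltnW (ltn_ord i)).
  move: gi gi'; rewrite !in_itv/= => /andP[a0 a1] /andP[b0 b1].
  have ba : i%:R / n%:R <= i.+1%:R / n%:R :> R.
    by rewrite ler_pM2r ?invr_gt0// ler_nat.
  rewrite /g ler_pM2r ?invr_gt0//; apply: lerB.
    by rewrite lerD2l ge0_ler_powR// nnegrE.
  by rewrite ge0_ler_powR// ?nnegrE ?subr_ge0// lerB.
(* The sum telescopes to n^H (g 1 - g 0) = n^H, written as n times the mean n^(H - 1) for Jensen's
   inequality. *)
have usum : \sum_(i < n) \int[P]_w (xi w * X i w) = n%:R * n%:R `^ (H - 1).
  under eq_bigr do rewrite uE.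
  rewrite -mulr_sumr -(big_mkord xpredT (fun i => g (i.+1%:R / n%:R) - g (i%:R / n%:R))).
  rewrite (telescope_sumr (fun i => g (i%:R / n%:R)))//.
  rewrite mul0r divff ?gt_eqF// /g subrr subr0 powR1 powR0//.
  rewrite -[X in X * n%:R `^ (H - 1)]powRr1 ?(ltW n0')// -powRD; last first.
    by rewrite (gt_eqF n0') implybT.
  by rewrite (_ : 1 + (H - 1) = H); [field|ring].
have kh' : 2 ^+ q * k < (\sum_(i < n) (\int[P]_w (xi w * X i w)) ^+ q) * h ^+ q.
  apply: (lt_le_trans kh); apply: ler_wpM2r; first by rewrite exprn_ge0// ltW.
  have := sum_exprn_ge q.-1 (powR_ge0 _ _) u0 usum; rewrite prednK//; apply: le_trans.
  rewrite -powR_mulrn ?powR_ge0// -powRrM -[X in _ <= X * _]powRr1 ?(ltW n0')//.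
  rewrite -powRD; last by rewrite (gt_eqF n0') implybT.
  by rewrite (_ : 1 + (H - 1) * q%:R = 1 - q%:R * (1 - H))//; ring.
have := hermite_sum_small_ball gS Sxi
  (fun i : 'I_n => fbm_incr_span fbmB (ltn_ord i)) xi2 h0 kh' k0.
rewrite (_ : [set w | _] = [set w | `|hermite_variation q H B n w| <= k])//.
apply/seteqP; split => w /=; rewrite /hermite_variation.
  by under [X in _ -> `|X| <= _]eq_bigr do rewrite hermiteE.
by under [X in `|X| <= _ -> _]eq_bigr do rewrite hermiteE.
Qed.

End fbm_small_ball.

(** * Tail probabilities and small balls from convergence in law *)

Section tails.
Context d (T : measurableType d) (R : realType) (P : probability T R).

Lemma measurable_gt_norm (V : T -> R) (k : R) : measurable_fun setT V ->
  measurable [set w | k < `|V w|].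
Proof.
move=> mV; rewrite (_ : [set w | _] = (Num.norm \o V) @^-1` `]k, +oo[).
  rewrite -[X in measurable X]setTI.
  exact: (measurableT_comp (@normr_measurable _ setT) mV).
by apply/seteqP; split => w /=; rewrite in_itv/= andbT.
Qed.

Lemma measurable_le_norm (V : T -> R) (k : R) : measurable_fun setT V ->
  measurable [set w | `|V w| <= k].
Proof.
move=> mV; rewrite (_ : [set w | _] = ~` [set w | k < `|V w|]).
  exact/measurableC/measurable_gt_norm.
by apply/seteqP; split => w /=; rewrite leNgt => /negP.
Qed.

Lemma prob_gt_ge (V : T -> R) (k b : R) : measurable_fun setT V ->
  (P [set w | `|V w| <= k]%R <= b%:E)%E ->
  1 - b <= fine (P [set w | k < `|V w|]%R).
Proof.
move=> mV; rewrite (_ : [set w | `|V w| <= k] = ~` [set w | k < `|V w|]).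
  have mA := measurable_gt_norm k mV.
  rewrite (probability_setC P mA) -[X in (1 - X <= _)%E]fineK ?fin_num_measure//.
  by rewrite -EFinB lee_fin lerBlDl addrC -lerBlDl.
by apply/seteqP; split => w /=; rewrite leNgt => /negP.
Qed.

Lemma tail_prob_le (V : T -> R) (k M : R) : measurable_fun setT V -> 0 < k ->
  (\int[P]_w (V w ^+ 2)%:E <= M%:E)%E ->
  fine (P [set w | k < `|V w|]%R) * k ^+ 2 <= M.
Proof.
move=> mV k0 VM; have mA := measurable_gt_norm k mV.
rewrite -lee_fin EFinM fineK ?fin_num_measure// muleC (le_trans _ VM)//.
apply: le_trans (second_moment_tail P mV k0).
apply: lee_wpmul2l; first by rewrite lee_fin sqr_ge0.
apply: le_measure; rewrite ?inE//; last by move=> w /= /ltW.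
rewrite (_ : [set w | _] = (Num.norm \o V) @^-1` `[k, +oo[).
  rewrite -[X in measurable X]setTI.
  exact: (measurableT_comp (@normr_measurable _ setT) mV).
by apply/seteqP; split => w /=; rewrite in_itv/= andbT.
Qed.

(** The continuous function g is at least 1 on [-eta, eta], at most 2, and 0 outside
    [-2 eta, 2 eta], an interval of normal mass at most 4 eta. Its normal mean is thus at most 8
    eta; the constant 9 leaves room to pass from the limit to all large n. *)
Lemma cvg_in_law_small_ball (X : nat -> T -> R) (eta : R) :
  (forall n, measurable_fun setT (X n)) -> cvg_in_law P X (normal_prob 0 1) ->
  0 < eta -> exists N, forall n, (N <= n)%N ->
    (P [set w | `|X n w| <= eta]%R <= (9 * eta)%:E)%E.
Proof.
move=> mX XN eta0; pose g (x : R) := Num.max 0 (2 - `|x| / eta).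
have cg : continuous g.
  move=> x; apply: (@continuous_max R R (fun=> 0) (fun y => 2 - `|y| / eta)).
    exact: cvg_cst.
  apply: (@cvgB _ R^o); first exact: cvg_cst.
  by apply: cvgM; [exact: norm_continuous|exact: cvg_cst].
have mg : measurable_fun setT g by exact: continuous_measurable_fun.
have g0 x : 0 <= g x by rewrite le_max lexx.
have g2 x : g x <= 2.
  by rewrite ge_max ler0n/= gerBl divr_ge0// ltW.
have g1 x : `|x| <= eta -> 1 <= g x.
  move=> xe; rewrite le_max; apply/orP; right.
  have : `|x| / eta <= 1 by rewrite ler_pdivrMr// mul1r.
  lra.
have gout x : 2 * eta < `|x| -> g x = 0.
  by move=> xe; apply/max_idPl; rewrite subr_le0 ler_pdivlMr// ltW.
pose D := [set x : R | `|x| <= 2 * eta].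
have mD : measurable D.
  have -> : D = [set` `[- (2 * eta), 2 * eta]].
    by apply/seteqP; split => x; rewrite /D/= in_itv/= ler_norml.
  exact: measurable_itv.
have e20 : 0 < 2 * eta by rewrite mulr_gt0.
have DN : (normal_prob 0 1 D <= (4 * eta)%:E)%E.
  have := @normal_cover_le R [:: 0] (2 * eta) D e20 mD.
  rewrite mul1r (_ : 2 * (2 * eta) = 4 * eta); last by ring.
  by apply=> x Dx; exists 0; rewrite ?inE// subr0.
have gN : (\int[normal_prob 0 1]_x (g x)%:E <= (8 * eta)%:E)%E.
  apply: (@le_trans _ _ (\int[normal_prob 0 1]_x (2%:E * (\1_D x)%:E))%E).
    apply: ge0_le_integral => //.
    - by move=> x _; rewrite lee_fin.
    - by apply/measurable_EFinP.
    - by apply: measurable_funeM; apply/measurable_EFinP; exact: measurable_indic.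
    - move=> x _; rewrite -EFinM lee_fin indicE.
      have [xD|] := boolP (x \in D); first by rewrite mulr1.
      by rewrite notin_setE /D/= => /negP; rewrite -ltNge => /gout ->; rewrite mulr0.
  rewrite ge0_integralZl//; last first.
    by apply/measurable_EFinP; exact: measurable_indic.
  have -> : (\int[normal_prob 0 1]_x (\1_D x)%:E = normal_prob 0 1 D)%E.
    by rewrite -[in RHS](setIT D); exact: integral_indic.
  apply: (@le_trans _ _ (2%:E * (4 * eta)%:E)%E); first exact: lee_wpmul2l.
  by rewrite -EFinM lee_fin; lra.
have gN' : (\int[normal_prob 0 1]_x (g x)%:E < (9 * eta)%:E)%E.
  by apply: (le_lt_trans gN); rewrite lte_fin; lra.
have bg : exists M, forall x, `|g x| <= M by exists 2 => x; rewrite ger0_norm.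
have [N _ NP] := XN g cg bg _ (open_ereal_lt' gN').
exists N => n /NP /= /ltW; apply: le_trans.
rewrite unlock.
have mA := measurable_le_norm eta (mX n).
rewrite -[X in P X]setIT -(integral_indic P measurableT mA).
apply: ge0_le_integral => //.
- by apply/measurable_EFinP; exact: measurable_indic.
- by apply/measurable_EFinP; exact: measurableT_comp.
- move=> w _; rewrite lee_fin indicE.
  by case: (boolP (w \in _)) => [/set_mem/g1|_] /=.
Qed.

End tails.

(** * The two limits *)

Section exact_asymptotics.
Context d (T : measurableType d) (R : realType) (P : probability T R).
Variables (q : nat) (H : R) (B : R -> T -> R).
Hypotheses (q_ge2 : (2 <= q)%N) (H_gt0 : 0 < H) (H_lt1 : H < 1).
Hypothesis fbmB : fbm P H B.

Local Notation V := (hermite_variation q H B).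

Let mV n : measurable_fun setT (V n) := hermite_variation_measurable fbmB n q.

Let K : R := 2 * 12 ^+ q * q`!%:R.

Let K0 : 0 <= K. Proof. by rewrite !mulr_ge0// exprn_ge0. Qed.

Let mA n k : measurable [set w | k < `|V n w|] := measurable_gt_norm k (mV n).

Let p01 (n : nat) (k : R) : 0 <= fine (P [set w | k < `|V n w|]%R) <= 1.
Proof.
rewrite fine_ge0 ?measure_ge0//= -lee_fin fineK; first exact: probability_le1.
exact: fin_num_measure.
Qed.

Let fE (k : nat -> R) :
  (\sum_(1 <= n <oo) (n%:R^-1)%:E * P [set w | k n < `|V n w|]%R =
   \sum_(1 <= n <oo) (n%:R^-1 * fine (P [set w | k n < `|V n w|]%R))%:E)%E.
Proof.
by apply: eq_eseriesr => n _; rewrite EFinM fineK// fin_num_measure.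
Qed.

Lemma central_asymptotics (c : R) : H < 1 - (2 * q%:R)^-1 ->
  central_constant P q H B c ->
  (((- ln (c^-1 * eps))^-1)%:E * f1 P q H B eps)%E @[eps --> 0^'+] --> 2%:E.
Proof.
move=> Hq [c0 VN].
have q0 : 0 < q%:R :> R by rewrite ltr0n (leq_trans _ q_ge2).
have g1 : 1 < q%:R * (2 - 2 * H).
  have : (2 * q%:R)^-1 * (2 * q%:R) < (1 - H) * (2 * q%:R).
    by rewrite ltr_pM2r ?mulr_gt0//; lra.
  by rewrite mulVf ?gt_eqF ?mulr_gt0//; lra.
have [C C0 SC] := sum_powR_gt1 g1.
under eq_fun do rewrite /f1 fE.
have half0 : 0 < 2^-1 :> R by rewrite invr_gt0.
rewrite (_ : 2 = 2^-1^-1 :> R); last by rewrite invrK.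
apply: (@log_average_cvg R (fun n e => fine (P [set w | e * n%:R < `|V n w|]%R))
  2^-1 (K * C) c) => //.
- by rewrite mulr_ge0.
- move=> n e n0 e0; have n0' : 0 < n%:R :> R by rewrite ltr0n.
  have en0 : 0 < e * n%:R by rewrite mulr_gt0.
  have h := tail_prob_le (mV n) en0 (hermite_variation_sqr_le H_gt0 H_lt1 fbmB n q).
  rewrite powR12_sqrt ?(ltW n0')// exprMn sqr_sqrtr ?(ltW n0')//.
  rewrite -(ler_pM2r n0'); apply: (@le_trans _ _ (K * (n%:R * C))); last first.
    by rewrite le_eqVlt; apply/orP; left; apply/eqP; ring.
  apply: (@le_trans _ _ (K * (n%:R * \sum_(r < n) r.+1%:R `^ (- (q%:R * (2 - 2 * H)))))).
    apply: le_trans h; rewrite le_eqVlt; apply/orP; left; apply/eqP.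
    by rewrite exprMn [n%:R ^+ 2]expr2 !mulrA.
  by rewrite ler_wpM2l// ler_wpM2l.
- move=> dl dl0; have eta0 : 0 < dl / 9 by rewrite divr_gt0.
  have mX n : measurable_fun setT (fun w => V n w / (c * Num.sqrt n%:R)).
    by apply: measurable_funM.
  have [N NP] := cvg_in_law_small_ball mX VN eta0.
  (* If e sqrt(n) <= c dl / 9, then |V_n| <= e n forces |V_n| / (c sqrt(n)) <= dl / 9, an event of
     probability at most dl for large n. *)
  exists (c * (dl / 9)); first by rewrite mulr_gt0.
  exists N.+1 => n e Nn e0 en; have n0 : (0 < n)%N by exact: leq_ltn_trans Nn.
  have n0' : 0 < n%:R :> R by rewrite ltr0n.
  have s0 : 0 < Num.sqrt n%:R :> R by rewrite sqrtr_gt0.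
  apply: prob_gt_ge => //; have := NP n (ltnW Nn).
  rewrite (_ : 9 * (dl / 9) = dl); last by field.
  apply: le_trans; apply: le_measure; rewrite ?inE.
  + exact: measurable_le_norm.
  + exact: measurable_le_norm.
  + move=> w /= wV; rewrite normrM normfV (gtr0_norm (mulr_gt0 c0 s0)).
    rewrite ler_pdivrMr ?mulr_gt0// (le_trans wV)//.
    rewrite -[X in e * X]sqr_sqrtr ?(ltW n0')// expr2 mulrA [leRHS]mulrA.
    apply: ler_wpM2r; first exact: ltW.
    by rewrite [leRHS]mulrC -powR12_sqrt// ltW.
Qed.

Lemma noncentral_asymptotics (c : R) : 1 - (2 * q%:R)^-1 < H -> 0 < c ->
  (((- ln (c^-1 * eps))^-1)%:E * f2 P q H B eps)%E @[eps --> 0^'+]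
    --> ((1 - q%:R * (1 - H))^-1)%:E.
Proof.
move=> Hq c0; have q0 : 0 < q%:R :> R by rewrite ltr0n (leq_trans _ q_ge2).
set a := 1 - q%:R * (1 - H).
have g1 : q%:R * (2 - 2 * H) < 1.
  have : (1 - H) * (2 * q%:R) < (2 * q%:R)^-1 * (2 * q%:R).
    by rewrite ltr_pM2r ?mulr_gt0//; lra.
  by rewrite mulVf ?gt_eqF ?mulr_gt0//; lra.
have a0 : 0 < a by rewrite /a; lra.
have g01 : 0 < q%:R * (2 - 2 * H) < 1.
  by rewrite g1 andbT mulr_gt0//; have := H_lt1; lra.
have [C C0 SC] := sum_powR_lt1 g01.
have a2 n : (0 < n)%N -> n%:R `^ (2 - 2 * q%:R * (1 - H)) = (n%:R `^ a) ^+ 2 :> R.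
  move=> n0; rewrite -powR_mulrn ?powR_ge0// -powRrM.
  by congr (_ `^ _); rewrite /a; ring.
under eq_fun do rewrite /f2 fE.
apply: (@log_average_cvg R
  (fun n e => fine (P [set w | e * n%:R `^ (2 - 2 * q%:R * (1 - H)) < `|V n w|]%R))
  a (K * C) c) => //.
- by rewrite mulr_ge0.
- move=> n e n0 e0; have n0' : 0 < n%:R :> R by rewrite ltr0n.
  have na0 : 0 < n%:R `^ a by rewrite powR_gt0.
  have na20 : 0 < (n%:R `^ a) ^+ 2 by rewrite exprn_gt0.
  rewrite a2//; have en0 : 0 < e * (n%:R `^ a) ^+ 2 by rewrite mulr_gt0.
  have h := tail_prob_le (mV n) en0 (hermite_variation_sqr_le H_gt0 H_lt1 fbmB n q).
  rewrite -(ler_pM2r na20).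
  (* The second moment is at most K C n^(2 a); against the squared threshold e^2 n^(4 a), this gives
     K C / (e n^a)^2. *)
  apply: (@le_trans _ _ (K * (n%:R * (C * n%:R `^ (1 - q%:R * (2 - 2 * H)))))).
    apply: (@le_trans _ _ (K * (n%:R * \sum_(r < n) r.+1%:R `^ (- (q%:R * (2 - 2 * H)))))).
      apply: le_trans h; rewrite le_eqVlt; apply/orP; left; apply/eqP.
      by rewrite -mulrA; congr (_ * _); rewrite !expr2; ring.
    by rewrite ler_wpM2l// ler_wpM2l.
  rewrite -a2// le_eqVlt; apply/orP; left; apply/eqP.
  rewrite -[RHS]mulrA; congr (_ * _); rewrite mulrCA; congr (_ * _).
  rewrite -[X in X * _]powRr1 ?(ltW n0')// -powRD; last first.
    by rewrite (gt_eqF n0') implybT.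
  by congr (_ `^ _); ring.
(* Chosen so that the small ball bound q (2 h) equals dl. *)
- move=> dl dl0; pose h := dl / (2 * q%:R).
  have h0 : 0 < h by rewrite divr_gt0// mulr_gt0.
  have q2 : 0 < (2 : R) ^+ q by rewrite exprn_gt0.
  have hq0 : 0 < h ^+ q by rewrite exprn_gt0.
  (* The small ball lemma at k = e n^(2 a) asks for e n^a < (h / 2)^q; the last factor 1/2 provides
     the strict inequality. *)
  exists (h ^+ q / 2 ^+ q / 2); first by rewrite !divr_gt0.
  exists 1%N => n e n0 e0 en; have n0' : 0 < n%:R :> R by rewrite ltr0n.
  have na0 : 0 < n%:R `^ a by rewrite powR_gt0.
  apply: prob_gt_ge => //; rewrite (_ : dl = q%:R * (2 * h)); last first.
    by rewrite /h; field; rewrite gt_eqF.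
  apply: hermite_variation_small_ball => //.
  + exact: leq_trans q_ge2.
  + by rewrite mulr_ge0 ?powR_ge0// ltW.
  + rewrite a2// -/a expr2 mulrA mulrA [ltRHS]mulrC ltr_pM2r// -mulrA mulrC.
    apply: (@le_lt_trans _ _ (h ^+ q / 2 ^+ q / 2 * 2 ^+ q)); first by rewrite ler_pM2r.
    rewrite mulrAC divfK ?gt_eqF//; lra.
Qed.

End exact_asymptotics.

Unset Implicit Arguments.

Theorem theorem2 (R : realType) (q : nat) (H : R)
    (d : measure_display) (T : measurableType d) (P : probability T R)
    (B : R -> T -> R)
    (q_ge2 : (2 <= q)%N) (H_gt0 : 0 < H) (H_lt1 : H < 1) (fbmB : fbm P H B) :
  (H < 1 - (2 * q%:R)^-1 ->
   forall c1 : R, central_constant P q H B c1 ->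
     (((- ln (c1^-1 * eps))^-1)%:E * f1 P q H B eps)%E @[eps --> 0^'+]
       --> 2%:E)
  /\
  (1 - (2 * q%:R)^-1 < H ->
   forall c2 : R, noncentral_constant q H c2 ->
     (((- ln (c2^-1 * eps))^-1)%:E * f2 P q H B eps)%E @[eps --> 0^'+]
       --> ((1 - q%:R * (1 - H))^-1)%:E).
Proof.
split=> [Hq c1 hc1|Hq c2 [c2_gt0 _]]; first exact: central_asymptotics.
exact: noncentral_asymptotics.
Qed.
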